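(* Let $f$ belong to the class $C$ of normalized convex univalent functions, let $\beta$ be its lower order and let $\Theta\big(f(\mathbb{D})\big)$ be the angle at infinity of its range. Then $$\Theta\big(f(\mathbb{D})\big)=\beta\pi.$$
   Context: $\mathbb{D}$ is the open unit disk. $S$ is the class of univalent (injective holomorphic) functions $f(z)=z+\sum_{n=2}^\infty a_nz^n$ in $\mathbb{D}$. $C\subset S$ consists of those $f\in S$ whose range $f(\mathbb{D})$ is a convex set. The lower order of $f$ is $$\beta=\inf_{\zeta\in\mathbb{D}}|A_f(\zeta)|,\qquad A_f(\zeta)=\frac12(1-|\zeta|^2)\frac{f''(\zeta)}{f'(\zeta)}-\overline{\zeta}.$$ The angle at infinity of a convex domain $\Omega$ is $$\Theta(\Omega)=\inf\{\theta\in[0,\pi]:\ \Omega\text{ is contained in a sector of aperture }\theta\},$$ where a sector of aperture $\theta\in(0,\pi]$ is a set of the form $\{w_0+\rho e^{i\varphi}:\rho>0,\ |\varphi-\varphi_0|<\theta/2\}$ with $w_0\in\mathbb{C}$, $\varphi_0\in\mathbb{R}$, and a sector of aperture zero means an infinite strip (the region between two parallel lines). *)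

(* Defs.v *)
(* Stdlib reals with Coquelicot's complex numbers.  Functions on the unit disk
   are total functions C -> C; only their values on the disk matter. *)
From Stdlib Require Export Reals.
From Coquelicot Require Export Coquelicot.

Open Scope R_scope.

Definition unit_disk (z : C) : Prop := Cmod z < 1.

Definition image (f : C -> C) (D : C -> Prop) (w : C) : Prop :=
  exists z : C, D z /\ w = f z.

Definition convex (E : C -> Prop) : Prop :=
  forall (x y : C) (t : R), E x -> E y -> 0 <= t <= 1 ->
    E ((1 - t)%R * x + t * y)%C.

Definition holomorphic_on (D : C -> Prop) (f : C -> C) : Prop :=
  forall z : C, D z -> @ex_derive C_AbsRing C_NormedModule f z.

Definition injective_on (D : C -> Prop) (f : C -> C) : Prop :=
  forall z w : C, D z -> D w -> f z = f w -> z = w.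

Definition class_S (f : C -> C) : Prop :=
  holomorphic_on unit_disk f /\
  injective_on unit_disk f /\
  exists a : nat -> C,
    a 0%nat = 0%C /\ a 1%nat = 1%C /\
    forall z : C, unit_disk z ->
      @is_pseries C_AbsRing C_NormedModule a z (f z).

Definition class_C (f : C -> C) : Prop :=
  class_S f /\ convex (image f unit_disk).

(* [C_derive] is a total operator; by [C_derive_correct] it is the complex
   derivative wherever that derivative exists, so no junk value enters for
   functions that are univalent in the disk and points of the disk. *)
Definition A_op (f : C -> C) (zeta : C) : C :=
  ((1 / 2)%R * (1 - Cmod zeta ^ 2)%R *
     (C_derive (C_derive f) zeta / C_derive f zeta) - Cconj zeta)%C.

Definition lower_order (f : C -> C) : Rbar :=
  Glb_Rbar (fun r : R =>
    exists zeta : C, unit_disk zeta /\ r = Cmod (A_op f zeta)).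

Definition expi (phi : R) : C := (cos phi, sin phi).

Definition open_sector (w0 : C) (phi0 theta : R) (w : C) : Prop :=
  exists rho phi : R,
    0 < rho /\ Rabs (phi - phi0) < theta / 2 /\ w = (w0 + rho * expi phi)%C.

(* The region between the parallel lines
   { Re (e^{-i phi} w) = a } and { Re (e^{-i phi} w) = b }. *)
Definition open_strip (phi a b : R) (w : C) : Prop :=
  a < Re (expi (- phi) * w)%C < b.

Definition sector_of_aperture (theta : R) (T : C -> Prop) : Prop :=
  (0 < theta <= PI /\
     exists (w0 : C) (phi0 : R), forall w, T w <-> open_sector w0 phi0 theta w)
  \/
  (theta = 0 /\
     exists phi a b : R, a < b /\ forall w, T w <-> open_strip phi a b w).

Definition angle_at_infinity (Omega : C -> Prop) : Rbar :=
  Glb_Rbar (fun theta : R =>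
    0 <= theta <= PI /\
    exists T : C -> Prop,
      sector_of_aperture theta T /\ forall w, Omega w -> T w).

(* Main.v *)
Require Import Defs.
From Stdlib Require Import Lra Psatz Lia IndefiniteDescription Classical.

(** Why the theorem holds. Write [A_f] for [A_op f] and [W] for the range of [f].
    Two inequalities are proved, and one sharp estimate serves both of them
    ([strip_derive]): if [|Im g| <= M] in the disk, then
    [(1 - |z|^2) |g' z| <= 4 M / PI].

    The lower order is at most [theta / PI] when [W] lies in a sector of aperture
    [theta]. Applied to [g = log (f - w0)], the estimate gives
    [(1 - |z|^2) |f'| <= (2 theta / PI) |f - w0|], and after one integration
    [|f'| = O((1 - |z|^2) ^ (- 1 - theta / PI))] ([lower_order_sector]); for a
    strip it is applied to [f] itself. Hence, for [b > theta / PI], the function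
    [ln |f'| + (1 + b) ln (1 - |z|^2)] tends to [- oo] at the unit circle. It has a
    maximum in the disk, and at a critical point [A_f z = b conj z], so that
    [|A_f z| <= b] ([lower_order_le_growth]).

    The angle at infinity is at most [PI |A_f zeta|] for every [zeta]. Let
    [|A_f zeta| < gam < 1], and suppose that [W] lies in no strip and in no sector
    of aperture [gam PI]. By a separation argument in the plane
    ([recession_sector]), [W + v] is contained in [W] for all [v] of a sector of
    aperture [gam PI]. The maps [f^{-1} (f z + t v)] then send the disk into
    itself, and their generator is [v / f']. They contract the hyperbolic metric;
    differentiating the Schwarz-Pick inequality at [t = 0], and letting one of its
    two points tend to the boundary point [tau] that corresponds to infinity in
    the sector, one obtains the condition of Berkson and Porta ([berkson_porta]):
    [Re (v P) >= 0] for [P z = conj tau / (f' z (1 - conj tau z)^2)]. As it holds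
    for all these [v] with the same [tau], the values of [P] lie in a sector of
    aperture [(1 - gam) PI], and the strip estimate for [log P] says that [A_f zeta]
    is within [1 - gam] of a unimodular number ([A_op_ge_recession]). So
    [|A_f zeta| >= gam], a contradiction. When [|A_f zeta| >= 1] it is enough that
    [W] lies in a half-plane, which holds because [W] is convex and is not the
    whole plane.

    The function theory rests on the mean value property over concentric circles,
    proved by differentiation under the integral sign and stated with one
    exceptional point at which only continuity is assumed ([mean_value]). This
    covers the difference quotients in the Schwarz lemma and in the proof that
    [f'] has no zero ([univalent_derive_neq_0]). *)

(** * Complex derivatives *)

Notation is_Cderive := (@is_derive C_AbsRing C_NormedModule).
Notation Ccontinuous := (@continuous C_UniformSpace C_UniformSpace).

Lemma is_Cderive_eps (f : C -> C) (z l : C) :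
  is_Cderive f z l <->
  forall eps, 0 < eps -> exists d, 0 < d /\ forall w, Cmod (w - z) < d ->
    Cmod (f w - f z - l * (w - z)) <= eps * Cmod (w - z).
Proof.
  split.
  - intros [_ H] eps He.
    destruct (H z (fun P HP => HP) (mkposreal eps He)) as [d Hd].
    exists d; split; [apply cond_pos|].
    intros w Hw. specialize (Hd w Hw).
    replace (f w - f z - l * (w - z))%C with
      (minus (minus (f w) (f z)) (scal (minus w z) l)); [exact Hd|].
    change ((f w - f z) - (w - z) * l = f w - f z - l * (w - z))%C. ring.
  - intros H. split; [apply is_linear_scal_l|].
    intros x Hx eps.
    assert (Hxz : z = x) by (apply (@is_filter_lim_locally_unique C_AbsRing (AbsRing_NormedModule C_AbsRing)); exact Hx).
    subst x. destruct (H eps (cond_pos eps)) as [d [Hd Hd']].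
    exists (mkposreal d Hd). intros w Hw. specialize (Hd' w Hw).
    replace (f w - f z - l * (w - z))%C with
      (minus (minus (f w) (f z)) (scal (minus w z) l)) in Hd'; [exact Hd'|].
    change ((f w - f z) - (w - z) * l = f w - f z - l * (w - z))%C. ring.
Qed.

Lemma Ccontinuous_eps (f : C -> C) (z : C) :
  Ccontinuous f z <->
  forall eps, 0 < eps -> exists d, 0 < d /\ forall w, Cmod (w - z) < d ->
    Cmod (f w - f z) < eps.
Proof.
  split.
  - intros H eps He.
    assert (He2 : 0 < eps / sqrt 2).
    { apply Rdiv_lt_0_compat; [easy|]. apply sqrt_lt_R0; lra. }
    destruct (H (ball (f z) (mkposreal _ He2))) as [d Hd].
    { apply locally_ball. }
    exists d; split; [apply cond_pos|].
    intros w Hw.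
    assert (Hb : ball z d w) by (apply C_NormedModule_mixin_compat1; exact Hw).
    specialize (Hd w Hb).
    apply (C_NormedModule_mixin_compat2 (f z) (f w) (mkposreal _ He2)) in Hd.
    simpl in Hd. replace (sqrt 2 * (eps / sqrt 2)) with eps in Hd; [exact Hd|].
    field. apply Rgt_not_eq, sqrt_lt_R0; lra.
  - intros H P [eps HP].
    destruct (H eps (cond_pos eps)) as [d [Hd Hd']].
    assert (Hd2 : 0 < d / sqrt 2).
    { apply Rdiv_lt_0_compat; [easy|]. apply sqrt_lt_R0; lra. }
    exists (mkposreal _ Hd2). intros w Hw. apply HP.
    apply C_NormedModule_mixin_compat1. apply Hd'.
    apply (C_NormedModule_mixin_compat2 z w (mkposreal _ Hd2)) in Hw.
    simpl in Hw. replace (sqrt 2 * (d / sqrt 2)) with d in Hw; [exact Hw|].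
    field. apply Rgt_not_eq, sqrt_lt_R0; lra.
Qed.

Lemma is_Cderive_continuous (f : C -> C) (z l : C) : is_Cderive f z l -> Ccontinuous f z.
Proof.
  intros H. apply Ccontinuous_eps. intros eps He.
  rewrite is_Cderive_eps in H. destruct (H 1 Rlt_0_1) as [d [Hd Hd']].
  set (M := 1 + Cmod l).
  assert (HM : 0 < M) by (pose proof (Cmod_ge_0 l); unfold M; lra).
  exists (Rmin d (eps / M)). split.
  { apply Rmin_pos; [easy|]. now apply Rdiv_lt_0_compat. }
  intros w Hw.
  assert (Hw1 : Cmod (w - z) < d) by (eapply Rlt_le_trans; [exact Hw|apply Rmin_l]).
  assert (Hw2 : Cmod (w - z) < eps / M) by (eapply Rlt_le_trans; [exact Hw|apply Rmin_r]).
  specialize (Hd' w Hw1).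
  replace (f w - f z)%C with ((f w - f z - l * (w - z)) + l * (w - z))%C by ring.
  eapply Rle_lt_trans; [apply Cmod_triangle|]. rewrite Cmod_mult.
  apply Rle_lt_trans with (M * Cmod (w - z)).
  { unfold M. lra. }
  replace eps with (M * (eps / M)) by (field; lra).
  now apply Rmult_lt_compat_l.
Qed.

Lemma is_Cderive_const (c z : C) : is_Cderive (fun _ => c) z (RtoC 0).
Proof.
  apply is_Cderive_eps. intros eps He. exists 1; split; [lra|]. intros w _.
  replace (c - c - 0 * (w - z))%C with (RtoC 0) by ring. rewrite Cmod_0.
  apply Rmult_le_pos; [lra|apply Cmod_ge_0].
Qed.

Lemma is_Cderive_id (z : C) : is_Cderive (fun w => w) z (RtoC 1).
Proof.
  apply is_Cderive_eps. intros eps He. exists 1; split; [lra|]. intros w _.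
  replace (w - z - 1 * (w - z))%C with (RtoC 0) by ring. rewrite Cmod_0.
  apply Rmult_le_pos; [lra|apply Cmod_ge_0].
Qed.

Lemma is_Cderive_plus (f g : C -> C) (z lf lg : C) : is_Cderive f z lf -> is_Cderive g z lg ->
  is_Cderive (fun w => f w + g w)%C z (lf + lg)%C.
Proof. exact (is_derive_plus f g z lf lg). Qed.

Lemma is_Cderive_minus (f g : C -> C) (z lf lg : C) : is_Cderive f z lf -> is_Cderive g z lg ->
  is_Cderive (fun w => f w - g w)%C z (lf - lg)%C.
Proof. exact (is_derive_minus f g z lf lg). Qed.

Lemma is_Cderive_AbsRing (f : C -> C) (z l : C) :
  is_Cderive f z l <-> @is_derive C_AbsRing (AbsRing_NormedModule C_AbsRing) f z l.
Proof.
  split; intros [_ H]; (split; [apply is_linear_scal_l | exact H]).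
Qed.

Lemma is_Cderive_mult (f g : C -> C) (z lf lg : C) : is_Cderive f z lf -> is_Cderive g z lg ->
  is_Cderive (fun w => f w * g w)%C z (lf * g z + f z * lg)%C.
Proof.
  rewrite !is_Cderive_AbsRing. intros Hf Hg.
  exact (@is_derive_mult C_AbsRing f g z lf lg Hf Hg Cmult_comm).
Qed.

Lemma is_Cderive_comp (f g : C -> C) (z lf lg : C) : is_Cderive f (g z) lf -> is_Cderive g z lg ->
  is_Cderive (fun w => f (g w)) z (lg * lf)%C.
Proof.
  intros Hf Hg. apply is_Cderive_AbsRing in Hg.
  exact (@is_derive_comp C_AbsRing C_NormedModule f g z lf lg Hf Hg).
Qed.

Lemma Cmod_sub_sym (z w : C) : Cmod (z - w) = Cmod (w - z).
Proof. rewrite <- Cmod_opp. f_equal. ring. Qed.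

Lemma Cmod_triangle_rev (z w : C) : Cmod z - Cmod w <= Cmod (z - w).
Proof.
  pose proof (Cmod_triangle (z - w) w) as H.
  replace (z - w + w)%C with z in H by ring. lra.
Qed.

Lemma is_Cderive_Cinv (z : C) : z <> 0 -> is_Cderive Cinv z (- / (z * z))%C.
Proof.
  intros Hz. apply is_Cderive_eps. intros eps He.
  assert (Hm : 0 < Cmod z) by now apply Cmod_gt_0.
  set (m := Cmod z) in *.
  exists (Rmin (m / 2) (eps * m ^ 3 / 2)). split.
  { apply Rmin_pos; [lra|]. apply Rdiv_lt_0_compat; [|lra].
    apply Rmult_lt_0_compat; [easy|]. now apply pow_lt. }
  intros w Hw.
  assert (Hw1 : Cmod (w - z) < m / 2) by (eapply Rlt_le_trans; [exact Hw|apply Rmin_l]).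
  assert (Hw2 : Cmod (w - z) < eps * m ^ 3 / 2) by (eapply Rlt_le_trans; [exact Hw|apply Rmin_r]).
  pose proof (Cmod_triangle_rev z w) as Ht. rewrite (Cmod_sub_sym z w) in Ht. fold m in Ht.
  assert (Hmw : m / 2 < Cmod w) by lra.
  assert (Hw0 : w <> 0) by (apply Cmod_gt_0; lra).
  replace (/ w - / z - - / (z * z) * (w - z))%C with
    ((w - z) * ((w - z) * (/ w * (/ z * / z))))%C by (field; auto).
  rewrite !Cmod_mult, !Cmod_inv by auto. fold m.
  rewrite Rmult_comm. apply Rmult_le_compat_r; [apply Cmod_ge_0|].
  apply Rle_trans with (eps * m ^ 3 / 2 * (/ (m / 2) * (/ m * / m))).
  - apply Rmult_le_compat; [apply Cmod_ge_0| |lra|].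
    + repeat apply Rmult_le_pos; apply Rlt_le, Rinv_0_lt_compat; lra.
    + apply Rmult_le_compat_r.
      * apply Rmult_le_pos; apply Rlt_le, Rinv_0_lt_compat; lra.
      * apply Rinv_le_contravar; lra.
  - right. field. lra.
Qed.

(** The difference quotients of [L] are the reciprocals of those of [F];
    continuity of [L] makes [L w] tend to [L w0], and [l <> 0] then bounds
    [L w - L w0] by a multiple of [w - w0]. *)
Lemma is_Cderive_inverse (F L : C -> C) (w0 l : C) (r : R) :
  0 < r -> (forall w, Cmod (w - w0) < r -> F (L w) = w) ->
  Ccontinuous L w0 -> is_Cderive F (L w0) l -> l <> 0 ->
  is_Cderive L w0 (/ l)%C.
Proof.
  intros Hr HFL HL HF Hl. apply is_Cderive_eps. intros eps He.
  assert (Hm : 0 < Cmod l) by now apply Cmod_gt_0.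
  set (m := Cmod l) in *.
  set (e := Rmin (m / 2) (eps * m ^ 2 / 2)).
  assert (Hmm : 0 < eps * m ^ 2 / 2).
  { apply Rdiv_lt_0_compat; [|lra]. apply Rmult_lt_0_compat; [easy|]. now apply pow_lt. }
  assert (Hepos : 0 < e) by (apply Rmin_pos; lra).
  rewrite is_Cderive_eps in HF. destruct (HF e Hepos) as [d1 [Hd1 H1]].
  rewrite Ccontinuous_eps in HL. destruct (HL d1 Hd1) as [d2 [Hd2 H2]].
  exists (Rmin r d2). split; [now apply Rmin_pos|].
  intros w Hw.
  assert (Hw1 : Cmod (w - w0) < r) by (eapply Rlt_le_trans; [exact Hw|apply Rmin_l]).
  assert (Hw2 : Cmod (w - w0) < d2) by (eapply Rlt_le_trans; [exact Hw|apply Rmin_r]).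
  specialize (H1 _ (H2 _ Hw2)).
  assert (Hw00 : Cmod (w0 - w0) < r) by (replace (w0 - w0)%C with (RtoC 0) by ring; rewrite Cmod_0; easy).
  rewrite (HFL w Hw1), (HFL w0 Hw00) in H1.
  set (u := (L w - L w0)%C) in *.
  assert (Hu : m * Cmod u <= Cmod (w - w0) + e * Cmod u).
  { unfold m. rewrite <- Cmod_mult.
    replace (l * u)%C with ((w - w0) + - (w - w0 - l * u))%C by ring.
    eapply Rle_trans; [apply Cmod_triangle|]. rewrite Cmod_opp. lra. }
  assert (He1 : e <= m / 2) by apply Rmin_l.
  assert (He2 : e <= eps * m ^ 2 / 2) by apply Rmin_r.
  pose proof (Cmod_ge_0 u) as Hu0. pose proof (Cmod_ge_0 (w - w0)) as Hw0.
  assert (Hu2 : Cmod u <= 2 / m * Cmod (w - w0)).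
  { apply Rmult_le_reg_l with (m / 2); [lra|].
    replace (m / 2 * (2 / m * Cmod (w - w0))) with (Cmod (w - w0)) by (field; lra).
    assert (e * Cmod u <= m / 2 * Cmod u) by now apply Rmult_le_compat_r. lra. }
  replace (u - / l * (w - w0))%C with (- / l * (w - w0 - l * u))%C by (field; auto).
  rewrite Cmod_mult, Cmod_opp, Cmod_inv by auto. fold m.
  apply Rle_trans with (/ m * ((eps * m ^ 2 / 2) * (2 / m * Cmod (w - w0)))).
  - apply Rmult_le_compat_l; [apply Rlt_le, Rinv_0_lt_compat; lra|].
    eapply Rle_trans; [exact H1|].
    apply Rmult_le_compat; lra.
  - right. field. lra.
Qed.

Lemma Ccontinuous_mult (f g : C -> C) (z : C) :
  Ccontinuous f z -> Ccontinuous g z -> Ccontinuous (fun w => f w * g w)%C z.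
Proof.
  rewrite !Ccontinuous_eps. intros Hf Hg eps He.
  set (M := 1 + Cmod (f z) + Cmod (g z)).
  pose proof (Cmod_ge_0 (f z)). pose proof (Cmod_ge_0 (g z)).
  assert (HM : 1 <= M) by (unfold M; lra).
  set (e := Rmin 1 (eps / (2 * M))).
  assert (He0 : 0 < e) by (apply Rmin_pos; [lra|apply Rdiv_lt_0_compat; lra]).
  destruct (Hf e He0) as [d1 [Hd1 H1]]. destruct (Hg e He0) as [d2 [Hd2 H2]].
  exists (Rmin d1 d2); split; [now apply Rmin_pos|]. intros w Hw.
  specialize (H1 w (Rlt_le_trans _ _ _ Hw (Rmin_l _ _))).
  specialize (H2 w (Rlt_le_trans _ _ _ Hw (Rmin_r _ _))).
  replace (f w * g w - f z * g z)%C with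
    ((f w - f z) * (g w - g z) + (f z * (g w - g z) + (f w - f z) * g z))%C by ring.
  eapply Rle_lt_trans; [apply Cmod_triangle|].
  eapply Rle_lt_trans; [apply Rplus_le_compat_l, Cmod_triangle|].
  rewrite !Cmod_mult.
  assert (e <= 1) by apply Rmin_l.
  assert (e <= eps / (2 * M)) by apply Rmin_r.
  assert (HeM : e * M <= eps / 2).
  { replace (eps / 2) with (eps / (2 * M) * M) by (field; lra).
    apply Rmult_le_compat_r; lra. }
  pose proof (Cmod_ge_0 (f w - f z)). pose proof (Cmod_ge_0 (g w - g z)).
  assert (Cmod (f w - f z) * Cmod (g w - g z) <= e * 1) by (apply Rmult_le_compat; lra).
  assert (Cmod (f z) * Cmod (g w - g z) <= Cmod (f z) * e) by (apply Rmult_le_compat_l; lra).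
  assert (Cmod (f w - f z) * Cmod (g z) <= e * Cmod (g z)) by (apply Rmult_le_compat_r; lra).
  assert (e * M = e * 1 + Cmod (f z) * e + e * Cmod (g z)) by (unfold M; ring).
  lra.
Qed.

Lemma Ccontinuous_Cinv (z : C) : z <> 0 -> Ccontinuous Cinv z.
Proof. intros Hz. eapply is_Cderive_continuous, is_Cderive_Cinv, Hz. Qed.

Lemma Ccontinuous_comp (f g : C -> C) (z : C) :
  Ccontinuous f z -> Ccontinuous g (f z) -> Ccontinuous (fun w => g (f w)) z.
Proof. intros Hf Hg. exact (continuous_comp f g z Hf Hg). Qed.

Lemma Ccontinuous_plus (f g : C -> C) (z : C) :
  Ccontinuous f z -> Ccontinuous g z -> Ccontinuous (fun w => f w + g w)%C z.
Proof. exact (@continuous_plus C_UniformSpace C_AbsRing C_NormedModule f g z). Qed.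

Lemma Ccontinuous_minus (f g : C -> C) (z : C) :
  Ccontinuous f z -> Ccontinuous g z -> Ccontinuous (fun w => f w - g w)%C z.
Proof. exact (@continuous_minus C_UniformSpace C_AbsRing C_NormedModule f g z). Qed.

(** Continuity of the derivative is part of the notion: every function below is
    built from a power series, so it comes for free, and it lets the mean value
    property be proved by differentiating under the integral sign. *)
Definition holo (U : C -> Prop) (h : C -> C) : Prop :=
  exists h1 : C -> C, forall z, U z -> is_Cderive h z (h1 z) /\ Ccontinuous h1 z.

Lemma holo_continuous (U : C -> Prop) (h : C -> C) z : holo U h -> U z -> Ccontinuous h z.
Proof. intros [h1 H] Hz. destruct (H z Hz). eapply is_Cderive_continuous; eauto. Qed.

Lemma holo_subset (U V : C -> Prop) (h : C -> C) :
  (forall z, V z -> U z) -> holo U h -> holo V h.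
Proof. intros HVU [h1 H]. exists h1. auto. Qed.

Lemma holo_const U (c : C) : holo U (fun _ => c).
Proof.
  exists (fun _ => RtoC 0). intros z _. split; [apply is_Cderive_const|].
  apply (is_Cderive_continuous _ _ (RtoC 0)), is_Cderive_const.
Qed.

Lemma holo_id U : holo U (fun z => z).
Proof.
  exists (fun _ => RtoC 1). intros z _. split; [apply is_Cderive_id|].
  apply (is_Cderive_continuous _ _ (RtoC 0)), is_Cderive_const.
Qed.

Lemma holo_plus U (f g : C -> C) : holo U f -> holo U g -> holo U (fun z => f z + g z)%C.
Proof.
  intros [f1 Hf] [g1 Hg]. exists (fun z => f1 z + g1 z)%C. intros z Hz.
  destruct (Hf z Hz), (Hg z Hz). split; [now apply is_Cderive_plus|now apply Ccontinuous_plus].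
Qed.

Lemma holo_minus U (f g : C -> C) : holo U f -> holo U g -> holo U (fun z => f z - g z)%C.
Proof.
  intros [f1 Hf] [g1 Hg]. exists (fun z => f1 z - g1 z)%C. intros z Hz.
  destruct (Hf z Hz), (Hg z Hz). split; [now apply is_Cderive_minus|now apply Ccontinuous_minus].
Qed.

Lemma holo_mult U (f g : C -> C) : holo U f -> holo U g -> holo U (fun z => f z * g z)%C.
Proof.
  intros Hf0 Hg0. pose proof Hf0 as [f1 Hf]. pose proof Hg0 as [g1 Hg].
  exists (fun z => f1 z * g z + f z * g1 z)%C. intros z Hz.
  pose proof (holo_continuous _ _ z Hf0 Hz). pose proof (holo_continuous _ _ z Hg0 Hz).
  destruct (Hf z Hz), (Hg z Hz). split; [now apply is_Cderive_mult|].
  apply Ccontinuous_plus; now apply Ccontinuous_mult.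
Qed.

Lemma holo_comp (U V : C -> Prop) (f g : C -> C) :
  (forall z, U z -> V (g z)) -> holo V f -> holo U g -> holo U (fun z => f (g z)).
Proof.
  intros HUV [f1 Hf] Hg0. pose proof Hg0 as [g1 Hg].
  exists (fun z => g1 z * f1 (g z))%C. intros z Hz.
  pose proof (holo_continuous _ _ z Hg0 Hz).
  destruct (Hf _ (HUV z Hz)), (Hg z Hz). split; [now apply is_Cderive_comp|].
  apply Ccontinuous_mult; [easy|]. now apply Ccontinuous_comp.
Qed.

Lemma holo_Cinv : holo (fun z => z <> 0) Cinv.
Proof.
  exists (fun z => - / (z * z))%C. intros z Hz. split; [now apply is_Cderive_Cinv|].
  apply (@continuous_opp C_UniformSpace C_AbsRing C_NormedModule).
  apply (Ccontinuous_comp (fun w => w * w)%C Cinv).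
  - apply Ccontinuous_mult; apply continuous_id.
  - apply Ccontinuous_Cinv. now apply Cmult_neq_0.
Qed.

Lemma holo_div (U : C -> Prop) (f g : C -> C) : (forall z, U z -> g z <> 0) ->
  holo U f -> holo U g -> holo U (fun z => f z / g z)%C.
Proof.
  intros Hg0 Hf Hg. apply holo_mult; [easy|].
  now apply (holo_comp U _ Cinv g Hg0 holo_Cinv).
Qed.

Lemma is_Cderive_ext_ball (f g : C -> C) (z l : C) (r : R) :
  0 < r -> (forall w, Cmod (w - z) < r -> f w = g w) ->
  is_Cderive f z l -> is_Cderive g z l.
Proof.
  intros Hr Hfg. apply is_derive_ext_loc. exists (mkposreal r Hr). exact Hfg.
Qed.

(** * Restriction to real curves *)

Lemma is_derive_eps (g : R -> R) (t p : R) :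
  is_derive g t p <->
  forall eps, 0 < eps -> exists d, 0 < d /\ forall s, Rabs (s - t) < d ->
    Rabs (g s - g t - p * (s - t)) <= eps * Rabs (s - t).
Proof.
  split.
  - intros [_ H] eps He.
    destruct (H t (fun P HP => HP) (mkposreal eps He)) as [d Hd].
    exists d; split; [apply cond_pos|].
    intros w Hw. specialize (Hd w Hw).
    replace (g w - g t - p * (w - t)) with
      (minus (minus (g w) (g t)) (scal (minus w t) p)); [exact Hd|].
    change ((g w - g t) - (w - t) * p = g w - g t - p * (w - t)). ring.
  - intros H. split; [apply is_linear_scal_l|].
    intros x Hx eps.
    assert (Hxz : t = x) by (apply (@is_filter_lim_locally_unique R_AbsRing R_NormedModule); exact Hx).
    subst x. destruct (H eps (cond_pos eps)) as [d [Hd Hd']].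
    exists (mkposreal d Hd). intros w Hw. specialize (Hd' w Hw).
    replace (g w - g t - p * (w - t)) with
      (minus (minus (g w) (g t)) (scal (minus w t) p)) in Hd'; [exact Hd'|].
    change ((g w - g t) - (w - t) * p = g w - g t - p * (w - t)). ring.
Qed.

Lemma Cmod_le_Rabs (a b : R) : Cmod (a, b) <= Rabs a + Rabs b.
Proof.
  replace ((a, b) : C) with (RtoC a + Ci * RtoC b)%C.
  - eapply Rle_trans; [apply Cmod_triangle|].
    rewrite Cmod_mult, Cmod_Ci, !Cmod_R. lra.
  - unfold Ci, RtoC, Cplus, Cmult; simpl. f_equal; ring.
Qed.

Lemma Rabs_Im_le_Cmod (z : C) : Rabs (Im z) <= Cmod z.
Proof. eapply Rle_trans; [|apply Rmax_Cmod]. apply Rmax_r. Qed.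

Lemma Re_minus (a b : C) : Re (a - b) = Re a - Re b.
Proof. reflexivity. Qed.

Lemma Im_minus (a b : C) : Im (a - b) = Im a - Im b.
Proof. reflexivity. Qed.

(** The chain rule along a real curve, where [l] acts as a real-linear map. *)
Lemma is_derive_Re_curve (h : C -> C) (g1 g2 : R -> R) (t p q : R) (l : C) :
  is_Cderive h (g1 t, g2 t) l -> is_derive g1 t p -> is_derive g2 t q ->
  is_derive (fun s => Re (h (g1 s, g2 s))) t (Re (l * (p, q))%C).
Proof.
  rewrite is_Cderive_eps, !is_derive_eps. intros H H1 H2 eps He.
  set (M := Rabs p + Rabs q + 2).
  pose proof (Rabs_pos p). pose proof (Rabs_pos q). pose proof (Cmod_ge_0 l).
  assert (HM : 2 <= M) by (unfold M; lra).
  set (L := Cmod l + 1). assert (HL : 1 <= L) by (unfold L; lra).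
  set (e1 := Rmin 1 (eps / (4 * L))). set (e2 := eps / (2 * M)).
  assert (He1 : 0 < e1) by (apply Rmin_pos; [lra|apply Rdiv_lt_0_compat; lra]).
  assert (He2 : 0 < e2) by (apply Rdiv_lt_0_compat; lra).
  destruct (H e2 He2) as [d [Hd D]].
  destruct (H1 e1 He1) as [d1 [Hd1 D1]]. destruct (H2 e1 He1) as [d2 [Hd2 D2]].
  exists (Rmin (d / M) (Rmin d1 d2)). split.
  { repeat apply Rmin_pos; try easy. apply Rdiv_lt_0_compat; lra. }
  intros s Hs.
  specialize (D1 s (Rlt_le_trans _ _ _ Hs (Rle_trans _ _ _ (Rmin_r _ _) (Rmin_l _ _)))).
  specialize (D2 s (Rlt_le_trans _ _ _ Hs (Rle_trans _ _ _ (Rmin_r _ _) (Rmin_r _ _)))).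
  assert (Hs1 : Rabs (s - t) < d / M) by (eapply Rlt_le_trans; [exact Hs|apply Rmin_l]).
  set (u := Rabs (s - t)) in *. assert (Hu : 0 <= u) by apply Rabs_pos.
  assert (E1 : e1 <= 1) by apply Rmin_l.
  assert (E2 : e1 <= eps / (4 * L)) by apply Rmin_r.
  assert (A1 : Rabs (g1 s - g1 t) <= (Rabs p + 1) * u).
  { replace (g1 s - g1 t) with ((g1 s - g1 t - p * (s - t)) + p * (s - t)) by ring.
    eapply Rle_trans; [apply Rabs_triang|]. rewrite Rabs_mult. fold u.
    assert (e1 * u <= 1 * u) by now apply Rmult_le_compat_r. lra. }
  assert (A2 : Rabs (g2 s - g2 t) <= (Rabs q + 1) * u).
  { replace (g2 s - g2 t) with ((g2 s - g2 t - q * (s - t)) + q * (s - t)) by ring.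
    eapply Rle_trans; [apply Rabs_triang|]. rewrite Rabs_mult. fold u.
    assert (e1 * u <= 1 * u) by now apply Rmult_le_compat_r. lra. }
  assert (A : Cmod ((g1 s, g2 s) - (g1 t, g2 t)) <= M * u).
  { replace ((g1 s, g2 s) - (g1 t, g2 t))%C with ((g1 s - g1 t, g2 s - g2 t) : C) by reflexivity.
    eapply Rle_trans; [apply Cmod_le_Rabs|]. unfold M. lra. }
  assert (A3 : Cmod ((g1 s, g2 s) - (g1 t, g2 t)) < d).
  { eapply Rle_lt_trans; [exact A|]. replace d with (M * (d / M)) by (field; lra).
    apply Rmult_lt_compat_l; lra. }
  specialize (D _ A3).
  set (G := ((g1 s, g2 s) - (g1 t, g2 t))%C) in *.
  set (V := (G - (p, q) * RtoC (s - t))%C).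
  assert (HV : Cmod V <= 2 * e1 * u).
  { replace V with ((g1 s - g1 t - p * (s - t), g2 s - g2 t - q * (s - t)) : C).
    - eapply Rle_trans; [apply Cmod_le_Rabs|]. lra.
    - unfold V, G, RtoC, Cminus, Cplus, Copp, Cmult; simpl. f_equal; ring. }
  replace (Re (h (g1 s, g2 s)) - Re (h (g1 t, g2 t)) - Re (l * (p, q)) * (s - t))
    with (Re ((h (g1 s, g2 s) - h (g1 t, g2 t) - l * G) + l * V)%C).
  2:{ unfold V. rewrite <- re_scal_r, <- !Re_minus.
      f_equal. ring. }
  eapply Rle_trans; [apply re_le_Cmod|].
  eapply Rle_trans; [apply Cmod_triangle|]. rewrite Cmod_mult.
  assert (B1 : e2 * Cmod G <= eps / 2 * u).
  { replace (eps / 2 * u) with (e2 * (M * u)) by (unfold e2; field; lra).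
    apply Rmult_le_compat_l; lra. }
  assert (B2 : Cmod l * Cmod V <= eps / 2 * u).
  { apply Rle_trans with (L * (2 * (eps / (4 * L)) * u)).
    - apply Rmult_le_compat; [easy|apply Cmod_ge_0|unfold L; lra|].
      eapply Rle_trans; [exact HV|]. apply Rmult_le_compat_r; lra.
    - right. field. lra. }
  lra.
Qed.

Lemma is_derive_Im_curve (h : C -> C) (g1 g2 : R -> R) (t p q : R) (l : C) :
  is_Cderive h (g1 t, g2 t) l -> is_derive g1 t p -> is_derive g2 t q ->
  is_derive (fun s => Im (h (g1 s, g2 s))) t (Im (l * (p, q))%C).
Proof.
  intros H H1 H2.
  (* Im w = Re (- i w) *)
  assert (HI : forall w : C, Re (- Ci * w) = Im w).
  { intros [a b]. unfold Re, Im, Ci; simpl. ring. }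
  assert (K : is_Cderive (fun z : C => (- Ci * h z)%C) (g1 t, g2 t) (- Ci * l)%C).
  { replace (- Ci * l)%C with (0 * h (g1 t, g2 t) + - Ci * l)%C by ring.
    exact (is_Cderive_mult (fun _ => - Ci)%C h _ _ _ (is_Cderive_const _ _) H). }
  pose proof (is_derive_Re_curve _ _ _ _ _ _ _ K H1 H2) as D.
  replace (Im (l * (p, q))) with (Re (- Ci * l * (p, q))).
  - eapply is_derive_ext; [|exact D]. intros s. apply HI.
  - rewrite <- HI. f_equal. ring.
Qed.

Lemma RtoC_neq0 (x : R) : x <> 0 -> RtoC x <> 0.
Proof. intros H E. apply H. now apply RtoC_inj. Qed.

Ltac Ceq := match goal with |- ?a = ?b => change (@eq C a b) end.

(** * The mean value property *)

Definition circ (r t : R) : C := (r * cos t, r * sin t).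

Lemma circ_expi (r t : R) : circ r t = (r * expi t)%C.
Proof. unfold circ, expi, RtoC, Cmult; simpl. f_equal; ring. Qed.

Lemma Cmod_expi (t : R) : Cmod (expi t) = 1.
Proof.
  unfold Cmod, expi; simpl. rewrite !Rmult_1_r.
  pose proof (sin2_cos2 t) as H. unfold Rsqr in H.
  replace (cos t * cos t + sin t * sin t) with 1 by lra. apply sqrt_1.
Qed.

Lemma Cmod_circ (r t : R) : Cmod (circ r t) = Rabs r.
Proof. rewrite circ_expi, Cmod_mult, Cmod_expi, Cmod_R. ring. Qed.

Lemma continuous_C_pair {U : UniformSpace} (f g : U -> R) (x : U) :
  continuous f x -> continuous g x ->
  @continuous U C_UniformSpace (fun y => (f y, g y)) x.
Proof.
  intros Hf Hg P [eps HP].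
  specialize (Hf (ball (f x) eps) (locally_ball _ _)).
  specialize (Hg (ball (g x) eps) (locally_ball _ _)).
  unfold filtermap in *.
  apply (filter_imp (fun y => ball (f x) eps (f y) /\ ball (g x) eps (g y))).
  - intros y [H1 H2]. apply HP. split; assumption.
  - now apply filter_and.
Qed.

Lemma continuous_Re (z : C) : @continuous C_UniformSpace R_UniformSpace Re z.
Proof. destruct z. apply (@continuous_fst R_UniformSpace R_UniformSpace). Qed.

Lemma continuous_Im (z : C) : @continuous C_UniformSpace R_UniformSpace Im z.
Proof. destruct z. apply (@continuous_snd R_UniformSpace R_UniformSpace). Qed.

Lemma continuous_scal_trig {U : UniformSpace} (f g : U -> R) (T : R -> R) (x : U) :
  (forall t, continuous T t) -> continuous f x -> continuous g x ->
  continuous (fun y => f y * T (g y)) x.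
Proof.
  intros HT Hf Hg. apply (@continuous_mult U R_AbsRing f (fun y => T (g y))); [easy|].
  apply (continuous_comp g T); auto.
Qed.

Lemma continuous_circ {U : UniformSpace} (f g : U -> R) (x : U) :
  continuous f x -> continuous g x ->
  @continuous U C_UniformSpace (fun y => circ (f y) (g y)) x.
Proof.
  intros Hf Hg. apply continuous_C_pair; apply continuous_scal_trig; auto.
  - intros t. apply continuous_cos.
  - intros t. apply continuous_sin.
Qed.

Lemma continuity_2d_circ (k : C -> C) (r t : R) :
  Ccontinuous k (circ r t) -> continuity_2d_pt (fun u v => Re (k (circ u v))) r t.
Proof.
  intros Hk. apply continuity_2d_pt_filterlim.
  change (@continuous (prod_UniformSpace R_UniformSpace R_UniformSpace) R_UniformSpace
    (fun z => Re (k (circ (fst z) (snd z)))) (r, t)).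
  apply (continuous_comp (fun z => k (circ (fst z) (snd z))) Re); [|apply continuous_Re].
  apply (continuous_comp (fun z => circ (fst z) (snd z)) k); [|exact Hk].
  apply (continuous_circ (U := prod_UniformSpace R_UniformSpace R_UniformSpace) fst snd).
  - apply continuous_fst.
  - apply continuous_snd.
Qed.

Lemma continuous_Re_circ (k : C -> C) (r t : R) :
  Ccontinuous k (circ r t) -> continuous (fun s => Re (k (circ r s))) t.
Proof.
  intros Hk. apply (continuous_comp (fun s => k (circ r s)) Re); [|apply continuous_Re].
  apply (continuous_comp (fun s => circ r s) k); [|exact Hk].
  apply (continuous_circ (fun _ => r) (fun s => s)); [apply continuous_const|apply continuous_id].
Qed.

Lemma ex_RInt_circ (k : C -> C) (r a b : R) :
  (forall t, Ccontinuous k (circ r t)) -> ex_RInt (fun t => Re (k (circ r t))) a b.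
Proof.
  intros H. apply (@ex_RInt_continuous R_CompleteNormedModule).
  intros t _. apply continuous_Re_circ, H.
Qed.

Section MeanValue.

Variables (h : C -> C) (R0 : R) (w : C).
Hypothesis Hh : holo (fun z => Cmod z < R0 /\ z <> w) h.
Hypothesis Hc : forall z, Cmod z < R0 -> Ccontinuous h z.

Let I (r : R) := RInt (fun t => Re (h (circ r t))) 0 (2 * PI).

Lemma circ_mean_derive (r : R) : 0 < r < R0 -> r <> Cmod w -> is_derive I r 0.
Proof.
  intros Hr Hrw. pose proof PI_RGT_0 as HPI.
  destruct Hh as [h1 H1].
  set (d0 := Rmin (Rmin r (R0 - r)) (Rabs (r - Cmod w))).
  assert (Hd0 : 0 < d0).
  { repeat apply Rmin_pos; try lra. apply Rabs_pos_lt. lra. }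
  assert (Hin : forall u t, Rabs (u - r) < d0 -> Cmod (circ u t) < R0 /\ circ u t <> w).
  { intros u t Hu.
    assert (Hu1 : Rabs (u - r) < r) by (eapply Rlt_le_trans; [exact Hu|]; eapply Rle_trans; [apply Rmin_l|apply Rmin_l]).
    assert (Hu2 : Rabs (u - r) < R0 - r) by (eapply Rlt_le_trans; [exact Hu|]; eapply Rle_trans; [apply Rmin_l|apply Rmin_r]).
    assert (Hu3 : Rabs (u - r) < Rabs (r - Cmod w)) by (eapply Rlt_le_trans; [exact Hu|apply Rmin_r]).
    apply Rabs_def2 in Hu1. apply Rabs_def2 in Hu2.
    rewrite Cmod_circ, Rabs_right by lra. split; [lra|].
    intros E. assert (E' : Cmod w = u) by (rewrite <- E, Cmod_circ; apply Rabs_right; lra).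
    rewrite E', Rabs_minus_sym in Hu3. lra. }
  assert (Hder : forall u t, Rabs (u - r) < d0 ->
    is_derive (fun z => Re (h (circ z t))) u (Re (h1 (circ u t) * expi t)%C)).
  { intros u t Hu. destruct (H1 _ (Hin u t Hu)) as [D _].
    apply (is_derive_Re_curve h (fun z => z * cos t) (fun z => z * sin t)); [exact D| |];
      auto_derive; auto; ring. }
  assert (HD : is_derive I r (RInt (fun t => Derive (fun u => Re (h (circ u t))) r) 0 (2 * PI))).
  { apply (is_derive_RInt_param (fun u t => Re (h (circ u t)))).
    - exists (mkposreal d0 Hd0). intros u Hu t _. eexists. apply Hder. exact Hu.
    - intros t _. apply continuity_2d_pt_ext_loc with
        (fun u v => Re (h1 (circ u v)) * cos v - Im (h1 (circ u v)) * sin v).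
      + exists (mkposreal d0 Hd0). intros u v Hu _. symmetry.
        apply is_derive_unique.
        replace (Re (h1 (circ u v)) * cos v - Im (h1 (circ u v)) * sin v)
          with (Re (h1 (circ u v) * expi v)%C) by apply re_mult.
        now apply Hder.
      + destruct (H1 (circ r t)) as [_ C1].
        { apply Hin. replace (r - r) with 0 by ring. now rewrite Rabs_R0. }
        apply continuity_2d_pt_minus; apply continuity_2d_pt_mult.
        * now apply continuity_2d_circ.
        * apply continuity_2d_pt_filterlim.
          apply (continuous_comp (U := prod_UniformSpace R_UniformSpace R_UniformSpace) snd cos);
            [apply continuous_snd|apply continuous_cos].
        * (* Im k = Re (- i k) *)
          apply continuity_2d_pt_ext with (fun u v => Re (- Ci * h1 (circ u v))%C).
          { intros u v. destruct (h1 (circ u v)). unfold Re, Im, Ci; simpl. ring. }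
          apply (continuity_2d_circ (fun z => - Ci * h1 z)%C).
          apply Ccontinuous_mult; [apply continuous_const|exact C1].
        * apply continuity_2d_pt_filterlim.
          apply (continuous_comp (U := prod_UniformSpace R_UniformSpace R_UniformSpace) snd sin);
            [apply continuous_snd|apply continuous_sin].
    - exists (mkposreal d0 Hd0). intros u Hu. apply ex_RInt_circ.
      intros t. apply Hc. now apply Hin. }
  replace 0 with (RInt (fun t => Derive (fun u => Re (h (circ u t))) r) 0 (2 * PI)); [exact HD|].
  assert (Hr0 : Rabs (r - r) < d0) by (replace (r - r) with 0 by ring; now rewrite Rabs_R0).
  (* radial and angular derivatives differ by the factor i r *)
  assert (HA : forall t, is_derive (fun s => / r * Im (h (circ r s))) t (Re (h1 (circ r t) * expi t)%C)).
  { intros t. destruct (H1 _ (Hin r t Hr0)) as [D _].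
    pose proof (is_derive_Im_curve h (fun s => r * cos s) (fun s => r * sin s) t
      (- r * sin t) (r * cos t) _ D) as K.
    replace (Re (h1 (circ r t) * expi t)) with
      (/ r * Im (h1 (circ r t) * (- r * sin t, r * cos t))).
    - apply is_derive_scal. apply K; auto_derive; auto; ring.
    - rewrite im_mult, re_mult. unfold expi, Re, Im; simpl. field. lra. }
  rewrite (RInt_ext _ (fun t => Re (h1 (circ r t) * expi t)%C)).
  - transitivity (minus (/ r * Im (h (circ r (2 * PI)))) (/ r * Im (h (circ r 0)))).
    + apply is_RInt_unique. apply (is_RInt_derive (fun s => / r * Im (h (circ r s)))).
      * intros t _. apply HA.
      * intros t _. destruct (H1 (circ r t) (Hin r t Hr0)) as [_ C1].
        apply (continuous_comp (fun s => h1 (circ r s) * expi s)%C Re); [|apply continuous_Re].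
        apply (continuous_ext (fun s => h1 (circ r s) * (circ r s * / r))%C).
        { intros s. rewrite circ_expi. Ceq. field. apply RtoC_neq0. lra. }
        apply (continuous_comp (fun s => circ r s) (fun z => h1 z * (z * / r))%C).
        { apply (continuous_circ (fun _ => r) (fun s => s)); [apply continuous_const|apply continuous_id]. }
        apply Ccontinuous_mult; [exact C1|].
        apply Ccontinuous_mult; [apply continuous_id|apply continuous_const].
    + replace (circ r (2 * PI)) with (circ r 0).
      * apply (@minus_eq_zero R_AbelianGroup).
      * unfold circ. now rewrite cos_2PI, sin_2PI, cos_0, sin_0.
  - intros t _. apply is_derive_unique. now apply Hder.
Qed.

Lemma circ_mean_continuous (r : R) : Rabs r < R0 -> continuity_pt I r.
Proof.
  intros Hr. pose proof PI_RGT_0 as HPI.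
  set (a := (Rabs r + R0) / 2).
  assert (Ha : Rabs r < a < R0) by (unfold a; lra).
  assert (HU : forall x y, - a <= x <= a -> 0 <= y <= 2 * PI ->
    continuity_2d_pt (fun u v => Re (h (circ u v))) x y).
  { intros x y Hx _. apply continuity_2d_circ, Hc. rewrite Cmod_circ.
    eapply Rle_lt_trans; [apply Rabs_le, Hx|lra]. }
  intros eps He.
  assert (He2 : 0 < eps / (4 * PI)) by (apply Rdiv_lt_0_compat; lra).
  destruct (uniform_continuity_2d _ _ _ _ _ HU (mkposreal _ He2)) as [d Hd]. simpl in Hd.
  exists (Rmin d (a - Rabs r)). split; [apply Rmin_pos; [apply cond_pos|lra]|].
  intros x [_ Hx]. simpl in *. unfold Rdist in *.
  assert (Hx1 : Rabs (x - r) < d) by (eapply Rlt_le_trans; [exact Hx|apply Rmin_l]).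
  assert (Hx2 : Rabs (x - r) < a - Rabs r) by (eapply Rlt_le_trans; [exact Hx|apply Rmin_r]).
  assert (Hxa : Rabs x <= a).
  { pose proof (Rabs_triang_inv x r). lra. }
  assert (Hra : Rabs r <= a) by lra.
  assert (Hex : forall y, Rabs y <= a -> ex_RInt (fun t => Re (h (circ y t))) 0 (2 * PI)).
  { intros y Hy. apply ex_RInt_circ. intros t. apply Hc. rewrite Cmod_circ. lra. }
  unfold I.
  replace (RInt (fun t => Re (h (circ x t))) 0 (2 * PI) - RInt (fun t => Re (h (circ r t))) 0 (2 * PI))
    with (RInt (fun t => minus (Re (h (circ x t))) (Re (h (circ r t)))) 0 (2 * PI)).
  2:{ apply (@RInt_minus R_CompleteNormedModule); auto. }
  apply Rle_lt_trans with ((2 * PI - 0) * (eps / (4 * PI))).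
  - apply abs_RInt_le_const; [lra| |].
    + apply (@ex_RInt_minus R_NormedModule); auto.
    + intros t Ht. apply Rlt_le. apply (Hd r t x t); auto.
      * apply Rabs_le_between. easy.
      * apply Rabs_le_between. easy.
      * replace (t - t) with 0 by ring. rewrite Rabs_R0. apply cond_pos.
  - replace ((2 * PI - 0) * (eps / (4 * PI))) with (eps / 2) by (field; lra). lra.
Qed.

Lemma circ_mean_const (a b : R) : 0 <= a <= b -> b < R0 ->
  (b <= Cmod w \/ Cmod w <= a) -> I b = I a.
Proof.
  intros Hab Hb Hw.
  destruct (Req_dec a b) as [->|Hne]; [easy|].
  destruct (MVT_gen I a b (fun _ => 0)) as [c [_ Hc']].
  - rewrite Rmin_left, Rmax_right by lra. intros x Hx. apply circ_mean_derive; lra.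
  - rewrite Rmin_left, Rmax_right by lra. intros x Hx.
    apply circ_mean_continuous. rewrite Rabs_right; lra.
  - lra.
Qed.

(** The integral over the circle of radius [r] depends continuously on [r], and
    its derivative vanishes except perhaps where the circle meets [w]; so it is
    constant. Continuity alone suffices at [w], which disposes of removable
    singularities without proving that they are removable. *)
Lemma mean_value (r : R) : 0 <= r < R0 ->
  RInt (fun t => Re (h (circ r t))) 0 (2 * PI) = 2 * PI * Re (h 0).
Proof.
  intros Hr.
  replace (2 * PI * Re (h 0)) with (I 0).
  - change (I r = I 0).
    destruct (Rle_lt_dec r (Cmod w)) as [H|H]; [apply circ_mean_const; lra|].
    pose proof (Cmod_ge_0 w).
    transitivity (I (Cmod w)); apply circ_mean_const; lra.
  - unfold I. rewrite (RInt_ext _ (fun _ => Re (h 0))).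
    + rewrite RInt_const. unfold scal; simpl. unfold mult; simpl. ring.
    + intros t _. f_equal. f_equal. unfold circ. now rewrite !Rmult_0_l.
Qed.

End MeanValue.

(** The maximum principle at the centre; the maximum of [|h|] over the circle
    bounds the integrand after [h 0] is rotated onto the positive axis. *)
Lemma center_le_circle (h : C -> C) (R0 : R) (w : C) (r M : R) :
  holo (fun z => Cmod z < R0 /\ z <> w) h ->
  (forall z, Cmod z < R0 -> Ccontinuous h z) ->
  0 <= r < R0 -> (forall t, Cmod (h (circ r t)) <= M) -> Cmod (h 0) <= M.
Proof.
  intros Hh Hc Hr HM. pose proof PI_RGT_0 as HPI.
  assert (HM0 : 0 <= M) by (eapply Rle_trans; [apply Cmod_ge_0|apply (HM 0)]).
  destruct (Req_dec (Cmod (h 0)) 0) as [E|E]; [lra|].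
  assert (Hp : 0 < Cmod (h 0)) by (pose proof (Cmod_ge_0 (h 0)); lra).
  (* rotate so that the value at the centre is real *)
  set (c := (Cconj (h 0) * / Cmod (h 0))%C).
  assert (Hcm : Cmod c = 1).
  { unfold c. rewrite Cmod_mult, Cmod_conj, Cmod_inv, Cmod_R, Rabs_right by (try apply RtoC_neq0; lra).
    field. lra. }
  assert (Hch : Re (c * h 0)%C = Cmod (h 0)).
  { replace (c * h 0)%C with (/ Cmod (h 0) * (h 0 * Cconj (h 0)))%C by (unfold c; ring).
    rewrite <- Cmod2_conj, <- RtoC_inv, <- RtoC_mult, re_RtoC by lra. field. lra. }
  pose proof (mean_value (fun z => c * h z)%C R0 w) as MV.
  specialize (MV (holo_mult _ (fun _ => c) h (holo_const _ c) Hh)).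
  specialize (MV (fun z Hz => Ccontinuous_mult _ _ _ (continuous_const c z) (Hc z Hz)) r Hr).
  cbv beta in MV. rewrite Hch in MV.
  assert (B : Rabs (RInt (fun t => Re (c * h (circ r t))%C) 0 (2 * PI)) <= (2 * PI - 0) * M).
  { apply abs_RInt_le_const; [lra| |].
    - apply (ex_RInt_circ (fun z => c * h z)%C). intros t.
      apply Ccontinuous_mult; [apply continuous_const|]. apply Hc. rewrite Cmod_circ, Rabs_right; lra.
    - intros t _. eapply Rle_trans; [apply re_le_Cmod|]. rewrite Cmod_mult, Hcm, Rmult_1_l. apply HM. }
  rewrite MV, Rabs_right in B by nra. nra.
Qed.

(** * Difference quotients *)

Lemma holo_ext_ball (U : C -> Prop) (f g : C -> C) :
  (forall z, U z -> exists r, 0 < r /\ forall w, Cmod (w - z) < r -> f w = g w) ->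
  holo U f -> holo U g.
Proof.
  intros Hfg [f1 H]. exists f1. intros z Hz. destruct (H z Hz) as [H1 H2]. split; [|easy].
  destruct (Hfg z Hz) as [r [Hr E]]. exact (is_Cderive_ext_ball f g z _ r Hr E H1).
Qed.

Lemma holo_scal (U : C -> Prop) (c : C) (f : C -> C) : holo U f -> holo U (fun z => c * f z)%C.
Proof. intros H. exact (holo_mult U (fun _ => c) f (holo_const U c) H). Qed.

Definition dquot (F : C -> C) (a l z : C) : C :=
  if Ceq_dec z a then l else ((F z - F a) / (z - a))%C.

Lemma dquot_at (F : C -> C) (a l : C) : dquot F a l a = l.
Proof. unfold dquot. now destruct (Ceq_dec a a). Qed.

Lemma dquot_off (F : C -> C) (a l z : C) : z <> a -> dquot F a l z = ((F z - F a) / (z - a))%C.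
Proof. intros H. unfold dquot. now destruct (Ceq_dec z a). Qed.

Lemma ne_ball (z a : C) : z <> a -> exists r, 0 < r /\ forall w, Cmod (w - z) < r -> w <> a.
Proof.
  intros H. exists (Cmod (z - a)). split.
  - apply Cmod_gt_0. now apply Cminus_eq_contra.
  - intros w Hw E. subst w. rewrite Cmod_sub_sym in Hw. lra.
Qed.

Lemma dquot_holo (U : C -> Prop) (F : C -> C) (a l : C) :
  holo U F -> holo (fun z => U z /\ z <> a) (dquot F a l).
Proof.
  intros H. apply holo_ext_ball with (fun z => (F z - F a) / (z - a))%C.
  - intros z [_ Hz]. destruct (ne_ball z a Hz) as [r [Hr E]].
    exists r. split; [easy|]. intros w Hw. now rewrite dquot_off by auto.
  - apply holo_div.
    + intros z [_ Hz]. now apply Cminus_eq_contra.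
    + apply holo_minus; [|apply holo_const]. now apply (holo_subset U); [intros z [Hz _]|].
    + apply holo_minus; [apply holo_id|apply holo_const].
Qed.

Lemma dquot_continuous (U : C -> Prop) (F : C -> C) (a l z : C) :
  holo U F -> is_Cderive F a l -> U z -> Ccontinuous (dquot F a l) z.
Proof.
  intros H Hl Hz. destruct (Ceq_dec z a) as [->|Hne].
  - apply Ccontinuous_eps. intros eps He. rewrite is_Cderive_eps in Hl.
    destruct (Hl (eps / 2)) as [d [Hd D]]; [lra|]. exists d. split; [easy|]. intros w Hw.
    rewrite dquot_at. unfold dquot. destruct (Ceq_dec w a) as [->|Hwa].
    + replace (l - l)%C with (RtoC 0) by ring. now rewrite Cmod_0.
    + specialize (D w Hw). assert (Hm : 0 < Cmod (w - a)) by now apply Cmod_gt_0, Cminus_eq_contra.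
      replace ((F w - F a) / (w - a) - l)%C with ((F w - F a - l * (w - a)) * / (w - a))%C
        by (field; now apply Cminus_eq_contra).
      rewrite Cmod_mult, Cmod_inv by now apply Cminus_eq_contra.
      apply Rle_lt_trans with (eps / 2); [|lra].
      apply Rmult_le_reg_r with (Cmod (w - a)); [easy|].
      rewrite Rmult_assoc, Rinv_l by lra. lra.
  - apply (holo_continuous _ _ z (dquot_holo U F a l H)). now split.
Qed.

(** * Automorphisms of the disk *)

Definition mobius (a z : C) : C := ((z + a) / (1 + Cconj a * z))%C.

Lemma Cmod_sq (a b : R) : Cmod (a, b) ^ 2 = a ^ 2 + b ^ 2.
Proof. rewrite Cmod2_alt. reflexivity. Qed.

Lemma Cmod_lt_1_sq (z : C) : Cmod z < 1 <-> Cmod z ^ 2 < 1.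
Proof. pose proof (Cmod_ge_0 z). split; nra. Qed.

Lemma mobius_den (a z : C) : unit_disk a -> unit_disk z -> (1 + Cconj a * z)%C <> 0.
Proof.
  intros Ha Hz E. unfold unit_disk in *.
  assert (E1 : Cmod (Cconj a * z) = 1).
  { replace (Cconj a * z)%C with (- (1))%C; [apply Cmod_m1|].
    replace (Cconj a * z)%C with ((1 + Cconj a * z) - 1)%C by ring. rewrite E. ring. }
  rewrite Cmod_mult, Cmod_conj in E1.
  pose proof (Cmod_ge_0 a). pose proof (Cmod_ge_0 z). nra.
Qed.

Lemma mobius_den_bound (a z : C) : unit_disk z -> 1 - Cmod a <= Cmod (1 + Cconj a * z).
Proof.
  intros Hz. unfold unit_disk in Hz.
  pose proof (Cmod_triangle_rev 1 (- (Cconj a * z))) as H.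
  replace (1 - - (Cconj a * z))%C with (1 + Cconj a * z)%C in H by ring.
  rewrite Cmod_1, Cmod_opp, Cmod_mult, Cmod_conj in H.
  pose proof (Cmod_ge_0 a). pose proof (Cmod_ge_0 z). nra.
Qed.

Lemma mobius_num_den (a z : C) :
  Cmod (1 + Cconj a * z) ^ 2 - Cmod (z + a) ^ 2 = (1 - Cmod a ^ 2) * (1 - Cmod z ^ 2).
Proof.
  destruct a as [a1 a2], z as [z1 z2].
  rewrite !Cmod2_alt. unfold Re, Im, Cconj, Cplus, Cmult, RtoC; simpl. ring.
Qed.

Lemma mobius_mod (a z : C) : unit_disk a -> unit_disk z ->
  1 - Cmod (mobius a z) ^ 2 = (1 - Cmod a ^ 2) * (1 - Cmod z ^ 2) / Cmod (1 + Cconj a * z) ^ 2.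
Proof.
  intros Ha Hz. pose proof (mobius_den a z Ha Hz) as Hd.
  assert (0 < Cmod (1 + Cconj a * z)) by now apply Cmod_gt_0.
  rewrite <- mobius_num_den. unfold mobius. rewrite Cmod_div by easy. field. lra.
Qed.

Lemma mobius_disk (a z : C) : unit_disk a -> unit_disk z -> unit_disk (mobius a z).
Proof.
  intros Ha Hz. apply Cmod_lt_1_sq. pose proof (mobius_mod a z Ha Hz) as E.
  assert (0 < Cmod (1 + Cconj a * z)) by (apply Cmod_gt_0; now apply mobius_den).
  apply Cmod_lt_1_sq in Ha. apply Cmod_lt_1_sq in Hz.
  assert (0 < (1 - Cmod a ^ 2) * (1 - Cmod z ^ 2) / Cmod (1 + Cconj a * z) ^ 2).
  { apply Rdiv_lt_0_compat; [nra|]. now apply pow_lt. }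
  lra.
Qed.

Lemma mobius_0 (a : C) : mobius a 0 = a.
Proof. unfold mobius. replace (1 + Cconj a * 0)%C with (RtoC 1) by ring. field. Qed.

Lemma one_sub_Cmod_neq_0 (a : C) : unit_disk a -> (1 - a * Cconj a)%C <> 0.
Proof.
  intros Ha. rewrite <- Cmod2_conj, <- RtoC_minus. apply RtoC_neq0.
  apply Cmod_lt_1_sq in Ha. lra.
Qed.

Lemma mobius_inv (a z : C) : unit_disk a -> unit_disk z -> mobius (- a) (mobius a z) = z.
Proof.
  intros Ha Hz. unfold mobius. rewrite Copp_conj.
  pose proof (mobius_den a z Ha Hz) as Hd.
  pose proof (one_sub_Cmod_neq_0 a Ha) as H1. field. split; [easy|].
  intros E. apply H1. rewrite <- E. ring.
Qed.

Lemma unit_disk_opp (a : C) : unit_disk a -> unit_disk (- a)%C.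
Proof. unfold unit_disk. now rewrite Cmod_opp. Qed.

Lemma unit_disk_0 : unit_disk 0.
Proof. unfold unit_disk. rewrite Cmod_0. lra. Qed.

Lemma mobius_holo (a : C) : unit_disk a -> holo unit_disk (mobius a).
Proof.
  intros Ha. apply holo_div.
  - intros z Hz. now apply mobius_den.
  - apply holo_plus; [apply holo_id|apply holo_const].
  - apply holo_plus; [apply holo_const|]. apply holo_scal, holo_id.
Qed.

Lemma is_Cderive_unique (f : C -> C) z l1 l2 :
  is_Cderive f z l1 -> is_Cderive f z l2 -> l1 = l2.
Proof.
  intros H1 H2. apply is_C_derive_unique in H1. apply is_C_derive_unique in H2. congruence.
Qed.

Lemma is_Cderive_div (f g : C -> C) (z lf lg : C) :
  is_Cderive f z lf -> is_Cderive g z lg -> g z <> 0 ->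
  is_Cderive (fun w => f w / g w)%C z ((lf * g z - f z * lg) / (g z * g z))%C.
Proof.
  intros Hf Hg H0.
  replace ((lf * g z - f z * lg) / (g z * g z))%C
    with (lf * / g z + f z * (lg * (- / (g z * g z))))%C by (field; easy).
  apply (is_Cderive_mult f (fun w => / g w)%C); [easy|].
  apply (is_Cderive_comp Cinv g); [|easy]. now apply is_Cderive_Cinv.
Qed.

Lemma mobius_derive (a z : C) : (1 + Cconj a * z)%C <> 0 ->
  is_Cderive (mobius a) z ((1 - Cmod a ^ 2)%R / ((1 + Cconj a * z) * (1 + Cconj a * z)))%C.
Proof.
  intros Hd.
  replace ((1 - Cmod a ^ 2)%R / ((1 + Cconj a * z) * (1 + Cconj a * z)))%C with
    (((1 + 0) * (1 + Cconj a * z) - (z + a) * (0 + (0 * z + Cconj a * 1))) /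
     ((1 + Cconj a * z) * (1 + Cconj a * z)))%C.
  2:{ rewrite RtoC_minus, Cmod2_conj. field. easy. }
  apply (is_Cderive_div (fun z => z + a)%C (fun z => 1 + Cconj a * z)%C); [| |easy].
  - apply (is_Cderive_plus (fun z => z) (fun _ => a)); [apply is_Cderive_id|apply is_Cderive_const].
  - apply (is_Cderive_plus (fun _ => RtoC 1) (fun z => Cconj a * z)%C); [apply is_Cderive_const|].
    apply (is_Cderive_mult (fun _ => Cconj a) (fun z => z)); [apply is_Cderive_const|apply is_Cderive_id].
Qed.

Lemma mobius_derive_0 (a : C) : is_Cderive (mobius a) (RtoC 0) (RtoC (1 - Cmod a ^ 2)).
Proof.
  assert (E : (1 + Cconj a * 0)%C = RtoC 1) by ring.
  pose proof (mobius_derive a 0) as H. rewrite E in H.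
  replace (RtoC (1 - Cmod a ^ 2)) with ((1 - Cmod a ^ 2)%R / (1 * 1))%C by field.
  apply H, C1_nz.
Qed.

(** * The Schwarz lemma *)

(** Both parts of the Schwarz lemma are contained here, since [dquot om 0 l] is
    [om z / z] off the origin and [om'(0)] at the origin. Moving [z0] to the centre by an
    automorphism turns the maximum principle into a mean value over circles
    tending to the boundary, where the modulus of the automorphism tends to 1. *)
Lemma schwarz_dquot (om : C -> C) (l z0 : C) :
  holo unit_disk om -> (forall z, unit_disk z -> unit_disk (om z)) -> om 0 = 0 ->
  is_Cderive om (RtoC 0) l -> unit_disk z0 -> Cmod (dquot om 0 l z0) <= 1.
Proof.
  intros Hom HD H0 Hl Hz0.
  set (k := dquot om 0 l). set (h := fun s => k (mobius z0 s)).
  pose proof (Cmod_ge_0 z0) as Hm0. pose proof Hz0 as Hz0'. unfold unit_disk in Hz0'.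
  assert (Hh : holo (fun s => Cmod s < 1 /\ s <> - z0)%C h).
  { apply (holo_comp _ (fun z => unit_disk z /\ z <> 0) k (mobius z0)).
    - intros s [Hs Hne]. split; [now apply mobius_disk|]. intros E. apply Hne.
      assert (E2 : (s + z0)%C = 0).
      { replace (s + z0)%C with (mobius z0 s * (1 + Cconj z0 * s))%C
          by (unfold mobius; field; now apply mobius_den).
        rewrite E. ring. }
      replace s with ((s + z0) - z0)%C by ring. rewrite E2. ring.
    - now apply dquot_holo.
    - apply (holo_subset unit_disk); [intros z [Hz _]; exact Hz|now apply mobius_holo]. }
  assert (Hc : forall s, Cmod s < 1 -> Ccontinuous h s).
  { intros s Hs. apply (Ccontinuous_comp (mobius z0) k).
    - apply (holo_continuous unit_disk); [now apply mobius_holo|exact Hs].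
    - apply (dquot_continuous unit_disk); auto. now apply mobius_disk. }
  set (q := Cmod (k z0)). assert (Hq0 : 0 <= q) by apply Cmod_ge_0.
  set (c := (1 + Cmod z0) / (1 - Cmod z0)).
  assert (Hc0 : 0 < c) by (apply Rdiv_lt_0_compat; lra).
  assert (Key : forall r, 0 <= r < 1 -> 0 < 1 - (1 - r ^ 2) * c -> q ^ 2 * (1 - (1 - r ^ 2) * c) <= 1).
  { intros r Hr Hpos. set (m := sqrt (1 - (1 - r ^ 2) * c)).
    assert (Hm : 0 < m) by now apply sqrt_lt_R0.
    assert (Hm2 : m ^ 2 = 1 - (1 - r ^ 2) * c) by (apply pow2_sqrt; lra).
    assert (Q : q <= / m).
    { replace q with (Cmod (h 0)) by (unfold h; now rewrite mobius_0).
      apply (center_le_circle h 1 (- z0) r); auto. intros t. unfold h.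
      set (s := circ r t).
      assert (Hs : Cmod s = r) by (unfold s; rewrite Cmod_circ, Rabs_right; lra).
      assert (Hsd : unit_disk s) by (unfold unit_disk; lra).
      pose proof (mobius_mod z0 s Hz0 Hsd) as E. rewrite Hs in E.
      pose proof (mobius_den_bound z0 s Hsd) as B.
      set (d := Cmod (1 + Cconj z0 * s)) in *.
      assert (B2 : (1 - Cmod z0 ^ 2) * (1 - r ^ 2) / d ^ 2 <= (1 - r ^ 2) * c).
      { apply Rmult_le_reg_r with (d ^ 2); [apply pow_lt; lra|].
        replace ((1 - Cmod z0 ^ 2) * (1 - r ^ 2) / d ^ 2 * d ^ 2)
          with ((1 - r ^ 2) * c * (1 - Cmod z0) ^ 2) by (unfold c; field; lra).
        apply Rmult_le_compat_l; [|apply pow_incr; lra].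
        apply Rmult_le_pos; nra. }
      set (T := mobius z0 s) in *.
      assert (HT : m <= Cmod T).
      { pose proof (Cmod_ge_0 T). apply Rnot_lt_le. intros L. nra. }
      unfold k. rewrite dquot_off.
      - rewrite H0. replace ((om T - 0) / (T - 0))%C with (om T / T)%C by (unfold Cdiv; f_equal; [ring|f_equal; ring]).
        assert (HT0 : T <> 0) by (apply Cmod_gt_0; lra).
        rewrite Cmod_div by easy.
        assert (Cmod (om T) < 1) by (apply HD; now apply mobius_disk).
        assert (/ Cmod T <= / m) by (apply Rinv_le_contravar; lra).
        assert (0 < / Cmod T) by (apply Rinv_0_lt_compat; lra).
        pose proof (Cmod_ge_0 (om T)). unfold Rdiv. nra.
      - apply Cmod_gt_0. lra. }
    assert (q * m <= 1).
    { replace 1 with (/ m * m) by (field; lra). apply Rmult_le_compat_r; lra. }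
    rewrite <- Hm2. assert (0 <= q * m) by (apply Rmult_le_pos; lra). nra. }
  fold k. fold q. apply Rnot_lt_le. intros Hq.
  (* any r with (1 - r^2) c < 1 - 1/q^2 violates the bound just proved *)
  set (e := Rmin (1 / 2) ((1 - / q ^ 2) / (2 * c))).
  assert (Hq2 : / q ^ 2 < 1).
  { rewrite <- Rinv_1. apply Rinv_lt_contravar; nra. }
  assert (He : 0 < e) by (apply Rmin_pos; [lra|apply Rdiv_lt_0_compat; lra]).
  assert (He1 : e <= 1 / 2) by apply Rmin_l.
  assert (He2 : e * c <= (1 - / q ^ 2) / 2).
  { replace ((1 - / q ^ 2) / 2) with ((1 - / q ^ 2) / (2 * c) * c) by (field; split; nra).
    apply Rmult_le_compat_r; [lra|apply Rmin_r]. }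
  assert (Hs2 : sqrt (1 - e) ^ 2 = 1 - e) by (apply pow2_sqrt; lra).
  assert (Hs : 0 <= sqrt (1 - e) < 1).
  { split; [apply sqrt_pos|]. rewrite <- sqrt_1 at 2. apply sqrt_lt_1; lra. }
  assert (0 < / q ^ 2) by (apply Rinv_0_lt_compat; nra).
  specialize (Key _ Hs). rewrite Hs2 in Key. replace (1 - (1 - e)) with e in Key by ring.
  assert (K : q ^ 2 * (1 - e * c) <= 1) by (apply Key; lra).
  assert (q ^ 2 * ((1 + / q ^ 2) / 2) <= 1).
  { eapply Rle_trans; [|exact K]. apply Rmult_le_compat_l; nra. }
  replace (q ^ 2 * ((1 + / q ^ 2) / 2)) with ((q ^ 2 + 1) / 2) in H1 by (field; nra). nra.
Qed.

Lemma schwarz (om : C -> C) (z : C) :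
  holo unit_disk om -> (forall z, unit_disk z -> unit_disk (om z)) -> om 0 = 0 ->
  unit_disk z -> Cmod (om z) <= Cmod z.
Proof.
  intros Hom HD H0 Hz. pose proof Hom as [o1 Ho]. destruct (Ho 0 unit_disk_0) as [Hl _].
  pose proof (schwarz_dquot om _ z Hom HD H0 Hl Hz) as S.
  destruct (Ceq_dec z 0) as [->|Hne]; [rewrite H0; lra|].
  rewrite dquot_off, H0 in S by easy.
  replace ((om z - 0) / (z - 0))%C with (om z / z)%C in S by (unfold Cdiv; f_equal; [ring|f_equal; ring]).
  rewrite Cmod_div in S by easy.
  assert (0 < Cmod z) by now apply Cmod_gt_0.
  replace (Cmod (om z)) with (Cmod (om z) / Cmod z * Cmod z) by (field; lra).
  rewrite <- (Rmult_1_l (Cmod z)) at 3. apply Rmult_le_compat_r; lra.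
Qed.

Lemma schwarz_derive (om : C -> C) (l : C) :
  holo unit_disk om -> (forall z, unit_disk z -> unit_disk (om z)) -> om 0 = 0 ->
  is_Cderive om (RtoC 0) l -> Cmod l <= 1.
Proof.
  intros Hom HD H0 Hl. rewrite <- (dquot_at om 0 l).
  now apply schwarz_dquot; try apply unit_disk_0.
Qed.

(** Both sides are [1 - d^2] for a pseudo-hyperbolic distance [d], which in the
    form [|mobius (- y) z|] reduces the claim to the Schwarz lemma. *)
Lemma schwarz_pick (om : C -> C) (z y : C) :
  holo unit_disk om -> (forall z, unit_disk z -> unit_disk (om z)) ->
  unit_disk z -> unit_disk y ->
  (1 - Cmod y ^ 2) * (1 - Cmod z ^ 2) / Cmod (1 - Cconj y * z) ^ 2 <=
  (1 - Cmod (om y) ^ 2) * (1 - Cmod (om z) ^ 2) / Cmod (1 - Cconj (om y) * om z) ^ 2.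
Proof.
  intros Hom HD Hz Hy.
  assert (E : forall a b, unit_disk a -> unit_disk b ->
    1 - Cmod (mobius (- a) b) ^ 2 = (1 - Cmod a ^ 2) * (1 - Cmod b ^ 2) / Cmod (1 - Cconj a * b) ^ 2).
  { intros a b Ha Hb. rewrite mobius_mod; [|now apply unit_disk_opp|easy].
    rewrite Cmod_opp, Copp_conj.
    now replace (1 + - Cconj a * b)%C with (1 - Cconj a * b)%C by ring. }
  rewrite <- !E by auto.
  set (s := mobius (- y) z).
  assert (Hs : unit_disk s) by (apply mobius_disk; auto using unit_disk_opp).
  pose proof (schwarz (fun s => mobius (- om y) (om (mobius y s))) s) as S.
  assert (Hys : mobius y s = z).
  { unfold s. pose proof (mobius_inv (- y) z (unit_disk_opp y Hy) Hz) as I.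
    replace (- - y)%C with y in I by ring. exact I. }
  cbv beta in S. rewrite Hys in S.
  assert (S' : Cmod (mobius (- om y) (om z)) <= Cmod s).
  { apply S; auto.
    - apply (holo_comp unit_disk unit_disk (mobius (- om y)) (fun s => om (mobius y s))).
      + intros; apply HD; now apply mobius_disk.
      + apply mobius_holo, unit_disk_opp; auto.
      + apply (holo_comp unit_disk unit_disk om (mobius y)); auto using mobius_holo.
        intros; now apply mobius_disk.
    - intros u Hu. apply mobius_disk; [apply unit_disk_opp; auto|apply HD; now apply mobius_disk].
    - rewrite mobius_0. unfold mobius.
      replace (om y + - om y)%C with (RtoC 0) by ring. unfold Cdiv. ring. }
  pose proof (Cmod_ge_0 (mobius (- om y) (om z))). nra.
Qed.

(** * Functions with bounded imaginary part *)

Lemma is_RInt_scal_sin (A a b : R) : is_RInt (fun t => A * sin t) a b (A * (cos a - cos b)).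
Proof.
  replace (A * (cos a - cos b)) with (minus (- A * cos b) (- A * cos a))
    by (unfold minus, plus, opp; simpl; ring).
  apply (is_RInt_derive (fun t => - A * cos t)).
  - intros t _. auto_derive; auto. ring.
  - intros t _. apply (continuous_scal_trig (fun _ => A) (fun t => t) sin).
    + intros u. apply continuous_sin.
    + apply continuous_const.
    + apply continuous_id.
Qed.

(** On the circle of radius [r], the integral of [Im G] against [sin t] is
    [PI r Re G'(0)], and for [|Im G| <= M] it is at most [4 M], the integral of
    [M |sin t|]. The constant [4 / PI] is attained by the conformal map onto the
    strip [|Im w| < M]; this sharpness is what produces the exact value of the
    angle in both halves of the theorem. *)
Lemma strip_derive_center (G : C -> C) (l : C) (M : R) :
  holo unit_disk G -> (forall z, unit_disk z -> Rabs (Im (G z)) <= M) ->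
  is_Cderive G (RtoC 0) l -> Re l <= 4 * M / PI.
Proof.
  intros HG HM Hl. pose proof PI_RGT_0 as HPI.
  set (c0 := Im (G 0)).
  assert (Key : forall r, 0 < r < 1 -> PI * r * Re l <= 4 * M).
  { intros r Hr.
    assert (Hin : forall t, unit_disk (circ r t)).
    { intros t. unfold unit_disk. rewrite Cmod_circ, Rabs_right; lra. }
    assert (Hsub : forall k, holo unit_disk k -> holo (fun z => Cmod z < 1 /\ z <> 0) k).
    { intros k. apply holo_subset. now intros z [Hz _]. }
    pose proof (mean_value (dquot G 0 l) 1 0 (dquot_holo unit_disk G 0 l HG)
      (fun z => dquot_continuous unit_disk G 0 l z HG Hl) r) as MV1.
    rewrite dquot_at in MV1.
    set (k2 := fun z => (z * (G z - G 0))%C).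
    assert (Hk2 : holo unit_disk k2).
    { apply (holo_mult _ (fun z => z) (fun z => G z - G 0)%C); [apply holo_id|].
      apply (holo_minus _ G (fun _ => G 0)); [easy|apply holo_const]. }
    pose proof (mean_value k2 1 0 (Hsub _ Hk2)
      (fun z => holo_continuous unit_disk k2 z Hk2) r) as MV2.
    assert (E0 : Re (k2 0) = 0) by (unfold k2; rewrite Cmult_0_l; reflexivity).
    rewrite E0, Rmult_0_r in MV2.
    assert (Ex1 : forall a b, ex_RInt (fun t => Re (dquot G 0 l (circ r t))) a b).
    { intros a b. apply ex_RInt_circ. intros t. now apply (dquot_continuous unit_disk). }
    assert (Ex2 : forall a b, ex_RInt (fun t => Re (k2 (circ r t))) a b).
    { intros a b. apply ex_RInt_circ. intros t. now apply (holo_continuous unit_disk). }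
    assert (EI : forall t, minus (scal r (Re (dquot G 0 l (circ r t)))) (scal (/ r) (Re (k2 (circ r t))))
                 = 2 * (Im (G (circ r t)) - c0) * sin t).
    { intros t.
      assert (Hc0 : circ r t <> 0).
      { apply Cmod_gt_0. rewrite Cmod_circ, Rabs_right; lra. }
      rewrite dquot_off by easy. unfold k2, c0.
      assert (EC : ((G (circ r t) - G 0) / (circ r t - 0))%C =
                   (/ r * ((G (circ r t) - G 0) * Cconj (expi t)))%C).
      { assert (Ee : (expi t * Cconj (expi t))%C = 1).
        { rewrite <- Cmod2_conj, Cmod_expi. f_equal. ring. }
        rewrite circ_expi.
        assert (H1 : RtoC r <> 0) by (apply RtoC_neq0; lra).
        assert (H2 : expi t <> 0) by (apply Cmod_gt_0; rewrite Cmod_expi; lra).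
        replace (Cconj (expi t)) with (/ expi t)%C.
        - field. auto.
        - transitivity (/ expi t * (expi t * Cconj (expi t)))%C; [rewrite Ee; ring|field; easy]. }
      rewrite EC, <- RtoC_inv by lra.
      rewrite re_scal_l. unfold circ.
      destruct (G (r * cos t, r * sin t)) as [a b]. destruct (G 0) as [a0 b0].
      unfold expi, minus, plus, opp, scal; simpl. unfold mult; simpl. field. lra. }
    assert (Ex : forall a b, ex_RInt (fun t => 2 * (Im (G (circ r t)) - c0) * sin t) a b).
    { intros a b. eapply ex_RInt_ext; [intros t _; apply EI|].
      apply (@ex_RInt_minus R_NormedModule); now apply (@ex_RInt_scal R_NormedModule). }
    assert (T : RInt (fun t => 2 * (Im (G (circ r t)) - c0) * sin t) 0 (2 * PI) = 2 * PI * r * Re l).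
    { transitivity (minus (scal r (RInt (fun t => Re (dquot G 0 l (circ r t))) 0 (2 * PI)))
                          (scal (/ r) (RInt (fun t => Re (k2 (circ r t))) 0 (2 * PI)))).
      { apply is_RInt_unique.
        apply (is_RInt_ext (fun t => minus (scal r (Re (dquot G 0 l (circ r t))))
                                           (scal (/ r) (Re (k2 (circ r t)))))).
        - intros t _. apply EI.
        - apply (@is_RInt_minus R_NormedModule); apply (@is_RInt_scal R_NormedModule);
            apply (@RInt_correct R_CompleteNormedModule); auto. }
      rewrite MV1, MV2 by lra. unfold minus, plus, opp, scal; simpl. unfold mult; simpl. ring. }
    rewrite <- (RInt_Chasles _ 0 PI (2 * PI)) in T by auto.
    assert (B1 : RInt (fun t => 2 * (Im (G (circ r t)) - c0) * sin t) 0 PI <= 2 * (M - c0) * 2).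
    { replace (2 * (M - c0) * 2) with (RInt (fun t => 2 * (M - c0) * sin t) 0 PI).
      - apply RInt_le; [lra|auto|eexists; apply is_RInt_scal_sin|].
        intros t Ht. assert (0 < sin t) by (apply sin_gt_0; lra).
        pose proof (HM _ (Hin t)) as B. apply Rabs_le_between in B.
        apply Rmult_le_compat_r; lra.
      - rewrite (is_RInt_unique _ _ _ _ (is_RInt_scal_sin _ _ _)), cos_0, cos_PI.
        match goal with |- ?a = ?b => change (@eq R a b) end. ring. }
    assert (B2 : RInt (fun t => 2 * (Im (G (circ r t)) - c0) * sin t) PI (2 * PI) <= 2 * (M + c0) * 2).
    { replace (2 * (M + c0) * 2) with (RInt (fun t => 2 * (- M - c0) * sin t) PI (2 * PI)).
      - apply RInt_le; [lra|auto|eexists; apply is_RInt_scal_sin|].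
        intros t Ht. assert (sin t < 0) by (apply sin_lt_0; lra).
        pose proof (HM _ (Hin t)) as B. apply Rabs_le_between in B. nra.
      - rewrite (is_RInt_unique _ _ _ _ (is_RInt_scal_sin _ _ _)), cos_2PI, cos_PI.
        match goal with |- ?a = ?b => change (@eq R a b) end. ring. }
    unfold plus in T; simpl in T. nra. }
  assert (HM0 : 0 <= M) by (eapply Rle_trans; [apply Rabs_pos|apply (HM 0 unit_disk_0)]).
  apply Rnot_lt_le. intros L.
  assert (HL : 4 * M < PI * Re l).
  { replace (4 * M) with (PI * (4 * M / PI)) by (field; lra). apply Rmult_lt_compat_l; lra. }
  set (X := PI * Re l) in *.
  (* a radius r with r X > 4 M *)
  specialize (Key ((4 * M + X) / (2 * X))).
  assert (Hr : 0 < (4 * M + X) / (2 * X) < 1).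
  { split; [apply Rdiv_lt_0_compat; lra|].
    apply Rmult_lt_reg_r with (2 * X); [lra|]. unfold Rdiv. rewrite Rmult_assoc, Rinv_l; lra. }
  specialize (Key Hr).
  replace (PI * ((4 * M + X) / (2 * X)) * Re l) with ((4 * M + X) / 2) in Key.
  - lra.
  - unfold X. field. fold X. split; [|lra]. intros E. unfold X in *. nra.
Qed.

Lemma strip_derive (g : C -> C) (z l : C) (M : R) :
  holo unit_disk g -> (forall z, unit_disk z -> Rabs (Im (g z)) <= M) ->
  unit_disk z -> is_Cderive g z l -> (1 - Cmod z ^ 2) * Cmod l <= 4 * M / PI.
Proof.
  intros Hg HM Hz Hl.
  assert (H1 : 0 < 1 - Cmod z ^ 2) by (apply Cmod_lt_1_sq in Hz; lra).
  (* precompose with a rotation making the derivative at the centre real *)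
  assert (Hc : exists c, Cmod c = 1 /\ (c * l)%C = Cmod l).
  { destruct (Ceq_dec l 0) as [->|Hl0].
    - exists 1. rewrite Cmod_1, Cmod_0. split; [easy|ring].
    - assert (0 < Cmod l) by now apply Cmod_gt_0.
      assert (HC : RtoC (Cmod l) <> 0) by (apply RtoC_neq0; lra).
      exists (Cconj l / Cmod l)%C. split.
      + rewrite Cmod_div, Cmod_conj, Cmod_R, Rabs_right by (auto; lra). field. lra.
      + replace (Cconj l / Cmod l * l)%C with ((l * Cconj l) / Cmod l)%C by (field; easy).
        rewrite <- Cmod2_conj, <- RtoC_div by lra. f_equal. field. lra. }
  destruct Hc as [c [Hc1 Hcl]].
  assert (Hrot : forall s, unit_disk s -> unit_disk (c * s)%C).
  { intros s. unfold unit_disk. rewrite Cmod_mult, Hc1, Rmult_1_l. easy. }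
  assert (Hrh : holo unit_disk (fun s => c * s)%C) by (apply holo_scal, holo_id).
  pose proof (strip_derive_center (fun s => g (mobius z (c * s)))
    ((0 * 0 + c * 1) * (1 - Cmod z ^ 2)%R * l)%C M) as S.
  assert (E : ((0 * 0 + c * 1) * (1 - Cmod z ^ 2)%R * l)%C = RtoC ((1 - Cmod z ^ 2) * Cmod l)).
  { rewrite RtoC_mult, <- Hcl. ring. }
  rewrite E, re_RtoC in S. apply S; clear S.
  - apply (holo_comp unit_disk unit_disk g (fun s => mobius z (c * s)%C)); auto.
    + intros s Hs. apply mobius_disk; auto.
    + apply (holo_comp unit_disk unit_disk (mobius z) (fun s => c * s)%C); auto using mobius_holo.
  - intros s Hs. apply HM. apply mobius_disk; auto.
  - rewrite <- E.
    apply (is_Cderive_comp g (fun s => mobius z (c * s)%C)).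
    + replace (c * 0)%C with (RtoC 0) by ring. now rewrite mobius_0.
    + apply (is_Cderive_comp (mobius z) (fun s => c * s)%C).
      * replace (c * 0)%C with (RtoC 0) by ring. apply mobius_derive_0.
      * apply (is_Cderive_mult (fun _ => c) (fun s => s)); [apply is_Cderive_const|apply is_Cderive_id].
Qed.

(** * Power series *)

Notation is_Cseries := (@is_series C_AbsRing C_NormedModule).
Notation is_Cpseries := (@is_pseries C_AbsRing C_NormedModule).

Lemma pow_n_Cpow (z : C) (n : nat) : @pow_n C_AbsRing z n = (z ^ n)%C.
Proof. induction n as [|n IH]; [reflexivity|]. simpl. now rewrite IH. Qed.

Lemma is_Cpseries_iff (a : nat -> C) (z l : C) :
  is_Cpseries a z l <-> is_Cseries (fun n => z ^ n * a n)%C l.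
Proof.
  unfold is_pseries. split; apply is_series_ext; intros n; rewrite <- (pow_n_Cpow z n); reflexivity.
Qed.

Lemma Cmod_series_le (u : nat -> C) (l : C) (b : nat -> R) (L : R) :
  is_Cseries u l -> is_series b L -> (forall n, Cmod (u n) <= b n) -> Cmod l <= L.
Proof.
  intros Hu Hb Hle.
  assert (Hn : is_lim_seq (fun n => norm (sum_n u n)) (norm l)).
  { eapply (filterlim_comp _ _ _ (sum_n u) norm); [exact Hu|apply filterlim_norm]. }
  assert (Hb' : is_lim_seq (sum_n b) L) by exact Hb.
  assert (H := is_lim_seq_le (fun n => norm (sum_n u n)) (sum_n b) (norm l) L).
  apply H; auto. intros n. unfold sum_n. eapply Rle_trans; [exact (@norm_sum_n_m C_AbsRing C_NormedModule u 0 n)|].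
  apply sum_n_m_le. intros k. apply Hle.
Qed.

Lemma series_term_bounded (u : nat -> C) (l : C) :
  is_Cseries u l -> exists B, 0 < B /\ forall n, Cmod (u n) <= B.
Proof.
  intros H. destruct (filterlim_bounded (sum_n u)) as [M HM]; [now exists l|].
  exists (2 * M + 1).
  assert (HM' : forall n, Cmod (sum_n u n) <= M) by exact HM.
  assert (M0 : 0 <= M) by (eapply Rle_trans; [apply Cmod_ge_0|apply (HM' 0%nat)]).
  split; [lra|]. intros [|n].
  - specialize (HM' 0%nat). rewrite sum_O in HM'. lra.
  - replace (u (S n)) with (sum_n u (S n) - sum_n u n)%C.
    + pose proof (Cmod_triangle (sum_n u (S n)) (- sum_n u n)) as T. rewrite Cmod_opp in T.
      pose proof (HM' (S n)). pose proof (HM' n). unfold Cminus. lra.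
    + rewrite sum_Sn. unfold plus; simpl. ring.
Qed.

Lemma sq_le_geom (x : R) (n : nat) : 0 < x -> INR n ^ 2 <= / x ^ 2 * ((1 + x) ^ n) ^ 2.
Proof.
  intros Hx. pose proof (poly n x Hx) as P. pose proof (pos_INR n).
  assert (x ^ 2 <> 0) by nra.
  apply Rmult_le_reg_l with (x ^ 2); [nra|].
  rewrite <- Rmult_assoc, Rinv_r, Rmult_1_l by easy.
  assert (0 <= INR n * x) by nra. nra.
Qed.

Lemma pseries_weight_summable (a : nat -> C) (s : R) :
  (forall z, unit_disk z -> exists l, is_Cpseries a z l) -> 0 < s < 1 ->
  ex_series (fun n => INR n ^ 2 * Cmod (a n) * s ^ n).
Proof.
  intros Ha Hs.
  (* with [x] this small the series still converges at [s (1 + x) ^ 3 < 1]; two of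
     the three factors [(1 + x) ^ n] absorb [n ^ 2], the third is left for
     convergence *)
  set (x := (1 - s) / 8). set (t := 1 + x).
  assert (Hx : 0 < x) by (unfold x; lra).
  set (rho := s * t ^ 3).
  assert (Ht3 : t ^ 3 <= 1 + (1 - s)).
  { unfold t, x. assert (0 < (1 - s) < 1) by lra.
    set (e := 1 - s) in *. nra. }
  assert (Hrho : 0 < rho < 1).
  { unfold rho. assert (0 < t ^ 3) by (apply pow_lt; unfold t; lra). split; nra. }
  destruct (Ha (RtoC rho)) as [l Hl].
  { unfold unit_disk. rewrite Cmod_R, Rabs_right; lra. }
  apply is_Cpseries_iff in Hl. destruct (series_term_bounded _ _ Hl) as [B [HB HBn]].
  assert (Hti : Rabs (/ t) < 1).
  { assert (1 < t) by (unfold t; lra). rewrite Rabs_right.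
    - rewrite <- Rinv_1. apply Rinv_lt_contravar; lra.
    - apply Rle_ge, Rlt_le, Rinv_0_lt_compat. lra. }
  apply (@ex_series_le R_AbsRing R_CompleteNormedModule _ (fun n => (B * / x ^ 2) * (/ t) ^ n)).
  - intros n. change (Rabs (INR n ^ 2 * Cmod (a n) * s ^ n) <= B * / x ^ 2 * (/ t) ^ n).
    assert (Ht : 0 < t ^ n) by (apply pow_lt; unfold t; lra).
    assert (Hsn : 0 < s ^ n) by (apply pow_lt; lra).
    pose proof (Cmod_ge_0 (a n)) as Han. pose proof (pow2_ge_0 (INR n)) as Hn.
    rewrite Rabs_right by (apply Rle_ge, Rmult_le_pos; [apply Rmult_le_pos|]; lra).
    specialize (HBn n). rewrite Cmod_mult, Cmod_pow, Cmod_R, Rabs_right in HBn by lra.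
    unfold rho in HBn. rewrite Rpow_mult_distr in HBn.
    replace ((t ^ 3) ^ n) with ((t ^ n) ^ 3) in HBn by (rewrite <- !pow_mult; f_equal; lia).
    pose proof (sq_le_geom x n Hx) as Q. fold t in Q.
    rewrite pow_inv.
    apply Rle_trans with (/ x ^ 2 * (t ^ n) ^ 2 * (Cmod (a n) * s ^ n)).
    + rewrite Rmult_assoc. apply Rmult_le_compat_r; [nra|exact Q].
    + replace (B * / x ^ 2 * / t ^ n) with (/ x ^ 2 * (B * / t ^ n)) by ring.
      rewrite Rmult_assoc. apply Rmult_le_compat_l; [apply Rlt_le, Rinv_0_lt_compat; nra|].
      apply Rmult_le_reg_r with (t ^ n); [easy|].
      replace (B * / t ^ n * t ^ n) with B by (field; lra).
      replace ((t ^ n) ^ 2 * (Cmod (a n) * s ^ n) * t ^ n) with (s ^ n * (t ^ n) ^ 3 * Cmod (a n)) by ring.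
      exact HBn.
  - apply (@ex_series_scal R_AbsRing R_NormedModule). eexists. now apply is_series_geom.
Qed.

Lemma Cpow_sub_bound (z w : C) (s : R) (n : nat) :
  0 <= s -> Cmod z <= s -> Cmod w <= s ->
  s ^ 2 * Cmod (w ^ n - z ^ n - INR n * z ^ pred n * (w - z)) <= INR n ^ 2 * s ^ n * Cmod (w - z) ^ 2.
Proof.
  intros Hs Hz Hw. induction n as [|n IH].
  - simpl. replace (1 - 1 - 0 * 1 * (w - z))%C with (RtoC 0) by ring. rewrite Cmod_0. lra.
  - replace (w ^ S n - z ^ S n - INR (S n) * z ^ pred (S n) * (w - z))%C
      with (w * (w ^ n - z ^ n - INR n * z ^ pred n * (w - z)) +
            INR n * z ^ pred n * (w - z) * (w - z))%C.
    2:{ rewrite S_INR, RtoC_plus. destruct n as [|n].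
        - simpl. ring.
        - simpl pred. rewrite !Cpow_S. ring. }
    set (E := (w ^ n - z ^ n - INR n * z ^ pred n * (w - z))%C) in *.
    set (u := Cmod (w - z)) in *. assert (Hu : 0 <= u) by apply Cmod_ge_0.
    assert (Hn : 0 <= INR n) by apply pos_INR.
    assert (Hsn : 0 <= s ^ n) by now apply pow_le.
    assert (HE : 0 <= Cmod E) by apply Cmod_ge_0.
    assert (B : s * (INR n * Cmod z ^ pred n) <= INR n * s ^ n).
    { destruct n as [|n]; [simpl; lra|]. simpl pred.
      assert (Cmod z ^ n <= s ^ n) by (apply pow_incr; split; [apply Cmod_ge_0|easy]).
      simpl (s ^ S n). assert (0 <= s * INR (S n)) by nra.
      replace (INR (S n) * (s * s ^ n)) with (s * INR (S n) * s ^ n) by ring.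
      rewrite <- Rmult_assoc. now apply Rmult_le_compat_l. }
    eapply Rle_trans; [apply Rmult_le_compat_l; [nra|apply Cmod_triangle]|].
    rewrite !Cmod_mult, Cmod_pow, Cmod_R, Rabs_right by lra. fold u.
    rewrite S_INR. simpl (s ^ S n).
    assert (B1 : s ^ 2 * (Cmod w * Cmod E) <= s * (INR n ^ 2 * s ^ n * u ^ 2)).
    { apply Rle_trans with (s * (s ^ 2 * Cmod E)).
      - assert (Cmod w * Cmod E <= s * Cmod E) by now apply Rmult_le_compat_r. nra.
      - now apply Rmult_le_compat_l. }
    assert (B2 : s ^ 2 * (INR n * Cmod z ^ pred n * u * u) <= s * (INR n * s ^ n * u ^ 2)).
    { replace (s ^ 2 * (INR n * Cmod z ^ pred n * u * u))
        with (s * (u ^ 2 * (s * (INR n * Cmod z ^ pred n)))) by ring.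
      apply Rmult_le_compat_l; [easy|].
      replace (INR n * s ^ n * u ^ 2) with (u ^ 2 * (INR n * s ^ n)) by ring.
      apply Rmult_le_compat_l; [nra|easy]. }
    assert (0 <= s * s ^ n * u ^ 2) by (repeat apply Rmult_le_pos; nra).
    nra.
Qed.

(** The remainder of first order of the monomial [z ^ n] is at most
    [n ^ 2 s ^ n / s ^ 2] times [|w - z| ^ 2] in the disk of radius [s], and these
    bounds are summable against the coefficients. *)
Lemma pseries_derive (a : nat -> C) (f : C -> C) :
  (forall z, unit_disk z -> is_Cpseries a z (f z)) ->
  forall z, unit_disk z -> is_Cderive f z (C_derive f z) /\
    is_Cpseries (fun n => INR (S n) * a (S n))%C z (C_derive f z).
Proof.
  intros Hf z Hz. unfold unit_disk in Hz. pose proof (Cmod_ge_0 z) as Hz0.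
  set (s := (1 + Cmod z) / 2). assert (Hs : Cmod z < s < 1) by (unfold s; lra).
  destruct (pseries_weight_summable a s) as [K HK].
  { intros y Hy. exists (f y). now apply Hf. }
  { lra. }
  assert (Hex : @ex_series C_AbsRing C_NormedModule (fun n => z ^ n * (INR (S n) * a (S n)))%C).
  { apply (@ex_series_le C_AbsRing C_CompleteNormedModule _
      (fun n => / s * (INR (S n) ^ 2 * Cmod (a (S n)) * s ^ S n))).
    - intros n. change (Cmod (z ^ n * (INR (S n) * a (S n))) <= / s * (INR (S n) ^ 2 * Cmod (a (S n)) * s ^ S n)).
      rewrite !Cmod_mult, Cmod_pow, Cmod_R, Rabs_right by (apply Rle_ge, pos_INR).
      replace (/ s * (INR (S n) ^ 2 * Cmod (a (S n)) * s ^ S n))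
        with (s ^ n * (INR (S n) ^ 2 * Cmod (a (S n)))) by (simpl; field; lra).
      assert (Cmod z ^ n <= s ^ n) by (apply pow_incr; lra).
      assert (1 <= INR (S n)) by (rewrite S_INR; pose proof (pos_INR n); lra).
      pose proof (Cmod_ge_0 (a (S n))).
      apply Rmult_le_compat; [apply pow_le; lra|nra|easy|].
      apply Rmult_le_compat_r; nra.
    - apply (@ex_series_scal R_AbsRing R_NormedModule).
      apply (ex_series_incr_1 (fun n => INR n ^ 2 * Cmod (a n) * s ^ n)). now exists K. }
  assert (Hex' : exists l : C, is_Cseries (fun n => z ^ n * (INR (S n) * a (S n)))%C l) by exact Hex.
  destruct Hex' as [l Hl].
  assert (HD : is_Cderive f z l).
  { apply is_Cderive_eps. intros eps He.
    set (L := Rabs K / s ^ 2 + 1).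
    assert (HL : 0 < L).
    { unfold L. assert (0 <= Rabs K / s ^ 2) by (apply Rdiv_le_0_compat; [apply Rabs_pos|apply pow_lt; lra]). lra. }
    exists (Rmin (s - Cmod z) (eps / L)). split.
    { apply Rmin_pos; [lra|now apply Rdiv_lt_0_compat]. }
    intros w Hw.
    assert (Hw1 : Cmod (w - z) < s - Cmod z) by (eapply Rlt_le_trans; [exact Hw|apply Rmin_l]).
    assert (Hw2 : Cmod (w - z) < eps / L) by (eapply Rlt_le_trans; [exact Hw|apply Rmin_r]).
    pose proof (Cmod_triangle_rev w z) as T.
    assert (Hws : Cmod w <= s) by lra.
    (* the shifted derivative series, with the n = 0 term put back *)
    assert (Hl' : is_Cseries (fun n => a n * (INR n * z ^ pred n))%C l).
    { apply (@is_series_decr_1 C_AbsRing C_NormedModule).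
      replace (plus l (opp _)) with l.
      - apply is_series_ext with (2 := Hl). intros n. Ceq. simpl pred. ring.
      - unfold plus, opp; simpl. Ceq. ring. }
    pose proof (Hf z Hz) as Fz. pose proof (Hf w) as Fw. apply is_Cpseries_iff in Fz.
    assert (Hwd : unit_disk w) by (unfold unit_disk; lra).
    specialize (Fw Hwd). apply is_Cpseries_iff in Fw.
    pose proof (is_series_minus _ _ _ _ (is_series_minus _ _ _ _ Fw Fz)
      (@is_series_scal C_AbsRing C_NormedModule (w - z)%C _ _ Hl')) as D.
    assert (B : Cmod ((f w - f z) - (w - z) * l) <= K * (Cmod (w - z) ^ 2 / s ^ 2)).
    { eapply Cmod_series_le; [exact D| |].
      - apply (is_series_scal_r (Cmod (w - z) ^ 2 / s ^ 2)). exact HK.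
      - intros n. cbv beta.
        match goal with |- Cmod ?X <= _ =>
          replace X with (a n * (w ^ n - z ^ n - INR n * z ^ pred n * (w - z)))%C end.
        2:{ unfold plus, opp, scal; simpl. unfold mult; simpl. rewrite (pow_n_Cpow w n), (pow_n_Cpow z n). ring. }
        rewrite Cmod_mult.
        apply Rmult_le_reg_l with (s ^ 2); [apply pow_lt; lra|].
        replace (s ^ 2 * (INR n ^ 2 * Cmod (a n) * s ^ n * (Cmod (w - z) ^ 2 / s ^ 2)))
          with (Cmod (a n) * (INR n ^ 2 * s ^ n * Cmod (w - z) ^ 2)) by (field; lra).
        rewrite <- Rmult_assoc, (Rmult_comm (s ^ 2)), Rmult_assoc.
        apply Rmult_le_compat_l; [apply Cmod_ge_0|]. apply Cpow_sub_bound; lra. }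
    replace (f w - f z - l * (w - z))%C with ((f w - f z) - (w - z) * l)%C by ring.
    eapply Rle_trans; [exact B|]. pose proof (Cmod_ge_0 (w - z)) as Hu.
    apply Rle_trans with (L * Cmod (w - z) * Cmod (w - z)).
    - replace (K * (Cmod (w - z) ^ 2 / s ^ 2)) with (K / s ^ 2 * Cmod (w - z) * Cmod (w - z)) by (field; lra).
      apply Rmult_le_compat_r; [easy|]. apply Rmult_le_compat_r; [easy|].
      assert (K / s ^ 2 <= Rabs K / s ^ 2).
      { apply Rmult_le_compat_r; [apply Rlt_le, Rinv_0_lt_compat, pow_lt; lra|apply Rle_abs]. }
      unfold L; lra.
    - apply Rmult_le_compat_r; [easy|].
      replace eps with (L * (eps / L)) by (field; lra). apply Rmult_le_compat_l; lra. }
  rewrite (is_C_derive_unique f z l HD). split; [exact HD|].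
  now apply is_Cpseries_iff.
Qed.

(** * Compactness in the plane *)

Lemma adherent_point (u : nat -> C) (B : R) :
  (forall n, Cmod (u n) <= B) ->
  exists tau, forall eps N, 0 < eps -> exists n, (N <= n)%nat /\ Cmod (u n - tau) < eps.
Proof.
  intros HB.
  destruct (Bolzano_Weierstrass (fun n => Re (u n)) (fun c => - B <= c <= B)) as [x Hx].
  { apply compact_P3. }
  { intros n. apply Rabs_le_between. eapply Rle_trans; [apply re_le_Cmod|apply HB]. }
  assert (Hphi : forall k : nat, exists n : nat, (k <= n)%nat /\ Rabs (Re (u n) - x) < / (INR k + 1)).
  { intros k. pose proof (pos_INR k).
    assert (Hk : 0 < / (INR k + 1)) by (apply Rinv_0_lt_compat; lra).
    destruct (Hx (disc x (mkposreal _ Hk)) k) as [p [Hp1 Hp2]].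
    - exists (mkposreal _ Hk). now intros y Hy.
    - now exists p. }
  destruct (functional_choice _ Hphi) as [phi Hp].
  destruct (Bolzano_Weierstrass (fun k => Im (u (phi k))) (fun c => - B <= c <= B)) as [y Hy].
  { apply compact_P3. }
  { intros n. apply Rabs_le_between. eapply Rle_trans; [apply Rabs_Im_le_Cmod|apply HB]. }
  exists (x, y). intros eps N He.
  assert (He2 : 0 < eps / 2) by lra.
  destruct (archimed_cor1 (eps / 2) He2) as [K [HK1 HK2]].
  destruct (Hy (disc y (mkposreal _ He2)) (max N K)) as [k [Hk1 Hk2]].
  { exists (mkposreal _ He2). now intros v Hv. }
  destruct (Hp k) as [Hp1 Hp2].
  exists (phi k). split; [lia|].
  assert (HKk : / (INR k + 1) < eps / 2).
  { apply Rle_lt_trans with (/ INR K); [|easy].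
    assert (INR K <= INR k) by (apply le_INR; lia).
    assert (0 < INR K) by (now apply lt_0_INR).
    apply Rinv_le_contravar; lra. }
  assert (E : (u (phi k) - (x, y))%C = (Re (u (phi k)) - x, Im (u (phi k)) - y)) by reflexivity.
  rewrite E. eapply Rle_lt_trans; [apply Cmod_le_Rabs|].
  unfold disc in Hk2. simpl in Hk2. lra.
Qed.

Definition closed_set (K : C -> Prop) : Prop :=
  forall tau, (forall eps, 0 < eps -> exists z, K z /\ Cmod (z - tau) < eps) -> K tau.

Lemma continuous_real_eps (u : C -> R) (z : C) :
  @continuous C_UniformSpace R_UniformSpace u z ->
  forall eps, 0 < eps -> exists d, 0 < d /\ forall w, Cmod (w - z) < d -> Rabs (u w - u z) < eps.
Proof.
  intros H eps He.
  assert (HC : Ccontinuous (fun w => RtoC (u w)) z).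
  { apply continuous_C_pair; [exact H|apply continuous_const]. }
  rewrite Ccontinuous_eps in HC. destruct (HC eps He) as [d [Hd D]].
  exists d. split; [easy|]. intros w Hw. specialize (D w Hw).
  now rewrite <- RtoC_minus, Cmod_R in D.
Qed.

Lemma continuous_Cmod (g : C -> C) (z : C) :
  Ccontinuous g z -> @continuous C_UniformSpace R_UniformSpace (fun w => Cmod (g w)) z.
Proof.
  intros Hg. apply (continuous_comp g (fun x => @norm C_AbsRing C_NormedModule x)); [exact Hg|].
  exact (@filterlim_norm C_AbsRing C_NormedModule (g z)).
Qed.

(** Composing with [atan] makes the supremum finite without a prior proof that
    [u] is bounded. *)
Lemma compact_max (K : C -> Prop) (B : R) (u : C -> R) (z0 : C) :
  K z0 -> closed_set K -> (forall z, K z -> Cmod z <= B) ->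
  (forall z, K z -> @continuous C_UniformSpace R_UniformSpace u z) ->
  exists z, K z /\ forall w, K w -> u w <= u z.
Proof.
  intros H0 HK HB Hu.
  destruct (completeness (fun y => exists z, K z /\ y = atan (u z))) as [S [HS1 HS2]].
  { exists (PI / 2). intros y [z [_ ->]]. apply Rlt_le, atan_bound. }
  { now exists (atan (u z0)), z0. }
  assert (Hseq : forall n : nat, exists z, K z /\ S - / (INR n + 1) < atan (u z)).
  { intros n. apply NNPP. intros Hn.
    assert (0 < / (INR n + 1)) by (apply Rinv_0_lt_compat; pose proof (pos_INR n); lra).
    assert (S <= S - / (INR n + 1)); [|lra].
    apply HS2. intros y [z [Hz ->]]. apply Rnot_lt_le. intros L. apply Hn. now exists z. }
  destruct (functional_choice _ Hseq) as [v Hv].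
  destruct (adherent_point v B) as [tau Ht].
  { intros n. apply HB, Hv. }
  assert (HKt : K tau).
  { apply HK. intros eps He. destruct (Ht eps 0%nat He) as [n [_ Hn]].
    exists (v n). split; [apply Hv|easy]. }
  exists tau. split; [easy|]. intros w Hw. apply Rnot_lt_le. intros L.
  apply atan_increasing in L.
  assert (HwS : atan (u w) <= S) by (apply HS1; now exists w).
  assert (Ha : @continuous C_UniformSpace R_UniformSpace (fun z => atan (u z)) tau).
  { apply (continuous_comp u atan); [now apply Hu|]. apply continuous_atan. }
  set (e := (S - atan (u tau)) / 2). assert (He : 0 < e) by (unfold e; lra).
  destruct (continuous_real_eps _ _ Ha e He) as [d [Hd D]].
  destruct (archimed_cor1 e He) as [N [HN1 HN2]].
  destruct (Ht d N Hd) as [n [Hn1 Hn2]].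
  specialize (D _ Hn2). apply Rabs_def2 in D.
  destruct (Hv n) as [_ Hvn].
  assert (/ (INR n + 1) < e).
  { apply Rle_lt_trans with (/ INR N); [|easy].
    assert (INR N <= INR n) by (apply le_INR; lia).
    assert (0 < INR N) by (now apply lt_0_INR).
    apply Rinv_le_contravar; lra. }
  unfold e in *. lra.
Qed.

Lemma closed_disc (z0 : C) (r : R) : closed_set (fun z => Cmod (z - z0) <= r).
Proof.
  intros tau H. apply Rnot_lt_le. intros L.
  destruct (H (Cmod (tau - z0) - r)) as [z [Hz1 Hz2]]; [lra|].
  pose proof (Cmod_triangle (tau - z) (z - z0)) as T.
  replace (tau - z + (z - z0))%C with (tau - z0)%C in T by ring.
  rewrite (Cmod_sub_sym tau z) in T. lra.
Qed.

Lemma closed_circle (z0 : C) (r : R) : closed_set (fun z => Cmod (z - z0) = r).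
Proof.
  intros tau H. apply Rle_antisym.
  - apply closed_disc. intros eps He. destruct (H eps He) as [z [Hz1 Hz2]]. exists z. split; lra.
  - apply Rnot_lt_le. intros L.
    destruct (H (r - Cmod (tau - z0))) as [z [Hz1 Hz2]]; [lra|].
    pose proof (Cmod_triangle (z - tau) (tau - z0)) as T.
    replace (z - tau + (tau - z0))%C with (z - z0)%C in T by ring. lra.
Qed.

Lemma Cmod_le_center (z z0 : C) : Cmod z <= Cmod (z - z0) + Cmod z0.
Proof.
  pose proof (Cmod_triangle (z - z0) z0) as T.
  now replace (z - z0 + z0)%C with z in T by ring.
Qed.

(** * Injective holomorphic functions *)

Section Univalent.

Variable f : C -> C.
Hypothesis Hf : holo unit_disk f.
Hypothesis Hinj : injective_on unit_disk f.

Lemma circle_gap (z0 : C) (r : R) : unit_disk z0 -> 0 < r < 1 - Cmod z0 ->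
  exists m, 0 < m /\ forall z, Cmod (z - z0) = r -> m <= Cmod (f z - f z0).
Proof.
  intros Hz0 Hr.
  assert (Hin : forall z, Cmod (z - z0) = r -> unit_disk z).
  { intros z Hz. unfold unit_disk. pose proof (Cmod_le_center z z0). lra. }
  destruct (compact_max (fun z => Cmod (z - z0) = r) 1 (fun z => - Cmod (f z - f z0)) (z0 + RtoC r)%C)
    as [z [Hz1 Hz2]].
  - replace (z0 + r - z0)%C with (RtoC r) by ring. rewrite Cmod_R, Rabs_right; lra.
  - apply closed_circle.
  - intros z Hz. apply Rlt_le, Hin, Hz.
  - intros z Hz.
    apply (@continuous_opp C_UniformSpace R_AbsRing R_NormedModule (fun z => Cmod (f z - f z0))).
    apply continuous_Cmod. apply Ccontinuous_minus; [|apply continuous_const].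
    apply (holo_continuous unit_disk); auto.
  - exists (Cmod (f z - f z0)). split.
    + apply Cmod_gt_0, Cminus_eq_contra. intros E.
      apply Hinj in E; auto. subst z.
      replace (z0 - z0)%C with (RtoC 0) in Hz1 by ring. rewrite Cmod_0 in Hz1. lra.
    + intros w Hw. specialize (Hz2 w Hw). cbv beta in Hz2. lra.
Qed.

(** If [f'] vanished at [z0], then the reciprocal difference quotients
    [(z - w) / (f z - f w)] at base points [w] near [z0] would stay bounded on a
    fixed circle around [z0] but blow up at its centre, against the maximum
    principle. The base point needs [f' w <> 0] to be a removable singularity;
    such [w] exist near [z0], else [f] would be locally constant. *)
Lemma univalent_derive_neq_0 (z0 l : C) : unit_disk z0 -> is_Cderive f z0 l -> l <> 0.
Proof.
  intros Hz0 Hl ->.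
  pose proof Hf as [f1 Hf1].
  set (rho := (1 - Cmod z0) / 2).
  assert (Hrho : 0 < rho) by (unfold rho, unit_disk in *; lra).
  destruct (circle_gap z0 rho Hz0) as [m [Hm Hgap]].
  { unfold rho in *. lra. }
  pose proof (holo_continuous _ _ _ Hf Hz0) as Hcont.
  rewrite Ccontinuous_eps in Hcont. destruct (Hcont (m / 2)) as [d2 [Hd2 D2]]; [lra|].
  rewrite is_Cderive_eps in Hl. destruct (Hl (m / (8 * rho))) as [d1 [Hd1 D1]].
  { apply Rdiv_lt_0_compat; lra. }
  set (d := Rmin rho (Rmin d1 d2)).
  assert (Hd : 0 < d) by (repeat apply Rmin_pos; easy).
  assert (Hdr : d <= rho) by apply Rmin_l.
  assert (Hdd1 : d <= d1) by (eapply Rle_trans; [apply Rmin_r|apply Rmin_l]).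
  assert (Hdd2 : d <= d2) by (eapply Rle_trans; [apply Rmin_r|apply Rmin_r]).
  assert (Hin : forall z, Cmod (z - z0) < 2 * rho -> unit_disk z).
  { intros z Hz. unfold unit_disk. pose proof (Cmod_le_center z z0). unfold rho in *. lra. }
  assert (Hw : exists w, Cmod (w - z0) < d /\ f1 w <> 0).
  { apply NNPP. intros Hno.
    assert (Hz : forall w, Cmod (w - z0) < d -> f1 w = 0).
    { intros w Hw. apply NNPP. intros Hne. apply Hno. now exists w. }
    set (x0 := Re z0). set (y0 := Im z0).
    assert (Hseg : forall t, 0 <= t <= d / 2 ->
      is_Cderive f ((x0 + t)%R, y0) (RtoC 0)).
    { intros t Ht.
      assert (E : Cmod (((x0 + t)%R, y0) - z0) < d).
      { replace (((x0 + t)%R, y0) - z0)%C with (RtoC t).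
        - rewrite Cmod_R, Rabs_right; lra.
        - unfold x0, y0, RtoC. destruct z0. unfold Cminus, Cplus, Copp; simpl. f_equal; ring. }
      destruct (Hf1 ((x0 + t)%R, y0)) as [D _]; [apply Hin; lra|]. now rewrite Hz in D. }
    assert (EC : f ((x0 + d / 2)%R, y0) = f z0).
    { replace z0 with (((x0 + 0)%R, y0) : C) by (unfold x0, y0; destruct z0; simpl; f_equal; ring).
      assert (G1 : forall t, is_derive (fun s : R => x0 + s) t 1) by (intros t; auto_derive; auto).
      assert (G2 : forall t, is_derive (fun s : R => y0) t 0) by (intros t; auto_derive; auto).
      apply injective_projections.
      - symmetry. apply (eq_is_derive (fun t => Re (f ((x0 + t)%R, y0))) 0 (d / 2)); [|lra].
        intros t Ht.
        pose proof (is_derive_Re_curve f (fun s => x0 + s) (fun _ => y0) t 1 0 0 (Hseg t Ht) (G1 t) (G2 t)) as D.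
        rewrite Cmult_0_l in D. exact D.
      - symmetry. apply (eq_is_derive (fun t => Im (f ((x0 + t)%R, y0))) 0 (d / 2)); [|lra].
        intros t Ht.
        pose proof (is_derive_Im_curve f (fun s => x0 + s) (fun _ => y0) t 1 0 0 (Hseg t Ht) (G1 t) (G2 t)) as D.
        rewrite Cmult_0_l in D. exact D. }
    assert (E1 : (((x0 + d / 2)%R, y0) - z0)%C = RtoC (d / 2)).
    { unfold x0, y0, RtoC. destruct z0. unfold Cminus, Cplus, Copp; simpl. f_equal; ring. }
    assert (E2 : (((x0 + d / 2)%R, y0) : C) = z0).
    { apply Hinj; auto. apply Hin. rewrite E1, Cmod_R, Rabs_right; lra. }
    rewrite E2 in E1. replace (z0 - z0)%C with (RtoC 0) in E1 by ring.
    apply RtoC_inj in E1. lra. }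
  destruct Hw as [w [Hw Hf1w]].
  assert (Hwd : unit_disk w) by (apply Hin; lra).
  assert (Hwz : w <> z0).
  { intros ->. apply Hf1w. destruct (Hf1 z0 Hz0) as [D _].
    apply (is_Cderive_unique f z0); [exact D|]. now apply is_Cderive_eps. }
  destruct (Hf1 w Hwd) as [Dw _].
  set (k := fun z => (/ dquot f w (f1 w) z)%C).
  assert (Hq0 : forall z, unit_disk z -> dquot f w (f1 w) z <> 0).
  { intros z Hz. destruct (Ceq_dec z w) as [->|Hne]; [now rewrite dquot_at|].
    rewrite dquot_off by easy. apply Cmult_neq_0.
    - apply Cminus_eq_contra. intros E. apply Hne. now apply Hinj.
    - apply Cmod_gt_0. rewrite Cmod_inv by now apply Cminus_eq_contra.
      apply Rinv_0_lt_compat. now apply Cmod_gt_0, Cminus_eq_contra. }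
  assert (Hshift : forall U, holo U (fun s => z0 + s)%C).
  { intros U. apply (holo_plus U (fun _ => z0) (fun s => s)); [apply holo_const|apply holo_id]. }
  assert (Hs : forall s, Cmod s < 2 * rho -> unit_disk (z0 + s)%C).
  { intros s H. apply Hin. now replace (z0 + s - z0)%C with s by ring. }
  assert (HC : Cmod (k (z0 + 0)%C) <= 4 * rho / m).
  { apply (center_le_circle (fun s => k (z0 + s)%C) (2 * rho) (w - z0)%C rho).
    - apply (holo_comp _ (fun z => unit_disk z /\ z <> w) k (fun s => z0 + s)%C); [| |apply Hshift].
      + intros s [H1 H2]. split; [auto|]. intros E. apply H2. rewrite <- E. ring.
      + apply (holo_comp _ (fun z => z <> 0) Cinv (dquot f w (f1 w))).
        * intros z [Hz _]. auto.
        * apply holo_Cinv.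
        * now apply dquot_holo.
    - intros s H. apply (Ccontinuous_comp (fun s => z0 + s)%C k).
      + apply (holo_continuous (fun _ => True)); auto.
      + apply (Ccontinuous_comp (dquot f w (f1 w)) Cinv).
        * apply (dquot_continuous unit_disk); auto.
        * apply Ccontinuous_Cinv. auto.
    - lra.
    - intros t. unfold k. set (z := (z0 + circ rho t)%C).
      assert (Ez : Cmod (z - z0) = rho).
      { unfold z. replace (z0 + circ rho t - z0)%C with (circ rho t) by ring.
        rewrite Cmod_circ, Rabs_right; lra. }
      assert (Hzw : z <> w) by (intros E; subst w; lra).
      pose proof (Hgap z Ez) as Gz.
      pose proof (D2 w (Rlt_le_trans _ _ _ Hw Hdd2)) as Gw.
      pose proof (Cmod_triangle (f z - f w) (f w - f z0)) as T1.
      replace (f z - f w + (f w - f z0))%C with (f z - f z0)%C in T1 by ring.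
      pose proof (Cmod_triangle (z - z0) (z0 - w)) as T2.
      replace (z - z0 + (z0 - w))%C with (z - w)%C in T2 by ring.
      rewrite (Cmod_sub_sym z0 w) in T2.
      assert (Hfz : Cmod (f z - f w) > 0) by lra.
      rewrite dquot_off by easy.
      rewrite Cmod_inv, Cmod_div by (try (apply Cminus_eq_contra; easy);
        rewrite <- (dquot_off f w (f1 w)) by easy; apply Hq0; apply Hin; lra).
      rewrite Rinv_div.
      apply Rle_trans with (2 * rho / (m / 2)).
      + apply Rmult_le_compat; [apply Cmod_ge_0| |lra|].
        * apply Rlt_le, Rinv_0_lt_compat; lra.
        * apply Rinv_le_contravar; lra.
      + right. field. lra. }
  replace (z0 + 0)%C with z0 in HC by ring. unfold k in HC.
  specialize (D1 w (Rlt_le_trans _ _ _ Hw Hdd1)).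
  replace (f w - f z0 - 0 * (w - z0))%C with (f w - f z0)%C in D1 by ring.
  assert (Hne : (w - z0)%C <> 0) by now apply Cminus_eq_contra.
  assert (Hne' : (z0 - w)%C <> 0) by (apply Cminus_eq_contra; auto).
  assert (0 < Cmod (w - z0)) by now apply Cmod_gt_0.
  assert (Hfw : (f w - f z0)%C <> 0).
  { apply Cminus_eq_contra. intros E. apply Hwz. now apply Hinj. }
  assert (0 < Cmod (f w - f z0)) by now apply Cmod_gt_0.
  rewrite dquot_off in HC by auto.
  rewrite Cmod_inv, Cmod_div in HC by (try easy; rewrite <- (dquot_off f w (f1 w)) by auto; auto).
  rewrite Rinv_div, (Cmod_sub_sym z0 w), (Cmod_sub_sym (f z0)) in HC.
  assert (Cmod (w - z0) <= 4 * rho / m * Cmod (f w - f z0)).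
  { apply Rmult_le_reg_r with (/ Cmod (f w - f z0)); [now apply Rinv_0_lt_compat|].
    rewrite Rmult_assoc, Rinv_r, Rmult_1_r by lra. exact HC. }
  assert (4 * rho / m * Cmod (f w - f z0) <= 4 * rho / m * (m / (8 * rho) * Cmod (w - z0))).
  { apply Rmult_le_compat_l; [|easy]. apply Rlt_le, Rdiv_lt_0_compat; lra. }
  replace (4 * rho / m * (m / (8 * rho) * Cmod (w - z0))) with (Cmod (w - z0) / 2) in H2 by (field; lra).
  lra.
Qed.

(** Open mapping: a minimum point of [|f - w|] on a small closed disk is
    interior, and moving it along [- (f - w) / f'] would decrease [|f - w|]. *)
Lemma univalent_locally_onto (z0 : C) (r : R) : unit_disk z0 -> 0 < r < 1 - Cmod z0 ->
  exists d, 0 < d /\ forall w, Cmod (w - f z0) < d -> exists z, Cmod (z - z0) < r /\ f z = w.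
Proof.
  intros Hz0 Hr. destruct (circle_gap z0 r Hz0 Hr) as [m [Hm Hgap]].
  exists (m / 2). split; [lra|]. intros w Hw.
  assert (Hin : forall z, Cmod (z - z0) <= r -> unit_disk z).
  { intros z Hz. unfold unit_disk. pose proof (Cmod_le_center z z0). lra. }
  assert (E0 : Cmod (z0 - z0) = 0) by (replace (z0 - z0)%C with (RtoC 0) by ring; apply Cmod_0).
  destruct (compact_max (fun z => Cmod (z - z0) <= r) 1 (fun z => - Cmod (f z - w)) z0)
    as [z [Hz1 Hz2]].
  - lra.
  - apply closed_disc.
  - intros z Hz. apply Rlt_le, Hin, Hz.
  - intros z Hz.
    apply (@continuous_opp C_UniformSpace R_AbsRing R_NormedModule (fun z => Cmod (f z - w))).
    apply continuous_Cmod. apply Ccontinuous_minus; [|apply continuous_const].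
    apply (holo_continuous unit_disk); auto.
  - cbv beta in Hz2.
    assert (Hint : Cmod (z - z0) < r).
    { destruct Hz1 as [Hz1|Hz1]; [easy|]. exfalso.
      specialize (Hgap z Hz1). specialize (Hz2 z0). rewrite E0 in Hz2.
      pose proof (Cmod_triangle (f z - w) (w - f z0)) as T.
      replace (f z - w + (w - f z0))%C with (f z - f z0)%C in T by ring.
      rewrite (Cmod_sub_sym (f z0) w) in Hz2. lra. }
    exists z. split; [easy|]. apply NNPP. intros Hne.
    pose proof Hf as [f1 Hf1]. destruct (Hf1 z (Hin z Hz1)) as [D _].
    pose proof (univalent_derive_neq_0 z _ (Hin z Hz1) D) as Hl.
    set (l := f1 z) in *. set (q := (f z - w)%C) in *.
    assert (Hq : q <> 0) by now apply Cminus_eq_contra.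
    assert (Hq0 : 0 < Cmod q) by now apply Cmod_gt_0.
    set (v := (- q / l)%C).
    assert (Hv0 : 0 < Cmod v).
    { unfold v. rewrite Cmod_div, Cmod_opp by easy. apply Rdiv_lt_0_compat; [easy|now apply Cmod_gt_0]. }
    rewrite is_Cderive_eps in D. destruct (D (Cmod q / (2 * Cmod v))) as [d [Hd D']].
    { apply Rdiv_lt_0_compat; lra. }
    set (t := Rmin (1 / 2) (Rmin (d / (2 * Cmod v)) ((r - Cmod (z - z0)) / (2 * Cmod v)))).
    assert (Ht : 0 < t) by (repeat apply Rmin_pos; try apply Rdiv_lt_0_compat; lra).
    assert (Ht1 : t <= 1 / 2) by apply Rmin_l.
    assert (Ht2 : t * Cmod v <= d / 2).
    { replace (d / 2) with (d / (2 * Cmod v) * Cmod v) by (field; lra).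
      apply Rmult_le_compat_r; [lra|]. eapply Rle_trans; [apply Rmin_r|apply Rmin_l]. }
    assert (Ht3 : t * Cmod v <= (r - Cmod (z - z0)) / 2).
    { replace ((r - Cmod (z - z0)) / 2) with ((r - Cmod (z - z0)) / (2 * Cmod v) * Cmod v) by (field; lra).
      apply Rmult_le_compat_r; [lra|]. eapply Rle_trans; [apply Rmin_r|apply Rmin_r]. }
    set (y := (z + t * v)%C).
    assert (Ey : Cmod (y - z) = t * Cmod v).
    { unfold y. replace (z + t * v - z)%C with (t * v)%C by ring.
      rewrite Cmod_mult, Cmod_R, Rabs_right; lra. }
    assert (Hy : Cmod (y - z0) <= r).
    { pose proof (Cmod_triangle (y - z) (z - z0)) as T.
      replace (y - z + (z - z0))%C with (y - z0)%C in T by ring. lra. }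
    specialize (Hz2 y Hy). specialize (D' y). rewrite Ey in D'.
    assert (DD : Cmod (f y - f z - l * (y - z)) <= Cmod q / (2 * Cmod v) * (t * Cmod v)) by (apply D'; lra).
    replace (Cmod q / (2 * Cmod v) * (t * Cmod v)) with (t / 2 * Cmod q) in DD by (field; lra).
    assert (Efy : (f y - w)%C = ((f y - f z - l * (y - z)) + (1 - t)%R * q)%C).
    { unfold y, v, q. rewrite RtoC_minus. field. easy. }
    pose proof (Cmod_triangle (f y - f z - l * (y - z)) ((1 - t)%R * q)) as T.
    rewrite <- Efy, Cmod_mult, Cmod_R, Rabs_right in T by lra.
    unfold q in *. nra.
Qed.

Lemma univalent_inverse : exists g : C -> C,
  (forall w, image f unit_disk w -> unit_disk (g w) /\ f (g w) = w) /\
  (forall z, unit_disk z -> g (f z) = z) /\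
  (forall z l, unit_disk z -> is_Cderive f z l -> is_Cderive g (f z) (/ l)%C) /\
  holo (image f unit_disk) g.
Proof.
  assert (Hg : forall w, exists z, image f unit_disk w -> unit_disk z /\ f z = w).
  { intros w. destruct (classic (image f unit_disk w)) as [[z [Hz E]]|Hno].
    - now exists z.
    - exists 0. now intros. }
  destruct (functional_choice _ Hg) as [g Hg1]. exists g.
  assert (Hg1' : forall w, image f unit_disk w -> unit_disk (g w) /\ f (g w) = w).
  { intros w Hw. split; apply Hg1, Hw. }
  assert (Hgf : forall z, unit_disk z -> g (f z) = z).
  { intros z Hz. destruct (Hg1 (f z)) as [H1 H2]; [now exists z|]. now apply Hinj. }
  assert (Hloc : forall z r, unit_disk z -> 0 < r -> exists d, 0 < d /\
    forall w, Cmod (w - f z) < d -> f (g w) = w /\ Cmod (g w - z) < r).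
  { intros z r Hz Hr. unfold unit_disk in Hz.
    destruct (univalent_locally_onto z (Rmin r ((1 - Cmod z) / 2)) Hz) as [d [Hd D]].
    - split; [apply Rmin_pos; lra|]. eapply Rle_lt_trans; [apply Rmin_r|lra].
    - exists d. split; [easy|]. intros w Hw. destruct (D w Hw) as [y [Hy <-]].
      assert (Hy1 : Cmod (y - z) < r) by (eapply Rlt_le_trans; [exact Hy|apply Rmin_l]).
      assert (Hy2 : Cmod (y - z) < (1 - Cmod z) / 2) by (eapply Rlt_le_trans; [exact Hy|apply Rmin_r]).
      assert (Hyd : unit_disk y).
      { unfold unit_disk. pose proof (Cmod_le_center y z). lra. }
      now rewrite Hgf. }
  assert (Hcont : forall z, unit_disk z -> Ccontinuous g (f z)).
  { intros z Hz. apply Ccontinuous_eps. intros eps He.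
    destruct (Hloc z eps Hz He) as [d [Hd D]]. exists d. split; [easy|].
    intros w Hw. rewrite Hgf by easy. now apply D. }
  assert (Hder : forall z l, unit_disk z -> is_Cderive f z l -> is_Cderive g (f z) (/ l)%C).
  { intros z l Hz Hl. destruct (Hloc z 1 Hz Rlt_0_1) as [d [Hd D]].
    apply (is_Cderive_inverse f g (f z) l d); auto.
    - intros w Hw. now apply D.
    - now rewrite Hgf.
    - now apply (univalent_derive_neq_0 z). }
  split; [exact Hg1'|]. split; [exact Hgf|]. split; [exact Hder|].
  pose proof Hf as [f1 Hf1]. exists (fun w => / f1 (g w))%C. intros w [z [Hz ->]].
  destruct (Hf1 z Hz) as [D1 D2]. rewrite Hgf by easy. split; [now apply Hder|].
  apply (Ccontinuous_comp (fun w => f1 (g w)) Cinv).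
  - apply (Ccontinuous_comp g f1); [now apply Hcont|]. now rewrite Hgf.
  - apply Ccontinuous_Cinv. rewrite Hgf by easy. now apply (univalent_derive_neq_0 z).
Qed.

(** This is the Schwarz lemma for the inverse function on the disk of radius [d]
    about [f z]: the conformal radius [(1 - |z|^2) |f' z|] of the range dominates
    the distance from [f z] to the boundary. *)
Lemma univalent_distance_le_radius (z l : C) (d : R) : unit_disk z -> is_Cderive f z l -> 0 < d ->
  (forall w, Cmod (w - f z) < d -> image f unit_disk w) -> d <= (1 - Cmod z ^ 2) * Cmod l.
Proof.
  intros Hz Hl Hd HB.
  destruct univalent_inverse as [g [Hg1 [Hg2 [Hg3 Hg4]]]].
  pose proof (univalent_derive_neq_0 z l Hz Hl) as Hl0.
  assert (H1 : 0 < 1 - Cmod z ^ 2) by (apply Cmod_lt_1_sq in Hz; lra).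
  set (E := fun s => (f z + d * s)%C).
  assert (HE : forall s, unit_disk s -> image f unit_disk (E s)).
  { intros s Hs. apply HB. unfold E. replace (f z + d * s - f z)%C with (d * s)%C by ring.
    rewrite Cmod_mult, Cmod_R, Rabs_right by lra. unfold unit_disk in Hs.
    pose proof (Cmod_ge_0 s). nra. }
  assert (E0 : E 0 = f z) by (unfold E; ring).
  pose proof (schwarz_derive (fun s => mobius (- z) (g (E s)))
    ((0 + (0 * 0 + d * 1)) * / l * ((1 - Cmod (- z) ^ 2)%R / ((1 + Cconj (- z) * z) * (1 + Cconj (- z) * z))))%C) as S.
  assert (Hden : (1 + Cconj (- z) * z)%C = RtoC (1 - Cmod z ^ 2)).
  { rewrite Copp_conj, RtoC_minus, Cmod2_conj. ring. }
  assert (HR : RtoC (1 - Cmod z ^ 2) <> 0) by (apply RtoC_neq0; lra).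
  rewrite Hden, Cmod_opp in S.
  replace ((0 + (0 * 0 + d * 1)) * / l * ((1 - Cmod z ^ 2)%R / ((1 - Cmod z ^ 2)%R * (1 - Cmod z ^ 2)%R)))%C
    with (d / (l * (1 - Cmod z ^ 2)%R))%C in S by (field; auto).
  rewrite Cmod_div, Cmod_mult, !Cmod_R, !Rabs_right in S by (try apply Cmult_neq_0; auto; lra).
  assert (HS : d / (Cmod l * (1 - Cmod z ^ 2)) <= 1).
  { apply S; clear S.
    - apply (holo_comp unit_disk unit_disk (mobius (- z)) (fun s => g (E s))).
      + intros s Hs. now apply Hg1, HE.
      + apply mobius_holo. now apply unit_disk_opp.
      + apply (holo_comp unit_disk (image f unit_disk) g E); auto.
        apply (holo_plus _ (fun _ => f z) (fun s => d * s)%C); [apply holo_const|].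
        apply holo_scal, holo_id.
    - intros s Hs. apply mobius_disk; [now apply unit_disk_opp|]. now apply Hg1, HE.
    - rewrite E0, Hg2 by easy. unfold mobius. replace (z + - z)%C with (RtoC 0) by ring.
      unfold Cdiv. ring.
    - replace (d / (l * (1 - Cmod z ^ 2)%R))%C with
        ((0 + (0 * 0 + d * 1)) * / l * ((1 - Cmod (- z) ^ 2)%R / ((1 + Cconj (- z) * z) * (1 + Cconj (- z) * z))))%C
        by (rewrite Hden, Cmod_opp; field; auto).
      apply (is_Cderive_comp (mobius (- z)) (fun s => g (E s))).
      + rewrite E0, Hg2 by easy. apply mobius_derive. now rewrite Hden.
      + apply (is_Cderive_comp g E).
        * rewrite E0. now apply Hg3.
        * apply (is_Cderive_plus (fun _ => f z) (fun s => d * s)%C); [apply is_Cderive_const|].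
          apply (is_Cderive_mult (fun _ => RtoC d) (fun s => s)); [apply is_Cderive_const|apply is_Cderive_id]. }
  assert (Hlp : 0 < Cmod l) by now apply Cmod_gt_0.
  apply Rmult_le_reg_r with (/ (Cmod l * (1 - Cmod z ^ 2))).
  - apply Rinv_0_lt_compat. now apply Rmult_lt_0_compat.
  - replace ((1 - Cmod z ^ 2) * Cmod l * / (Cmod l * (1 - Cmod z ^ 2))) with 1 by (field; lra). exact HS.
Qed.

End Univalent.

(** * Exponential, logarithm and polar form *)

Lemma expi_plus (a b : R) : expi (a + b) = (expi a * expi b)%C.
Proof.
  unfold expi, Cmult; simpl. rewrite cos_plus, sin_plus. f_equal; ring.
Qed.

Lemma expi_0 : expi 0 = 1.
Proof. unfold expi. now rewrite cos_0, sin_0. Qed.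

Lemma expi_opp_mult (a : R) : (expi (- a) * expi a)%C = 1.
Proof. rewrite <- expi_plus. replace (- a + a) with 0 by ring. apply expi_0. Qed.

Definition Cexp (z : C) : C := (exp (Re z) * expi (Im z))%C.

Definition CLog (w : C) : C := (ln (Cmod w), atan (Im w / Re w)).

Lemma Cexp_plus (a b : C) : Cexp (a + b) = (Cexp a * Cexp b)%C.
Proof. unfold Cexp. rewrite re_plus, im_plus, exp_plus, expi_plus, RtoC_mult. ring. Qed.

Lemma Cexp_0 : Cexp 0 = 1.
Proof. unfold Cexp. simpl. rewrite exp_0, expi_0. ring. Qed.

Lemma Cexp_derive_0 : is_Cderive Cexp (RtoC 0) (RtoC 1).
Proof.
  apply is_Cderive_eps. intros eps He.
  set (e := Rmin 1 (eps / 20)).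
  assert (He0 : 0 < e) by (apply Rmin_pos; lra).
  assert (He1 : e <= 1) by apply Rmin_l. assert (He2 : e <= eps / 20) by apply Rmin_r.
  assert (D1 : is_derive exp 0 1) by (pose proof (is_derive_exp 0) as D; now rewrite exp_0 in D).
  assert (D2 : is_derive cos 0 0).
  { pose proof (is_derive_cos 0) as D. now rewrite sin_0, Ropp_0 in D. }
  assert (D3 : is_derive sin 0 1) by (pose proof (is_derive_sin 0) as D; now rewrite cos_0 in D).
  rewrite is_derive_eps in D1, D2, D3.
  destruct (D1 e He0) as [d1 [Hd1 B1]]. destruct (D2 e He0) as [d2 [Hd2 B2]].
  destruct (D3 e He0) as [d3 [Hd3 B3]].
  exists (Rmin e (Rmin d1 (Rmin d2 d3))). split; [repeat apply Rmin_pos; lra|].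
  intros w Hw. replace (w - 0)%C with w in * by ring.
  destruct w as [x y]. set (m := Cmod (x, y)) in *.
  assert (Hx : Rabs x <= m) by apply (re_le_Cmod (x, y)).
  assert (Hy : Rabs y <= m) by apply (Rabs_Im_le_Cmod (x, y)).
  assert (Hme : m < e) by (eapply Rlt_le_trans; [exact Hw|apply Rmin_l]).
  assert (Hm1 : m < d1).
  { eapply Rlt_le_trans; [exact Hw|]. eapply Rle_trans; [apply Rmin_r|apply Rmin_l]. }
  assert (Hm2 : m < d2).
  { eapply Rlt_le_trans; [exact Hw|]. do 2 (eapply Rle_trans; [apply Rmin_r|]). apply Rmin_l. }
  assert (Hm3 : m < d3).
  { eapply Rlt_le_trans; [exact Hw|]. do 2 (eapply Rle_trans; [apply Rmin_r|]). apply Rmin_r. }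
  specialize (B1 x). specialize (B2 y). specialize (B3 y).
  rewrite Rminus_0_r in B1, B2, B3. rewrite exp_0 in B1. rewrite cos_0 in B2. rewrite sin_0 in B3.
  specialize (B1 ltac:(lra)). specialize (B2 ltac:(lra)). specialize (B3 ltac:(lra)).
  assert (Hm : 0 <= m) by apply Cmod_ge_0.
  set (a := exp x - 1 - 1 * x) in *. set (b := cos y - 1 - 0 * y) in *.
  set (c := sin y - 0 - 1 * y) in *.
  assert (Ba : Rabs a <= e * m).
  { eapply Rle_trans; [exact B1|]. apply Rmult_le_compat_l; lra. }
  assert (Bb : Rabs b <= e * m).
  { eapply Rle_trans; [exact B2|]. apply Rmult_le_compat_l; lra. }
  assert (Bc : Rabs c <= e * m).
  { eapply Rle_trans; [exact B3|]. apply Rmult_le_compat_l; lra. }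
  rewrite Cexp_0.
  replace (Cexp (x, y) - 1 - 1 * (x, y))%C
    with (RtoC a + (b, c) + RtoC (x + a) * (b, (y + c)%R))%C.
  2:{ unfold Cexp, expi, Re, Im, a, b, c, RtoC, Cminus, Cplus, Copp, Cmult; simpl. f_equal; ring. }
  assert (T1 : Cmod (RtoC (x + a) * (b, (y + c)%R)) <= 6 * e * m).
  { rewrite Cmod_mult, Cmod_R.
    assert (Rabs (x + a) <= 2 * e) by (pose proof (Rabs_triang x a); nra).
    assert (Cmod (b, (y + c)%R) <= 3 * m).
    { eapply Rle_trans; [apply Cmod_le_Rabs|]. pose proof (Rabs_triang y c). nra. }
    replace (6 * e * m) with (2 * e * (3 * m)) by ring.
    apply Rmult_le_compat; [apply Rabs_pos|apply Cmod_ge_0| |]; easy. }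
  assert (T2 : Cmod (b, c) <= 2 * e * m).
  { eapply Rle_trans; [apply Cmod_le_Rabs|]. lra. }
  eapply Rle_trans; [apply Cmod_triangle|].
  eapply Rle_trans; [apply Rplus_le_compat_r, Cmod_triangle|]. rewrite Cmod_R.
  nra.
Qed.

Lemma Cexp_derive (z : C) : is_Cderive Cexp z (Cexp z).
Proof.
  apply (is_derive_ext (fun w => Cexp z * Cexp (w - z))%C).
  { intros w. Ceq. rewrite <- Cexp_plus. f_equal. ring. }
  assert (D : is_Cderive (fun w => Cexp (w - z))%C z ((1 - 0) * 1)%C).
  { apply (is_Cderive_comp Cexp (fun w => w - z)%C).
    - replace (z - z)%C with (RtoC 0) by ring. apply Cexp_derive_0.
    - apply (is_Cderive_minus (fun w => w) (fun _ => z)); [apply is_Cderive_id|apply is_Cderive_const]. }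
  pose proof (is_Cderive_mult (fun _ => Cexp z) _ _ _ _ (is_Cderive_const (Cexp z) z) D) as H.
  cbv beta in H.
  replace (0 * Cexp (z - z) + Cexp z * ((1 - 0) * 1))%C with (Cexp z) in H by ring. exact H.
Qed.

Lemma Cmod_right_half (w : C) : 0 < Re w -> 0 < Cmod w.
Proof. intros H. pose proof (re_le_Cmod w). pose proof (Rle_abs (Re w)). lra. Qed.

Lemma Cexp_CLog (w : C) : 0 < Re w -> Cexp (CLog w) = w.
Proof.
  intros Hw. pose proof (Cmod_right_half w Hw) as Hm.
  destruct w as [x y]. unfold Re in Hw; simpl in Hw.
  unfold Cexp, CLog, expi, Re, Im; simpl fst; simpl snd.
  rewrite exp_ln, cos_atan, sin_atan by easy.
  assert (E : sqrt (1 + (y / x)²) = Cmod (x, y) / x).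
  { unfold Cmod; simpl fst; simpl snd.
    replace (1 + (y / x)²) with ((x ^ 2 + y ^ 2) / (x ^ 2)) by (unfold Rsqr; field; lra).
    rewrite sqrt_div by nra. rewrite sqrt_pow2 by lra. reflexivity. }
  rewrite E. unfold RtoC, Cmult; simpl. f_equal; field; lra.
Qed.

Lemma CLog_continuous (w : C) : 0 < Re w -> Ccontinuous CLog w.
Proof.
  intros Hw. apply continuous_C_pair.
  - apply (continuous_comp (fun w => Cmod w) ln).
    + apply (continuous_Cmod (fun w => w)). apply continuous_id.
    + apply continuity_pt_filterlim, derivable_continuous_pt.
      exists (/ Cmod w). apply derivable_pt_lim_ln. now apply Cmod_right_half.
  - apply (continuous_comp (fun w => Im w / Re w) atan); [|apply continuous_atan].
    apply (@continuous_mult C_UniformSpace R_AbsRing Im (fun w => / Re w)); [apply continuous_Im|].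
    apply (continuous_comp Re Rinv); [apply continuous_Re|].
    apply continuous_Rinv. lra.
Qed.

Lemma right_half_open (w : C) : 0 < Re w -> forall y, Cmod (y - w) < Re w -> 0 < Re y.
Proof.
  intros Hw y Hy. pose proof (re_le_Cmod (y - w)) as H. rewrite Re_minus in H.
  pose proof (Rle_abs (- (Re y - Re w))) as H2. rewrite Rabs_Ropp in H2. lra.
Qed.

(** Obtained from the exponential, of which [CLog] is a continuous right inverse. *)
Lemma CLog_derive (w : C) : 0 < Re w -> is_Cderive CLog w (/ w)%C.
Proof.
  intros Hw. apply (is_Cderive_inverse Cexp CLog w w (Re w)); auto.
  - intros y Hy. apply Cexp_CLog. now apply (right_half_open w).
  - now apply CLog_continuous.
  - pose proof (Cexp_derive (CLog w)) as D. rewrite (Cexp_CLog w Hw) in D; exact D.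
  - apply Cmod_gt_0. now apply Cmod_right_half.
Qed.

Lemma CLog_holo : holo (fun w => 0 < Re w) CLog.
Proof.
  exists Cinv. intros w Hw. split; [now apply CLog_derive|].
  apply Ccontinuous_Cinv, Cmod_gt_0. now apply Cmod_right_half.
Qed.

Lemma Re_CLog (w : C) : Re (CLog w) = ln (Cmod w).
Proof. reflexivity. Qed.

Lemma Im_CLog (w : C) : Im (CLog w) = atan (Im w / Re w).
Proof. reflexivity. Qed.

Lemma polar_form (w : C) : exists phi, - PI < phi <= PI /\ w = (Cmod w * expi phi)%C.
Proof.
  pose proof PI_RGT_0 as HPI.
  assert (Hhalf : forall z, 0 < Re z -> exists phi, - (PI / 2) < phi < PI / 2 /\ z = (Cmod z * expi phi)%C).
  { intros z Hz. exists (Im (CLog z)). split; [rewrite Im_CLog; pose proof (atan_bound (Im z / Re z)); lra|].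
    rewrite <- (Cexp_CLog z Hz) at 1. unfold Cexp. rewrite Re_CLog, exp_ln; [easy|].
    now apply Cmod_right_half. }
  destruct (Rlt_le_dec 0 (Re w)) as [H|H].
  { destruct (Hhalf w H) as [phi [B E]]. exists phi. split; [lra|easy]. }
  destruct (Rlt_le_dec 0 (Im w)) as [Hi|Hi].
  - destruct (Hhalf (expi (- (PI / 2)) * w)%C) as [phi [B E]].
    { unfold expi. rewrite cos_neg, sin_neg, cos_PI2, sin_PI2. destruct w; unfold Re, Im in *; simpl in *. lra. }
    rewrite Cmod_mult, Cmod_expi, Rmult_1_l in E.
    exists (phi + PI / 2). split; [lra|].
    rewrite expi_plus, Cmult_assoc, <- E.
    transitivity ((expi (- (PI / 2)) * expi (PI / 2)) * w)%C; [rewrite expi_opp_mult|]; ring.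
  - destruct (Rlt_le_dec (Im w) 0) as [Hi2|Hi2].
    + destruct (Hhalf (expi (PI / 2) * w)%C) as [phi [B E]].
      { unfold expi. rewrite cos_PI2, sin_PI2. destruct w; unfold Re, Im in *; simpl in *. lra. }
      rewrite Cmod_mult, Cmod_expi, Rmult_1_l in E.
      exists (phi + - (PI / 2)). split; [lra|].
      rewrite expi_plus, Cmult_assoc, <- E.
      transitivity ((expi (- (PI / 2)) * expi (PI / 2)) * w)%C; [rewrite expi_opp_mult|]; ring.
    + exists PI. split; [lra|]. destruct w as [x y]. unfold Re, Im in *; simpl in *.
      assert (y = 0) by lra. subst y.
      change ((x, 0) : C) with (RtoC x). rewrite Cmod_R, Rabs_left1 by lra.
      unfold expi, RtoC, Cmult. rewrite cos_PI, sin_PI; simpl. f_equal; ring.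
Qed.

Lemma Rabs_atan_le (x T : R) : Rabs x <= T -> Rabs (atan x) <= atan T.
Proof.
  intros H. apply Rabs_le_between in H.
  assert (mono : forall a b, a <= b -> atan a <= atan b).
  { intros a b [L|E]; [now apply Rlt_le, atan_increasing|now rewrite E; right]. }
  apply Rabs_le. rewrite <- atan_opp. split; now apply mono.
Qed.

Lemma Re_expi_mult (a rho b : R) : Re (expi a * (rho * expi b)) = rho * cos (a + b).
Proof.
  transitivity (Re (rho * (expi a * expi b))%C); [f_equal; ring|].
  now rewrite <- expi_plus, re_scal_l.
Qed.

(** * Growth of the derivative and the lower order *)

Lemma class_S_regular (f : C -> C) : class_S f ->
  (forall z, unit_disk z -> is_Cderive f z (C_derive f z)) /\
  (forall z, unit_disk z -> is_Cderive (C_derive f) z (C_derive (C_derive f) z)) /\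
  holo unit_disk f /\ holo unit_disk (C_derive f) /\
  (forall z, unit_disk z -> C_derive f z <> 0).
Proof.
  intros [_ [Hinj [a [_ [_ Ha]]]]].
  assert (H1 := pseries_derive a f Ha).
  assert (H2 := pseries_derive _ (C_derive f) (fun z Hz => proj2 (H1 z Hz))).
  assert (H3 := pseries_derive _ (C_derive (C_derive f)) (fun z Hz => proj2 (H2 z Hz))).
  assert (Hh : holo unit_disk f).
  { exists (C_derive f). intros z Hz. split; [now apply H1|].
    eapply is_Cderive_continuous. now apply H2. }
  split; [intros; now apply H1|]. split; [intros; now apply H2|]. split; [exact Hh|].
  split.
  - exists (C_derive (C_derive f)). intros z Hz. split; [now apply H2|].
    eapply is_Cderive_continuous. now apply H3.
  - intros z Hz. apply (univalent_derive_neq_0 f Hh Hinj z); [easy|]. now apply H1.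
Qed.

Lemma derive_local_max (phi : R -> R) (d delta : R) :
  0 < delta -> is_derive phi 0 d -> (forall t, Rabs t < delta -> phi t <= phi 0) -> d = 0.
Proof.
  intros Hd H Hmax. apply is_derive_Reals in H.
  assert (pr : derivable_pt phi 0) by now exists d.
  rewrite <- (deriv_maximum phi (- delta) delta 0 pr); try lra.
  - symmetry. apply derive_pt_eq_0. exact H.
  - intros x Hx1 Hx2. apply Hmax. apply Rabs_def1; lra.
Qed.

Section LowerOrder.

Variable f : C -> C.
Hypothesis Hf1 : forall z, unit_disk z -> is_Cderive f z (C_derive f z).
Hypothesis Hf2 : forall z, unit_disk z -> is_Cderive (C_derive f) z (C_derive (C_derive f) z).
Hypothesis Hf0 : forall z, unit_disk z -> C_derive f z <> 0.

(** The Wirtinger derivative of [ln |f'| + (1 + b) ln (1 - |z|^2)] at [z] is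
    [(A_f z - b conj z) / (1 - |z|^2)], so it vanishes at a local maximum. *)
Lemma A_op_at_critical (b : R) (z : C) (delta : R) : unit_disk z -> 0 < delta ->
  (forall w, Cmod (w - z) < delta -> unit_disk w /\
    ln (Cmod (C_derive f w)) + (1 + b) * ln (1 - Cmod w ^ 2) <=
    ln (Cmod (C_derive f z)) + (1 + b) * ln (1 - Cmod z ^ 2)) ->
  A_op f z = (b * Cconj z)%C.
Proof.
  intros Hz Hdel Hmax.
  set (f1 := C_derive f) in *. set (f2 := C_derive f1) in *.
  destruct z as [x y]. set (z := (x, y) : C) in *.
  assert (Hln : forall w, unit_disk w -> ln (Cmod (f1 w)) = ln (Re (f1 w) ^ 2 + Im (f1 w) ^ 2) / 2).
  { intros w Hw. pose proof (Hf0 w Hw) as H0. apply Cmod_gt_0 in H0.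
    rewrite <- Cmod2_alt. replace (Cmod (f1 w) ^ 2) with (Cmod (f1 w) * Cmod (f1 w)) by ring.
    rewrite ln_mult by easy. field. }
  assert (H1 : 0 < 1 - (x ^ 2 + y ^ 2)).
  { apply Cmod_lt_1_sq in Hz. unfold z in Hz. rewrite Cmod_sq in Hz. lra. }
  assert (H0 : 0 < Re (f1 z) ^ 2 + Im (f1 z) ^ 2).
  { rewrite <- Cmod2_alt. apply pow_lt, Cmod_gt_0, Hf0, Hz. }
  assert (Key : forall p q, Cmod (p, q) = 1 ->
    (Re (f1 z) * Re (f2 z * (p, q))%C + Im (f1 z) * Im (f2 z * (p, q))%C) / (Re (f1 z) ^ 2 + Im (f1 z) ^ 2)
      = (1 + b) * (2 * (x * p + y * q)) / (1 - (x ^ 2 + y ^ 2))).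
  { intros p q Hpq.
    set (g := fun t : R => (((x + t * p)%R, (y + t * q)%R) : C)).
    set (phi := fun t : R => ln (Re (f1 (g t)) ^ 2 + Im (f1 (g t)) ^ 2) / 2
                  + (1 + b) * ln (1 - ((x + t * p) ^ 2 + (y + t * q) ^ 2))).
    assert (G0 : g 0 = z) by (unfold g, z; f_equal; ring).
    assert (Gm : forall t, Cmod (g t - z) = Rabs t).
    { intros t. replace (g t - z)%C with (t * (p, q))%C.
      - rewrite Cmod_mult, Hpq, Cmod_R. ring.
      - unfold g, z, RtoC, Cminus, Cplus, Copp, Cmult; simpl. f_equal; ring. }
    assert (G1 : is_derive (fun t : R => x + t * p) 0 p) by (auto_derive; auto; ring).
    assert (G2 : is_derive (fun t : R => y + t * q) 0 q) by (auto_derive; auto; ring).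
    assert (DR : is_derive (fun t => Re (f1 (g t))) 0 (Re (f2 z * (p, q))%C)).
    { apply (is_derive_Re_curve f1 (fun t => x + t * p) (fun t => y + t * q)); auto.
      fold (g 0). rewrite G0. now apply Hf2. }
    assert (DI : is_derive (fun t => Im (f1 (g t))) 0 (Im (f2 z * (p, q))%C)).
    { apply (is_derive_Im_curve f1 (fun t => x + t * p) (fun t => y + t * q)); auto.
      fold (g 0). rewrite G0. now apply Hf2. }
    set (u := fun t : R => Re (f1 (g t))) in *. set (v := fun t : R => Im (f1 (g t))) in *.
    set (ul := Re (f2 z * (p, q))%C) in *. set (vl := Im (f2 z * (p, q))%C) in *.
    assert (D : is_derive phi 0
      ((Re (f1 z) * ul + Im (f1 z) * vl) / (Re (f1 z) ^ 2 + Im (f1 z) ^ 2)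
       - (1 + b) * (2 * (x * p + y * q)) / (1 - (x ^ 2 + y ^ 2)))).
    { assert (Eu : u 0 = Re (f1 z)) by (unfold u; now rewrite G0).
      assert (Ev : v 0 = Im (f1 z)) by (unfold v; now rewrite G0).
      change (is_derive (fun t => ln (u t ^ 2 + v t ^ 2) / 2
                  + (1 + b) * ln (1 - ((x + t * p) ^ 2 + (y + t * q) ^ 2))) 0
        ((Re (f1 z) * ul + Im (f1 z) * vl) / (Re (f1 z) ^ 2 + Im (f1 z) ^ 2)
         - (1 + b) * (2 * (x * p + y * q)) / (1 - (x ^ 2 + y ^ 2)))).
      rewrite <- Eu, <- Ev in *. auto_derive.
      - split; [now exists ul|]. split; [now exists vl|]. split; [nra|]. split; [nra|easy].
      - assert (E1 : Derive (fun t => u t) 0 = ul) by now apply is_derive_unique.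
        assert (E2 : Derive (fun t => v t) 0 = vl) by now apply is_derive_unique.
        rewrite E1, E2. field. nra. }
    apply (derive_local_max phi _ delta) in D; [lra|easy|].
    intros t Ht. rewrite <- Gm in Ht.
    destruct (Hmax _ Ht) as [Hgd M].
    rewrite (Hln _ Hgd), (Hln _ Hz) in M. unfold g at 3, z at 3 in M. rewrite !Cmod_sq in M.
    unfold phi. rewrite G0. replace (x + 0 * p) with x by ring. replace (y + 0 * q) with y by ring.
    exact M. }
  pose proof (Key 1 0) as K1. pose proof (Key 0 1) as K2.
  assert (C10 : Cmod (1, 0) = 1) by apply Cmod_1.
  assert (C01 : Cmod (0, 1) = 1) by apply Cmod_Ci.
  specialize (K1 C10). specialize (K2 C01).
  assert (EQ : (f2 z / f1 z)%C = ((2 * (1 + b) / (1 - (x ^ 2 + y ^ 2)))%R * Cconj z)%C).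
  { assert (Hfz : f1 z <> 0) by now apply Hf0.
    assert (E : (f2 z / f1 z)%C = (/ (Re (f1 z) ^ 2 + Im (f1 z) ^ 2)%R * (f2 z * Cconj (f1 z)))%C).
    { rewrite <- Cmod2_alt, Cmod2_conj. field. split; [|easy].
      intros E. apply (f_equal Cmod) in E. rewrite Cmod_conj, Cmod_0 in E.
      apply Cmod_gt_0 in Hfz. lra. }
    rewrite E, <- RtoC_inv by lra.
    destruct (f1 z) as [a1 a2]. destruct (f2 z) as [c1 c2]. unfold z.
    unfold Re, Im, Cconj, Cmult, RtoC in *; simpl fst in *; simpl snd in *.
    f_equal.
    - transitivity ((a1 * (c1 * 1 - c2 * 0) + a2 * (c1 * 0 + c2 * 1)) / (a1 ^ 2 + a2 ^ 2));
        [field; lra|]. rewrite K1. field. lra.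
    - transitivity (- ((a1 * (c1 * 0 - c2 * 1) + a2 * (c1 * 1 + c2 * 0)) / (a1 ^ 2 + a2 ^ 2)));
        [field; lra|]. rewrite K2. field. lra. }
  unfold A_op. fold f1 f2. rewrite EQ.
  replace (Cmod z ^ 2) with (x ^ 2 + y ^ 2) by (unfold z; now rewrite Cmod_sq).
  set (n := 1 - (x ^ 2 + y ^ 2)) in *.
  rewrite Cmult_assoc, <- !RtoC_mult.
  replace (1 / 2 * n * (2 * (1 + b) / n)) with (1 + b) by (field; lra).
  rewrite RtoC_plus. ring.
Qed.

(** The function of the previous lemma tends to [- oo] at the unit circle because
    [b > al], so it has an interior maximum, where [|A_f z| = b |z|]. *)
Lemma lower_order_le_growth (al K b : R) :
  (forall z, unit_disk z -> ln (Cmod (C_derive f z)) <= K - (1 + al) * ln (1 - Cmod z ^ 2)) ->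
  0 <= al < b -> exists z, unit_disk z /\ Cmod (A_op f z) <= b.
Proof.
  intros HK Hb.
  set (v := fun z => ln (Cmod (C_derive f z)) + (1 + b) * ln (1 - Cmod z ^ 2)).
  set (c := (v 0 - K) / (b - al) - 1).
  set (e := Rmin (1 / 2) (exp c)).
  assert (He : 0 < e) by (apply Rmin_pos; [lra|apply exp_pos]).
  assert (He1 : e <= 1 / 2) by apply Rmin_l.
  assert (He2 : e <= exp c) by apply Rmin_r.
  set (rho := sqrt (1 - e)).
  assert (Hrho2 : rho ^ 2 = 1 - e) by (apply pow2_sqrt; lra).
  assert (Hrho : 0 <= rho < 1).
  { split; [apply sqrt_pos|]. unfold rho. rewrite <- sqrt_1 at 2. apply sqrt_lt_1; lra. }
  assert (Hrho0 : 0 < rho) by nra.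
  assert (Hfar : forall z, unit_disk z -> rho <= Cmod z -> v z < v 0).
  { intros z Hz Hr. pose proof (HK z Hz) as B. apply Cmod_lt_1_sq in Hz.
    assert (Hle : 1 - Cmod z ^ 2 <= exp c) by nra.
    assert (Hln : ln (1 - Cmod z ^ 2) <= c).
    { rewrite <- (ln_exp c). apply ln_le; lra. }
    assert (Hv : v z <= K + (b - al) * ln (1 - Cmod z ^ 2)) by (unfold v; lra).
    assert ((b - al) * ln (1 - Cmod z ^ 2) <= (b - al) * c) by (apply Rmult_le_compat_l; lra).
    assert ((b - al) * c = v 0 - K - (b - al)) by (unfold c; field; lra). lra. }
  assert (Hin : forall z, Cmod (z - 0) <= rho -> unit_disk z).
  { intros z Hz. unfold unit_disk. replace (z - 0)%C with z in Hz by ring. lra. }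
  destruct (compact_max (fun z => Cmod (z - 0) <= rho) 1 v 0) as [z [Hz1 Hz2]].
  - replace (0 - 0)%C with (RtoC 0) by ring. rewrite Cmod_0. lra.
  - apply closed_disc.
  - intros z Hz. apply Rlt_le, Hin, Hz.
  - intros z Hz. pose proof (Hin z Hz) as Hzd.
    assert (Hlnc : forall t, 0 < t -> continuous ln t).
    { intros t Ht. apply continuity_pt_filterlim, derivable_continuous_pt.
      exists (/ t). now apply derivable_pt_lim_ln. }
    apply (@continuous_plus C_UniformSpace R_AbsRing R_NormedModule
      (fun z => ln (Cmod (C_derive f z))) (fun z => (1 + b) * ln (1 - Cmod z ^ 2))).
    + apply (continuous_comp (fun z => Cmod (C_derive f z)) ln).
      * apply continuous_Cmod. eapply is_Cderive_continuous, Hf2, Hzd.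
      * now apply Hlnc, Cmod_gt_0, Hf0.
    + apply (@continuous_mult C_UniformSpace R_AbsRing (fun _ => 1 + b) (fun z => ln (1 - Cmod z ^ 2)));
        [apply continuous_const|].
      apply (continuous_comp Cmod (fun t => ln (1 - t ^ 2))).
      * apply (continuous_Cmod (fun z => z)). apply continuous_id.
      * apply (continuous_comp (fun t => 1 - t ^ 2) ln).
        { apply (@ex_derive_continuous R_AbsRing R_NormedModule). auto_derive. auto. }
        apply Hlnc. apply Cmod_lt_1_sq in Hzd. lra.
  - cbv beta in Hz2. pose proof (Hin z Hz1) as Hzd.
    assert (Hz0 : Cmod z < rho).
    { apply Rnot_le_lt. intros L. pose proof (Hfar z Hzd L). specialize (Hz2 0).
      replace (0 - 0)%C with (RtoC 0) in Hz2 by ring. rewrite Cmod_0 in Hz2. lra. }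
    exists z. split; [easy|].
    rewrite (A_op_at_critical b z (rho - Cmod z)); [|easy|lra|].
    + rewrite Cmod_mult, Cmod_conj, Cmod_R, Rabs_right by lra.
      unfold unit_disk in Hzd. pose proof (Cmod_ge_0 z). nra.
    + intros w Hw. pose proof (Cmod_le_center w z) as T.
      assert (Hw' : Cmod (w - 0) <= rho) by (replace (w - 0)%C with w by ring; lra).
      split; [now apply Hin|]. exact (Hz2 w Hw').
Qed.

Hypothesis Hh : holo unit_disk f.

(** In a strip, [(1 - |z|^2) |f'|] is bounded: growth exponent [0]. *)
Lemma lower_order_strip (phi a c b : R) : a < c ->
  (forall w, image f unit_disk w -> open_strip phi a c w) -> 0 < b ->
  exists z, unit_disk z /\ Cmod (A_op f z) <= b.
Proof.
  intros Hac Himg Hb. pose proof PI_RGT_0 as HPI.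
  assert (HKpos : 0 < 2 * (c - a) / PI) by (apply Rdiv_lt_0_compat; lra).
  apply (lower_order_le_growth 0 (ln (2 * (c - a) / PI)) b); [|lra].
  intros z Hz.
  set (n := (Ci * expi (- phi))%C).
  assert (Hn : Cmod n = 1) by (unfold n; rewrite Cmod_mult, Cmod_Ci, Cmod_expi; ring).
  assert (HI : forall w, Im (n * w)%C = Re (expi (- phi) * w)%C).
  { intros w. unfold n. destruct (expi (- phi)), w. unfold Ci, Re, Im; simpl. ring. }
  (* [n] turns the strip into a horizontal one, centred by the subtraction *)
  assert (S : (1 - Cmod z ^ 2) * Cmod (n * C_derive f z) <= 4 * ((c - a) / 2) / PI).
  { apply (strip_derive (fun z => n * f z - (0, ((a + c) / 2)%R))%C z).
    - apply (holo_minus _ (fun z => n * f z)%C); [now apply holo_scal|apply holo_const].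
    - intros y Hy. rewrite Im_minus, HI.
      destruct (Himg (f y)) as [S1 S2]; [now exists y|].
      change (Im (0, ((a + c) / 2)%R)) with ((a + c) / 2). apply Rabs_le. lra.
    - easy.
    - replace (n * C_derive f z)%C with ((0 * f z + n * C_derive f z) - 0)%C by ring.
      apply (is_Cderive_minus (fun z => n * f z)%C (fun _ => (0, ((a + c) / 2)%R))); [|apply is_Cderive_const].
      apply (is_Cderive_mult (fun _ => n) f); [apply is_Cderive_const|auto]. }
  rewrite Cmod_mult, Hn, Rmult_1_l in S.
  pose proof (Hf0 z Hz) as H0. apply Cmod_gt_0 in H0. apply Cmod_lt_1_sq in Hz.
  replace (4 * ((c - a) / 2) / PI) with (2 * (c - a) / PI) in S by (field; lra).
  apply ln_le in S; [|apply Rmult_lt_0_compat; lra].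
  rewrite ln_mult in S by lra. lra.
Qed.

(** The logarithm turns the sector into a strip of width [theta], so that
    [(1 - |z|^2) |f'| <= 2 al |f - w0|] with [al = theta / PI]. Integrated along a
    radius this bounds [|f - w0|] by a multiple of [(1 - |z|^2) ^ (- al)], and
    inserted again it gives growth exponent [al] for [f']. *)
Lemma lower_order_sector (w0 : C) (phi0 theta b : R) : 0 < theta <= PI ->
  (forall w, image f unit_disk w -> open_sector w0 phi0 theta w) -> theta / PI < b ->
  exists z, unit_disk z /\ Cmod (A_op f z) <= b.
Proof.
  intros Hth Himg Hb. pose proof PI_RGT_0 as HPI.
  set (al := theta / PI) in *. assert (Hal : 0 < al) by (apply Rdiv_lt_0_compat; lra).
  set (n := expi (- phi0)). assert (Hn : Cmod n = 1) by apply Cmod_expi.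
  set (u := fun z => (n * (f z - w0))%C).
  assert (Hu : forall z, unit_disk z -> 0 < Re (u z) /\ Rabs (Im (CLog (u z))) <= theta / 2).
  { intros z Hz. destruct (Himg (f z)) as [rho [phi [Hr [Hphi E]]]]; [now exists z|].
    assert (Eu : u z = (rho * expi (phi - phi0))%C).
    { unfold u, n. rewrite E. replace (phi - phi0) with (- phi0 + phi) by ring.
      rewrite expi_plus. ring. }
    apply Rabs_def2 in Hphi.
    assert (Hcos : 0 < cos (phi - phi0)) by (apply cos_gt_0; lra).
    rewrite Im_CLog, Eu, re_scal_l, im_scal_l. unfold expi, Re, Im; simpl fst; simpl snd.
    split; [now apply Rmult_lt_0_compat|].
    replace (rho * sin (phi - phi0) / (rho * cos (phi - phi0))) with (tan (phi - phi0))
      by (unfold tan; field; lra).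
    rewrite atan_tan by lra. apply Rabs_le. lra. }
  set (g := fun z => CLog (u z)).
  assert (Huh : holo unit_disk u).
  { apply holo_scal. apply holo_minus; [exact Hh|apply holo_const]. }
  assert (Hg : holo unit_disk g).
  { apply (holo_comp unit_disk (fun w => 0 < Re w) CLog u); auto using CLog_holo.
    intros z Hz. now apply Hu. }
  assert (Hu0 : forall z, unit_disk z -> u z <> 0).
  { intros z Hz. apply Cmod_gt_0, Cmod_right_half. now apply Hu. }
  assert (Hgd : forall z, unit_disk z -> is_Cderive g z (n * C_derive f z / u z)%C).
  { intros z Hz.
    replace (n * C_derive f z / u z)%C with ((0 * (f z - w0) + n * (C_derive f z - 0)) * / u z)%C
      by (field; auto).
    apply (is_Cderive_comp CLog u).
    - apply CLog_derive. now apply Hu.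
    - apply (is_Cderive_mult (fun _ => n) (fun z => f z - w0)%C); [apply is_Cderive_const|].
      apply (is_Cderive_minus f (fun _ => w0)); [auto|apply is_Cderive_const]. }
  assert (HS : forall z, unit_disk z -> (1 - Cmod z ^ 2) * Cmod (n * C_derive f z / u z) <= 2 * al).
  { intros z Hz. replace (2 * al) with (4 * (theta / 2) / PI) by (unfold al; field; lra).
    apply (strip_derive g); auto. intros y Hy. now apply Hu. }
  apply (lower_order_le_growth al (ln (2 * al) + ln (Cmod (u 0)) + al * ln 4) b); [|lra].
  intros z Hz. set (r := Cmod z).
  assert (Hr : 0 <= r < 1) by (split; [apply Cmod_ge_0|exact Hz]).
  assert (Hgrow : ln (Cmod (u z)) <= ln (Cmod (u 0)) + al * (ln (1 + r) - ln (1 - r))).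
  { destruct z as [x y]. set (z := (x, y) : C) in *.
    set (phi := fun t : R => Re (g (((t * x)%R, (t * y)%R) : C)) - al * (ln (1 + t * r) - ln (1 - t * r))).
    assert (Hseg : forall t, 0 <= t <= 1 -> Cmod (((t * x)%R, (t * y)%R) : C) = t * r).
    { intros t Ht. replace (((t * x)%R, (t * y)%R) : C) with (t * z)%C.
      - rewrite Cmod_mult, Cmod_R, Rabs_right by lra. reflexivity.
      - unfold z, RtoC, Cmult; simpl. f_equal; ring. }
    assert (Hsd : forall t, 0 <= t <= 1 -> unit_disk ((t * x)%R, (t * y)%R)).
    { intros t Ht. unfold unit_disk. rewrite Hseg by easy. nra. }
    set (g1 := fun z => (n * C_derive f z / u z)%C) in *.
    assert (D : forall t, 0 <= t <= 1 -> is_derive phi t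
      (Re (g1 (((t * x)%R, (t * y)%R) : C) * z)%C - al * (2 * r / (1 - (t * r) ^ 2)))).
    { intros t Ht.
      apply (@is_derive_minus R_AbsRing R_NormedModule (fun t => Re (g (((t * x)%R, (t * y)%R) : C)))
        (fun t => al * (ln (1 + t * r) - ln (1 - t * r)))).
      - apply (is_derive_Re_curve g (fun t => t * x) (fun t => t * y)).
        + now apply Hgd, Hsd.
        + auto_derive; auto; ring.
        + auto_derive; auto; ring.
      - assert (0 <= t * r < 1) by nra. auto_derive; [split; [lra|split; [lra|easy]]|field; split; nra]. }
    destruct (MVT_gen phi 0 1 (fun t => Re (g1 (((t * x)%R, (t * y)%R) : C) * z)%C
      - al * (2 * r / (1 - (t * r) ^ 2)))) as [t [Ht E]].
    - rewrite Rmin_left, Rmax_right by lra. intros t Ht. apply D. lra.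
    - rewrite Rmin_left, Rmax_right by lra. intros t Ht. apply continuity_pt_filterlim.
      apply (@ex_derive_continuous R_AbsRing R_NormedModule). eexists. now apply D.
    - rewrite Rmin_left, Rmax_right in Ht by lra.
      pose proof (HS _ (Hsd t Ht)) as B. fold (g1 (((t * x)%R, (t * y)%R) : C)) in B.
      rewrite Hseg in B by easy.
      set (G := g1 (((t * x)%R, (t * y)%R) : C)) in *.
      pose proof (re_le_Cmod (G * z)) as B2. rewrite Cmod_mult in B2. fold r in B2.
      pose proof (Rle_abs (Re (G * z))) as B3.
      assert (Hpos : 0 < 1 - (t * r) ^ 2) by (assert (0 <= t * r < 1) by nra; nra).
      assert (B4 : Cmod G <= 2 * al / (1 - (t * r) ^ 2)).
      { apply Rmult_le_reg_l with (1 - (t * r) ^ 2); [easy|].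
        replace ((1 - (t * r) ^ 2) * (2 * al / (1 - (t * r) ^ 2))) with (2 * al) by (field; lra). exact B. }
      assert (B5 : Cmod G * r <= al * (2 * r / (1 - (t * r) ^ 2))).
      { replace (al * (2 * r / (1 - (t * r) ^ 2))) with (2 * al / (1 - (t * r) ^ 2) * r) by (field; lra).
        apply Rmult_le_compat_r; lra. }
      assert (P1 : phi 1 = ln (Cmod (u z)) - al * (ln (1 + r) - ln (1 - r))).
      { unfold phi, g. rewrite Re_CLog. rewrite !Rmult_1_l. reflexivity. }
      assert (P0 : phi 0 = ln (Cmod (u 0))).
      { unfold phi, g. rewrite Re_CLog. rewrite !Rmult_0_l, Rplus_0_r, Rminus_0_r.
        change (((0, 0)) : C) with (RtoC 0). ring. }
      rewrite P1, P0 in E. lra. }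
  pose proof (HS z Hz) as B. fold r in B.
  assert (Hup : 0 < Cmod (u z)) by (apply Cmod_gt_0; auto).
  assert (Hfp : 0 < Cmod (C_derive f z)) by (apply Cmod_gt_0; auto).
  rewrite Cmod_div, Cmod_mult, Hn, Rmult_1_l in B by auto.
  assert (Hr2 : 0 < 1 - r ^ 2) by nra.
  assert (B' : (1 - r ^ 2) * Cmod (C_derive f z) <= 2 * al * Cmod (u z)).
  { replace ((1 - r ^ 2) * Cmod (C_derive f z))
      with ((1 - r ^ 2) * (Cmod (C_derive f z) / Cmod (u z)) * Cmod (u z)) by (field; lra).
    apply Rmult_le_compat_r; lra. }
  apply ln_le in B'; [|now apply Rmult_lt_0_compat].
  rewrite !ln_mult in B' by lra.
  assert (Hln4 : ln (1 + r) - ln (1 - r) <= ln 4 - ln (1 - r ^ 2)).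
  { replace (1 - r ^ 2) with ((1 + r) * (1 - r)) by ring. rewrite ln_mult by lra.
    assert (ln ((1 + r) * (1 + r)) <= ln 4) by (apply ln_le; nra).
    rewrite ln_mult in H by lra. lra. }
  assert (al * (ln (1 + r) - ln (1 - r)) <= al * (ln 4 - ln (1 - r ^ 2))) by (apply Rmult_le_compat_l; lra).
  rewrite ln_mult by lra. lra.
Qed.

End LowerOrder.

(** * Recession directions of the range *)

Lemma derive_nonneg (phi : R -> R) (l : R) :
  is_derive phi 0 l -> (forall t, 0 <= t -> phi 0 <= phi t) -> 0 <= l.
Proof.
  rewrite is_derive_eps. intros H Hm. apply Rnot_lt_le. intros Hl.
  destruct (H (- l / 2)) as [d [Hd D]]; [lra|].
  specialize (D (d / 2)). rewrite Rminus_0_r, Rabs_right in D by lra.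
  specialize (D ltac:(lra)). specialize (Hm (d / 2) ltac:(lra)).
  apply Rabs_le_between in D. nra.
Qed.

(** Half the logarithmic derivative at [t = 0] of the quotient in the Schwarz-Pick
    lemma, for the points [a + i b] and [c + i d]. *)
Lemma pick_quotient_derive (a b c d : R -> R) (a' b' c' d' : R) :
  is_derive a 0 a' -> is_derive b 0 b' -> is_derive c 0 c' -> is_derive d 0 d' ->
  let M := (1 - (c 0 * a 0 + d 0 * b 0)) ^ 2 + (c 0 * b 0 - d 0 * a 0) ^ 2 in
  let N1 := 1 - (c 0 ^ 2 + d 0 ^ 2) in let N2 := 1 - (a 0 ^ 2 + b 0 ^ 2) in
  0 < M -> 0 < N1 -> 0 < N2 ->
  let Q := fun t => (1 - (c t ^ 2 + d t ^ 2)) * (1 - (a t ^ 2 + b t ^ 2)) /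
      ((1 - (c t * a t + d t * b t)) ^ 2 + (c t * b t - d t * a t) ^ 2) in
  (forall t, 0 <= t -> Q 0 <= Q t) ->
  0 <= - (c 0 * c' + d 0 * d') / N1 - (a 0 * a' + b 0 * b') / N2
       + ((1 - (c 0 * a 0 + d 0 * b 0)) * (c' * a 0 + c 0 * a' + d' * b 0 + d 0 * b')
          - (c 0 * b 0 - d 0 * a 0) * (c' * b 0 + c 0 * b' - d' * a 0 - d 0 * a')) / M.
Proof.
  intros Ha Hb Hc Hd M N1 N2 HM HN1 HN2 Q HQ.
  match goal with |- 0 <= ?E => set (X := E) end.
  assert (D : is_derive Q 0 (2 * (N1 * N2 / M) * X)).
  { unfold Q. auto_derive.
    - repeat split; try (eexists; eassumption).
      apply Rgt_not_eq. unfold M in HM. simpl in HM. lra.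
    - assert (E1 : Derive (fun t => a t) 0 = a') by now apply is_derive_unique.
      assert (E2 : Derive (fun t => b t) 0 = b') by now apply is_derive_unique.
      assert (E3 : Derive (fun t => c t) 0 = c') by now apply is_derive_unique.
      assert (E4 : Derive (fun t => d t) 0 = d') by now apply is_derive_unique.
      rewrite E1, E2, E3, E4. unfold X, N1, N2, M in *. field. repeat split; nra. }
  apply derive_nonneg in D; [|easy].
  assert (0 < 2 * (N1 * N2 / M)).
  { apply Rmult_lt_0_compat; [lra|]. apply Rdiv_lt_0_compat; [|easy]. now apply Rmult_lt_0_compat. }
  apply Rnot_lt_le. intros L. nra.
Qed.

(** The right-hand side is the expression of the previous lemma; the complex form
    shows the coefficient of each velocity [gz], [gy] as a function of the two
    points, and in this form the limit [y -> tau] is visible. *)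
Lemma pick_velocity_form (a b c d a' b' c' d' : R) :
  0 < (1 - (c * a + d * b)) ^ 2 + (c * b - d * a) ^ 2 ->
  0 < 1 - (c ^ 2 + d ^ 2) -> 0 < 1 - (a ^ 2 + b ^ 2) ->
  let z := (a, b) : C in let y := (c, d) : C in
  let gz := (a', b') : C in let gy := (c', d') : C in
  Re (gz * (Cconj y / (1 - Cconj y * z) - Cconj z / (1 - Cmod z ^ 2)%R))%C +
  Re (gy * (Cconj z / (1 - Cconj z * y) - Cconj y / (1 - Cmod y ^ 2)%R))%C =
  - (c * c' + d * d') / (1 - (c ^ 2 + d ^ 2)) - (a * a' + b * b') / (1 - (a ^ 2 + b ^ 2))
       + ((1 - (c * a + d * b)) * (c' * a + c * a' + d' * b + d * b')
          - (c * b - d * a) * (c' * b + c * b' - d' * a - d * a'))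
         / ((1 - (c * a + d * b)) ^ 2 + (c * b - d * a) ^ 2).
Proof.
  intros HM HN1 HN2 z y gz gy. unfold z, y, gz, gy. rewrite !Cmod_sq.
  unfold Cconj, Cdiv, Cinv, Cminus, Cplus, Copp, Cmult, RtoC, Re; simpl fst; simpl snd.
  field. repeat split; nra.
Qed.

Section Recession.

Variable f : C -> C.
Hypothesis Hf1 : forall z, unit_disk z -> is_Cderive f z (C_derive f z).
Hypothesis Hh : holo unit_disk f.
Hypothesis Hinj : injective_on unit_disk f.

Definition recession (v : C) : Prop :=
  forall w t, image f unit_disk w -> 0 <= t -> image f unit_disk (w + t * v)%C.

(** For a recession direction [v] the translations [w + t v] of the range act
    on the disk as holomorphic self-maps [f^{-1} (f z + t v)], which contract the
    hyperbolic metric. Differentiating at [t = 0] gives an inequality for the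
    generator [v / f'] at pairs of points. *)
Lemma generator_inequality (v z y : C) : recession v -> unit_disk z -> unit_disk y ->
  0 <= Re (v / C_derive f z * (Cconj y / (1 - Cconj y * z) - Cconj z / (1 - Cmod z ^ 2)%R))%C +
       Re (v / C_derive f y * (Cconj z / (1 - Cconj z * y) - Cconj y / (1 - Cmod y ^ 2)%R))%C.
Proof.
  intros Hv Hz Hy.
  destruct (univalent_inverse f Hh Hinj) as [g [Hg1 [Hg2 [Hg3 Hg4]]]].
  set (om := fun t s => g (f s + (t : R) * v)%C).
  assert (Him : forall t s, 0 <= t -> unit_disk s -> image f unit_disk (f s + t * v)%C).
  { intros t s Ht Hs. apply Hv; [now exists s|easy]. }
  assert (HP : forall t, 0 <= t ->
    (1 - Cmod y ^ 2) * (1 - Cmod z ^ 2) / Cmod (1 - Cconj y * z) ^ 2 <=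
    (1 - Cmod (om t y) ^ 2) * (1 - Cmod (om t z) ^ 2) / Cmod (1 - Cconj (om t y) * om t z) ^ 2).
  { intros t Ht. apply (schwarz_pick (om t)); auto.
    - apply (holo_comp unit_disk (image f unit_disk) g (fun s => f s + t * v)%C); auto.
      apply holo_plus; [easy|apply holo_const].
    - intros s Hs. apply Hg1. auto. }
  assert (Hd : forall s, unit_disk s ->
    is_derive (fun t => Re (om t s)) 0 (Re (v / C_derive f s)%C) /\
    is_derive (fun t => Im (om t s)) 0 (Im (v / C_derive f s)%C) /\ om 0 s = s).
  { intros s Hs.
    assert (E0 : (f s + 0 * v)%C = f s) by ring.
    pose proof (Hg3 s _ Hs (Hf1 s Hs)) as D.
    set (x := Re (f s)). set (u := Im (f s)). set (p := Re v). set (q := Im v).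
    assert (Ec : forall t : R, (f s + t * v)%C = ((x + t * p)%R, (u + t * q)%R)).
    { intros t. unfold x, u, p, q. destruct (f s), v. unfold RtoC, Cplus, Cmult; simpl. f_equal; ring. }
    assert (D' : is_Cderive g ((x + 0 * p)%R, (u + 0 * q)%R) (/ C_derive f s)%C).
    { rewrite <- Ec, E0. exact D. }
    assert (G1 : is_derive (fun t : R => x + t * p) 0 p) by (auto_derive; auto; ring).
    assert (G2 : is_derive (fun t : R => u + t * q) 0 q) by (auto_derive; auto; ring).
    assert (Ev : (v / C_derive f s)%C = (/ C_derive f s * (p, q))%C).
    { unfold p, q. rewrite <- surjective_pairing. unfold Cdiv. ring. }
    rewrite Ev. split; [|split].
    - eapply is_derive_ext; [|exact (is_derive_Re_curve g _ _ 0 p q _ D' G1 G2)].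
      intros t. unfold om. now rewrite Ec.
    - eapply is_derive_ext; [|exact (is_derive_Im_curve g _ _ 0 p q _ D' G1 G2)].
      intros t. unfold om. now rewrite Ec.
    - unfold om. rewrite E0. now apply Hg2. }
  destruct (Hd z Hz) as [Da [Db E0z]]. destruct (Hd y Hy) as [Dc [Dd E0y]].
  assert (HQ : forall s r, Cmod (1 - Cconj r * s) ^ 2
     = (1 - (Re r * Re s + Im r * Im s)) ^ 2 + (Re r * Im s - Im r * Re s) ^ 2).
  { intros s r. rewrite Cmod2_alt. destruct s, r.
    unfold Cconj, Cminus, Cplus, Copp, Cmult, RtoC, Re, Im; simpl. ring. }
  pose proof (pick_quotient_derive _ _ _ _ _ _ _ _ Da Db Dc Dd) as K.
  cbv beta zeta in K. rewrite E0z, E0y in K.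
  assert (HM : 0 < Cmod (1 - Cconj y * z) ^ 2).
  { apply pow_lt, Cmod_gt_0.
    pose proof (mobius_den (- y) z (unit_disk_opp y Hy) Hz) as H0.
    rewrite Copp_conj in H0. intros E. apply H0. rewrite <- E. ring. }
  rewrite HQ in HM.
  apply Cmod_lt_1_sq in Hz. apply Cmod_lt_1_sq in Hy. rewrite Cmod2_alt in Hz, Hy.
  assert (N1 : 0 < 1 - (Re y ^ 2 + Im y ^ 2)) by lra.
  assert (N2 : 0 < 1 - (Re z ^ 2 + Im z ^ 2)) by lra.
  specialize (K HM N1 N2).
  pose proof (pick_velocity_form (Re z) (Im z) (Re y) (Im y)
    (Re (v / C_derive f z)) (Im (v / C_derive f z)) (Re (v / C_derive f y)) (Im (v / C_derive f y)) HM N1 N2) as F.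
  cbv zeta in F. 
  assert (Ceta : forall w : C, ((Re w, Im w) : C) = w) by (now intros []).
  rewrite !Ceta in F. rewrite F. apply K.
  intros t Ht. specialize (HP t Ht). rewrite !HQ, !Cmod2_alt in HP. exact HP.
Qed.

Lemma Cmod_div_le (a b : C) (m : R) : 0 < m -> m <= Cmod b -> Cmod (a / b) <= Cmod a / m.
Proof.
  intros Hm Hb. assert (b <> 0) by (apply Cmod_gt_0; lra).
  rewrite Cmod_div by easy. apply Rmult_le_compat_l; [apply Cmod_ge_0|].
  now apply Rinv_le_contravar.
Qed.

Lemma Cmod_one_minus (a z : C) : Cmod a <= 1 -> 1 - Cmod z <= Cmod (1 - Cconj a * z).
Proof.
  intros Ha. pose proof (Cmod_triangle_rev 1 (Cconj a * z)) as H.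
  rewrite Cmod_1, Cmod_mult, Cmod_conj in H. pose proof (Cmod_ge_0 z). nra.
Qed.

(** For [|tau| = 1] the coefficient of the velocity of [z] is a positive multiple
    of a holomorphic function of [z]. *)
Lemma boundary_kernel (tau z : C) : Cmod tau = 1 -> unit_disk z ->
  (Cconj tau / (1 - Cconj tau * z) - Cconj z / (1 - Cmod z ^ 2)%R)%C =
  ((Cmod (1 - Cconj tau * z) ^ 2 / (1 - Cmod z ^ 2))%R *
    (Cconj tau / ((1 - Cconj tau * z) * (1 - Cconj tau * z))))%C.
Proof.
  intros Ht Hz.
  assert (Hd : (1 - Cconj tau * z)%C <> 0).
  { apply Cmod_gt_0. pose proof (Cmod_one_minus tau z). unfold unit_disk in Hz. lra. }
  assert (Hd' : (1 - tau * Cconj z)%C <> 0).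
  { apply Cmod_gt_0. rewrite <- Cmod_conj, Cminus_conj, Cmult_conj, Cconj_conj.
    replace (Cconj 1) with (RtoC 1) by (unfold Cconj, RtoC; simpl; f_equal; ring).
    now apply Cmod_gt_0. }
  pose proof (one_sub_Cmod_neq_0 z Hz) as Hn.
  assert (Hz2 : 1 - Cmod z ^ 2 <> 0) by (apply Cmod_lt_1_sq in Hz; lra).
  assert (Htt : (tau * Cconj tau)%C = 1) by (rewrite <- Cmod2_conj, Ht; f_equal; ring).
  rewrite RtoC_div by easy. rewrite RtoC_minus, !Cmod2_conj.
  rewrite Cminus_conj, Cmult_conj, Cconj_conj.
  replace (Cconj 1) with (RtoC 1) by (unfold Cconj, RtoC; simpl; f_equal; ring).
  (* over the common denominator both sides are [conj tau - conj z] *)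
  transitivity ((Cconj tau - Cconj z) / ((1 - Cconj tau * z) * (1 - z * Cconj z)))%C;
    [field; auto|].
  replace (Cconj tau - Cconj z)%C with (Cconj tau - (tau * Cconj tau) * Cconj z)%C by (rewrite Htt; ring).
  field. auto.
Qed.

(** Along the images [y] of points running to infinity inside a sector of the
    range, [f y] is far from the boundary of the range, so the generator is small
    compared with [1 - |y|^2]. In the limit [y -> tau] the generator inequality
    becomes the Berkson-Porta condition at [tau], for every recession direction
    with the same [tau]. *)
Lemma berkson_porta (psi c : R) : 0 < c ->
  (forall t w, 0 < t -> Cmod (w - (f 0 + t * expi psi)) < c * t -> image f unit_disk w) ->
  exists tau, Cmod tau = 1 /\ forall v z, recession v -> unit_disk z ->
    0 <= Re (v * (Cconj tau / (C_derive f z * ((1 - Cconj tau * z) * (1 - Cconj tau * z)))))%C.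
Proof.
  intros Hc Hcone.
  set (p := fun n : nat => (f 0 + (INR n + 1)%R * expi psi)%C).
  assert (Hn0 : forall n, 0 < INR n + 1) by (intros n; pose proof (pos_INR n); lra).
  assert (Hy : forall n : nat, exists y, unit_disk y /\ f y = p n).
  { intros n. destruct (Hcone (INR n + 1) (p n) (Hn0 n)) as [y [H1 H2]].
    - fold (p n). replace (p n - p n)%C with (RtoC 0) by ring. rewrite Cmod_0.
      apply Rmult_lt_0_compat; [easy|apply Hn0].
    - now exists y. }
  destruct (functional_choice _ Hy) as [y Hyy].
  assert (Hrad : forall n, c * (INR n + 1) <= (1 - Cmod (y n) ^ 2) * Cmod (C_derive f (y n))).
  { intros n. destruct (Hyy n) as [Y1 Y2].
    apply (univalent_distance_le_radius f Hh Hinj (y n)); auto.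
    - apply Rmult_lt_0_compat; [easy|apply Hn0].
    - intros w Hw. rewrite Y2 in Hw. now apply (Hcone (INR n + 1)). }
  destruct (adherent_point y 1) as [tau Ht].
  { intros n. apply Rlt_le, Hyy. }
  assert (Htau : Cmod tau = 1).
  { apply Rle_antisym.
    - apply Rnot_lt_le. intros L. destruct (Ht (Cmod tau - 1) 0%nat) as [n [_ Hn]]; [lra|].
      pose proof (Cmod_triangle_rev tau (y n)) as T. rewrite (Cmod_sub_sym tau) in T.
      destruct (Hyy n) as [Y1 _]. unfold unit_disk in Y1. lra.
    - apply Rnot_lt_le. intros L.
      pose proof (holo_continuous _ _ tau Hh L) as HC. rewrite Ccontinuous_eps in HC.
      destruct (HC 1 Rlt_0_1) as [d [Hd D]].
      destruct (INR_unbounded (Cmod (f tau) + Cmod (f 0) + 1)) as [N HN].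
      destruct (Ht d N Hd) as [n [Hn1 Hn2]]. specialize (D _ Hn2).
      destruct (Hyy n) as [_ Y2]. rewrite Y2 in D.
      assert (INR N <= INR n) by now apply le_INR.
      pose proof (Cmod_triangle (p n - f tau) (f tau - f 0)) as T1.
      replace (p n - f tau + (f tau - f 0))%C with ((INR n + 1)%R * expi psi)%C in T1 by (unfold p; ring).
      rewrite Cmod_mult, Cmod_expi, Cmod_R, Rabs_right in T1 by (pose proof (Hn0 n); lra).
      pose proof (Cmod_triangle (f tau) (- f 0)) as T2. rewrite Cmod_opp in T2.
      unfold Cminus in *. lra. }
  exists tau. split; [easy|]. intros v z Hv Hz.
  set (G := (v / C_derive f z)%C).
  set (F := fun s => Re (G * (Cconj s / (1 - Cconj s * z) - Cconj z / (1 - Cmod z ^ 2)%R))%C).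
  pose proof Hz as Hz'. unfold unit_disk in Hz'. pose proof (Cmod_ge_0 z) as Hz0.
  assert (HF : 0 <= F tau).
  { apply Rnot_lt_le. intros L.
    set (E := 1 / (1 - Cmod z) + 1).
    assert (HE : 0 < E) by (assert (0 < 1 / (1 - Cmod z)) by (apply Rdiv_lt_0_compat; lra); unfold E; lra).
    assert (Hlip : forall s, Cmod s <= 1 ->
      Rabs (F s - F tau) <= Cmod G / ((1 - Cmod z) * (1 - Cmod z)) * Cmod (s - tau)).
    { intros s Hs.
      pose proof (Cmod_one_minus s z Hs) as B1. pose proof (Cmod_one_minus tau z ltac:(lra)) as B2.
      assert (B3 : (1 - Cconj s * z)%C <> 0) by (apply Cmod_gt_0; lra).
      assert (B4 : (1 - Cconj tau * z)%C <> 0) by (apply Cmod_gt_0; lra).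
      unfold F. rewrite <- Re_minus. eapply Rle_trans; [apply re_le_Cmod|].
      match goal with |- Cmod ?X <= _ =>
        replace X with ((G * (Cconj (s - tau))) / ((1 - Cconj s * z) * (1 - Cconj tau * z)))%C end.
      2:{ rewrite Cminus_conj. set (q := (Cconj z / (1 - Cmod z ^ 2)%R)%C). field. auto. }
      eapply Rle_trans; [apply (Cmod_div_le _ _ ((1 - Cmod z) * (1 - Cmod z)))|].
      - nra.
      - rewrite Cmod_mult. apply Rmult_le_compat; lra.
      - rewrite Cmod_mult, Cmod_conj. right. field. lra. }
    set (K := Cmod G / ((1 - Cmod z) * (1 - Cmod z)) + 1).
    assert (HK : 0 < K).
    { assert (0 <= Cmod G / ((1 - Cmod z) * (1 - Cmod z)))
        by (apply Rdiv_le_0_compat; [apply Cmod_ge_0|nra]). unfold K. lra. }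
    destruct (INR_unbounded (Cmod v / c * E / (- F tau / 2))) as [N HN].
    destruct (Ht (- F tau / 2 / K) N) as [n [Hn1 Hn2]]; [apply Rdiv_lt_0_compat; lra|].
    destruct (Hyy n) as [Y1 _]. pose proof Y1 as Y1'. unfold unit_disk in Y1'.
    pose proof (generator_inequality v z (y n) Hv Hz Y1) as I. fold G in I. fold (F (y n)) in I.
    specialize (Hlip (y n) ltac:(lra)).
    assert (L1 : F (y n) <= F tau / 2).
    { assert (Cmod G / ((1 - Cmod z) * (1 - Cmod z)) * Cmod (y n - tau) <= K * Cmod (y n - tau)).
      { apply Rmult_le_compat_r; [apply Cmod_ge_0|unfold K; lra]. }
      assert (K * Cmod (y n - tau) <= K * (- F tau / 2 / K)) by (apply Rmult_le_compat_l; lra).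
      replace (K * (- F tau / 2 / K)) with (- F tau / 2) in H0 by (field; lra).
      pose proof (Rle_abs (F (y n) - F tau)). lra. }
    (* the second term is at most |v| E / (c n) *)
    set (s := y n) in *. set (f1s := C_derive f s) in *.
    assert (Hs2 : 0 < 1 - Cmod s ^ 2) by (apply Cmod_lt_1_sq in Y1; lra).
    specialize (Hrad n). fold s f1s in Hrad.
    assert (Hf1s : 0 < Cmod f1s).
    { apply Rnot_le_lt. intros L0. pose proof (Hn0 n).
      assert (0 < c * (INR n + 1)) by now apply Rmult_lt_0_compat. nra. }
    set (T := (v / f1s * (Cconj z / (1 - Cconj z * s) - Cconj s / (1 - Cmod s ^ 2)%R))%C) in *.
    assert (HT : Cmod T <= Cmod v / (c * (INR n + 1)) * E).
    { assert (B1 : 1 - Cmod z <= Cmod (1 - Cconj z * s)).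
      { pose proof (Cmod_triangle_rev 1 (Cconj z * s)) as R. rewrite Cmod_1, Cmod_mult, Cmod_conj in R.
        pose proof (Cmod_ge_0 s). nra. }
      assert (B0 : (1 - Cconj z * s)%C <> 0) by (apply Cmod_gt_0; lra).
      assert (B5 : RtoC (1 - Cmod s ^ 2) <> 0) by (apply RtoC_neq0; lra).
      assert (ET : T = (v / ((1 - Cmod s ^ 2)%R * f1s) *
         (Cconj z * (1 - Cmod s ^ 2)%R / (1 - Cconj z * s) - Cconj s))%C).
      { unfold T. field. repeat split; auto. apply Cmod_gt_0. easy. }
      rewrite ET, Cmod_mult. apply Rmult_le_compat; try apply Cmod_ge_0.
      - apply Cmod_div_le; [apply Rmult_lt_0_compat; [easy|apply Hn0]|].
        rewrite Cmod_mult, Cmod_R, Rabs_right by lra. exact Hrad.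
      - unfold E. unfold Cminus at 1. eapply Rle_trans; [apply Cmod_triangle|].
        rewrite Cmod_opp, Cmod_conj. apply Rplus_le_compat; [|lra].
        eapply Rle_trans; [apply (Cmod_div_le _ _ (1 - Cmod z)); [lra|exact B1]|].
        apply Rmult_le_compat_r; [apply Rlt_le, Rinv_0_lt_compat; lra|].
        rewrite Cmod_mult, Cmod_conj, Cmod_R, Rabs_right by lra.
        assert (Cmod s ^ 2 >= 0) by (apply Rle_ge, pow2_ge_0). nra. }
    pose proof (re_le_Cmod T) as RT. pose proof (Rle_abs (Re T)) as RT2.
    assert (HNn : INR N <= INR n) by now apply le_INR.
    assert (Hfin : Cmod v / (c * (INR n + 1)) * E < - F tau / 2).
    { assert (HX : Cmod v / c * E < (- F tau / 2) * (INR n + 1)).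
      { replace (Cmod v / c * E) with ((- F tau / 2) * (Cmod v / c * E / (- F tau / 2))) by (field; lra).
        apply Rmult_lt_compat_l; lra. }
      apply Rmult_lt_reg_r with (INR n + 1); [apply Hn0|].
      replace (Cmod v / (c * (INR n + 1)) * E * (INR n + 1)) with (Cmod v / c * E)
        by (field; pose proof (Hn0 n); lra). exact HX. }
    lra. }
  unfold F in HF. rewrite (boundary_kernel tau z Htau Hz) in HF.
  set (den := ((1 - Cconj tau * z) * (1 - Cconj tau * z))%C) in *.
  set (kap := Cmod (1 - Cconj tau * z) ^ 2 / (1 - Cmod z ^ 2)) in *.
  assert (Hkap : 0 < kap).
  { apply Rdiv_lt_0_compat.
    - apply pow_lt. pose proof (Cmod_one_minus tau z ltac:(lra)). lra.
    - apply Cmod_lt_1_sq in Hz. lra. }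
  assert (Hden : den <> 0).
  { pose proof (Cmod_one_minus tau z ltac:(lra)). apply Cmult_neq_0; apply Cmod_gt_0; lra. }
  assert (Hfz : C_derive f z <> 0).
  { apply (univalent_derive_neq_0 f Hh Hinj z); auto. }
  replace (G * (kap * (Cconj tau / den)))%C with (kap * (v * (Cconj tau / (C_derive f z * den))))%C in HF
    by (unfold G; field; auto).
  rewrite re_scal_l in HF. apply Rnot_lt_le. intros L. nra.
Qed.

Hypothesis Hf2 : forall z, unit_disk z -> is_Cderive (C_derive f) z (C_derive (C_derive f) z).
Hypothesis Hh1 : holo unit_disk (C_derive f).

Lemma recession_sector_cone (psi s0 : R) : 0 < s0 <= PI / 2 ->
  (forall s, Rabs s <= s0 -> recession (expi (psi + s))) ->
  exists c, 0 < c /\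
  (forall t w, 0 < t -> Cmod (w - (f 0 + t * expi psi)) < c * t -> image f unit_disk w).
Proof.
  intros Hs0 Hrec. pose proof PI_RGT_0 as HPI.
  set (s1 := Rmin s0 (PI / 4)).
  assert (Hs1 : 0 < s1) by (apply Rmin_pos; lra).
  assert (Hs1a : s1 <= s0) by apply Rmin_l. assert (Hs1b : s1 <= PI / 4) by apply Rmin_r.
  set (T := tan s1). assert (HT : 0 < T) by (apply tan_gt_0; lra).
  exists (T / (1 + T)). split; [apply Rdiv_lt_0_compat; lra|].
  intros t w Ht Hw.
  set (u := (expi (- psi) * (w - f 0) * / t)%C).
  assert (Ht0 : RtoC t <> 0) by (apply RtoC_neq0; lra).
  assert (Ew : w = (f 0 + t * (expi psi * u))%C).
  { unfold u. transitivity (f 0 + (expi (- psi) * expi psi) * (w - f 0))%C; [rewrite expi_opp_mult; ring|].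
    field. easy. }
  assert (Hu1 : Cmod (u - 1) < T / (1 + T)).
  { replace (w - (f 0 + t * expi psi))%C with (t * (expi psi * (u - 1)))%C in Hw by (rewrite Ew; ring).
    rewrite !Cmod_mult, Cmod_expi, Cmod_R, Rabs_right in Hw by lra. nra. }
  pose proof (re_le_Cmod (u - 1)) as R1. pose proof (Rabs_Im_le_Cmod (u - 1)) as R2.
  rewrite Re_minus in R1. rewrite Im_minus in R2.
  change (Re 1) with 1 in R1. change (Im 1) with 0 in R2. rewrite Rminus_0_r in R2.
  assert (Hcc : T / (1 + T) < 1).
  { apply Rmult_lt_reg_r with (1 + T); [lra|]. unfold Rdiv. rewrite Rmult_assoc, Rinv_l; lra. }
  assert (R1' := Rabs_le_between (Re u - 1) (Cmod (u - 1))).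
  destruct (proj1 R1' R1) as [R3 R4].
  assert (Hre : 1 - T / (1 + T) < Re u) by lra.
  assert (Hre0 : 0 < Re u) by lra.
  assert (E1 : T * (1 - T / (1 + T)) = T / (1 + T)) by (field; lra).
  assert (Hratio : Rabs (Im u / Re u) <= T).
  { rewrite Rabs_div, (Rabs_right (Re u)) by lra.
    apply Rmult_le_reg_r with (Re u); [easy|]. unfold Rdiv. rewrite Rmult_assoc, Rinv_l by lra.
    assert (T * (1 - T / (1 + T)) <= T * Re u) by (apply Rmult_le_compat_l; lra). lra. }
  assert (Hat : Rabs (Im (CLog u)) <= s1).
  { rewrite Im_CLog. replace s1 with (atan T) by (unfold T; apply atan_tan; lra).
    now apply Rabs_atan_le. }
  rewrite Ew. rewrite <- (Cexp_CLog u Hre0). unfold Cexp.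
  replace (f 0 + t * (expi psi * (exp (Re (CLog u)) * expi (Im (CLog u)))))%C
    with (f 0 + (t * exp (Re (CLog u)))%R * expi (psi + Im (CLog u)))%C
    by (rewrite expi_plus, RtoC_mult; ring).
  apply Hrec; [lra| |].
  - exists 0. split; [apply unit_disk_0|easy].
  - apply Rmult_le_pos; [lra|apply Rlt_le, exp_pos].
Qed.

(** If the range is invariant under the translations of a sector of aperture
    [gam PI], the Berkson-Porta function takes values in the sector polar to it,
    its logarithm in a strip of width [(1 - gam) PI], and the strip estimate
    places [A_f] within [1 - gam] of a unimodular number. *)
Lemma A_op_ge_recession (psi gam : R) (zeta : C) : 0 < gam <= 1 ->
  (forall s, Rabs s <= gam * PI / 2 -> recession (expi (psi + s))) ->
  unit_disk zeta -> gam <= Cmod (A_op f zeta).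
Proof.
  intros Hgam Hrec Hzeta. pose proof PI_RGT_0 as HPI.
  set (s0 := gam * PI / 2) in *. assert (Hs0 : 0 < s0 <= PI / 2) by (unfold s0; split; nra).
  destruct (recession_sector_cone psi s0 Hs0 Hrec) as [c [Hc Hcone]].
  destruct (berkson_porta psi c Hc Hcone) as [tau [Ht HBP]].
  assert (Hf0 : forall z, unit_disk z -> C_derive f z <> 0).
  { intros z Hz. now apply (univalent_derive_neq_0 f Hh Hinj z), Hf1. }
  set (e := fun z => (1 - Cconj tau * z)%C).
  assert (He0 : forall z, unit_disk z -> e z <> 0).
  { intros z Hz. apply Cmod_gt_0. pose proof (Cmod_one_minus tau z ltac:(lra)).
    unfold unit_disk in Hz. unfold e. lra. }
  set (h := fun z => (C_derive f z * (e z * e z))%C).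
  assert (Hh0 : forall z, unit_disk z -> h z <> 0).
  { intros z Hz. apply Cmult_neq_0; [auto|]. apply Cmult_neq_0; auto. }
  set (k := (expi psi * Cconj tau)%C).
  assert (Hk : k <> 0).
  { apply Cmod_gt_0. unfold k. rewrite Cmod_mult, Cmod_expi, Cmod_conj, Ht. lra. }
  set (Q := fun z => (k / h z)%C).
  assert (HQre : forall z, unit_disk z -> 0 < Re (Q z) /\ Rabs (Im (CLog (Q z))) <= PI / 2 - s0).
  { intros z Hz.
    assert (HQ0 : Q z <> 0).
    { apply Cmult_neq_0; [easy|]. apply Cmod_gt_0. rewrite Cmod_inv by auto.
      apply Rinv_0_lt_compat, Cmod_gt_0; auto. }
    assert (B : forall s, Rabs s <= s0 -> 0 <= Re (Q z) * cos s - Im (Q z) * sin s).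
    { intros s Hs. pose proof (HBP _ z (Hrec s Hs) Hz) as P.
      replace (expi (psi + s) * (Cconj tau / (C_derive f z * ((1 - Cconj tau * z) * (1 - Cconj tau * z)))))%C
        with (Q z * expi s)%C in P.
      - rewrite re_mult in P. exact P.
      - rewrite expi_plus. unfold Q, k, h, e. field. split; [now apply He0|now apply Hf0]. }
    pose proof (B 0) as B0. rewrite Rabs_R0, cos_0, sin_0 in B0. specialize (B0 ltac:(lra)).
    pose proof (B s0) as B1. rewrite Rabs_right in B1 by lra. specialize (B1 ltac:(lra)).
    pose proof (B (- s0)) as B2. rewrite Rabs_Ropp, Rabs_right, cos_neg, sin_neg in B2 by lra.
    specialize (B2 ltac:(lra)).
    assert (Hsin : 0 < sin s0) by (apply sin_gt_0; lra).
    assert (Hcos : 0 <= cos s0) by (apply cos_ge_0; lra).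
    set (X := Re (Q z)) in *. set (Y := Im (Q z)) in *.
    assert (HX : 0 < X).
    { assert (HX0 : 0 <= X) by lra. destruct HX0 as [HX0|HX0]; [easy|]. exfalso.
      assert (HY : Y = 0) by nra. apply HQ0.
      rewrite (surjective_pairing (Q z)). change (fst (Q z)) with X. change (snd (Q z)) with Y.
      now rewrite HY, <- HX0. }
    split; [easy|]. rewrite Im_CLog. fold X Y.
    set (T := tan (PI / 2 - s0)).
    assert (HT : T = cos s0 / sin s0).
    { unfold T, tan. now rewrite sin_shift, cos_shift. }
    assert (Ha : atan T = PI / 2 - s0) by (apply atan_tan; lra).
    assert (HYX : - T <= Y / X <= T).
    { rewrite HT. split.
      - apply Rmult_le_reg_r with (X * sin s0); [now apply Rmult_lt_0_compat|].
        replace (- (cos s0 / sin s0) * (X * sin s0)) with (- (X * cos s0)) by (field; lra).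
        replace (Y / X * (X * sin s0)) with (Y * sin s0) by (field; lra). lra.
      - apply Rmult_le_reg_r with (X * sin s0); [now apply Rmult_lt_0_compat|].
        replace (cos s0 / sin s0 * (X * sin s0)) with (X * cos s0) by (field; lra).
        replace (Y / X * (X * sin s0)) with (Y * sin s0) by (field; lra). lra. }
    rewrite <- Ha. now apply Rabs_atan_le, Rabs_le. }
  assert (Heh : holo unit_disk e).
  { apply (holo_minus _ (fun _ => RtoC 1) (fun z => Cconj tau * z)%C); [apply holo_const|].
    apply holo_scal, holo_id. }
  assert (HQh : holo unit_disk Q).
  { apply (holo_div unit_disk (fun _ => k) h); auto; [apply holo_const|].
    apply holo_mult; [easy|]. now apply holo_mult. }
  assert (HLh : holo unit_disk (fun z => CLog (Q z))).
  { apply (holo_comp unit_disk (fun w => 0 < Re w) CLog Q); auto using CLog_holo.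
    intros z Hz. now apply HQre. }
  set (f1 := C_derive f zeta) in *. set (f2 := C_derive (C_derive f) zeta).
  set (E := e zeta).
  assert (HE : E <> 0) by now apply He0.
  assert (Hf10 : f1 <> 0) by now apply Hf0.
  assert (De : is_Cderive e zeta (0 - (0 * zeta + Cconj tau * 1))%C).
  { apply (is_Cderive_minus (fun _ => RtoC 1) (fun z => Cconj tau * z)%C); [apply is_Cderive_const|].
    apply (is_Cderive_mult (fun _ => Cconj tau) (fun z => z)); [apply is_Cderive_const|apply is_Cderive_id]. }
  pose proof (is_Cderive_mult _ _ _ _ _ (Hf2 zeta Hzeta) (is_Cderive_mult _ _ _ _ _ De De)) as Dh.
  cbv beta in Dh. fold f1 f2 E in Dh.
  pose proof (is_Cderive_div (fun _ => k) h zeta _ _ (is_Cderive_const k zeta) Dh (Hh0 zeta Hzeta)) as DQ.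
  cbv beta in DQ.
  pose proof (is_Cderive_comp CLog Q zeta _ _ (CLog_derive _ (proj1 (HQre zeta Hzeta))) DQ) as DL.
  pose proof (strip_derive (fun z => CLog (Q z)) zeta _ (PI / 2 - s0) HLh
    (fun z Hz => proj2 (HQre z Hz)) Hzeta DL) as S.
  match type of S with _ * Cmod ?X <= _ => replace X with (2 * Cconj tau / E - f2 / f1)%C in S end.
  2:{ unfold Q, h. fold f1 E. field. auto. }
  replace (4 * (PI / 2 - s0) / PI) with (2 * (1 - gam)) in S by (unfold s0; field; lra).
  assert (Hz2 : 0 < 1 - Cmod zeta ^ 2) by (apply Cmod_lt_1_sq in Hzeta; lra).
  set (n := 1 - Cmod zeta ^ 2) in *.
  set (B := (n * Cconj tau / E - Cconj zeta)%C).
  assert (HB : Cmod B = 1).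
  { assert (Htt : (tau * Cconj tau)%C = 1) by (rewrite <- Cmod2_conj, Ht; f_equal; ring).
    assert (EB : B = (Cconj (tau - zeta) / E)%C).
    { unfold B, n. rewrite RtoC_minus, Cmod2_conj, Cminus_conj. unfold E, e. field. exact HE. }
    assert (EE : E = (Cconj tau * (tau - zeta))%C).
    { unfold E, e. replace (Cconj tau * (tau - zeta))%C with (tau * Cconj tau - Cconj tau * zeta)%C by ring.
      now rewrite Htt. }
    rewrite EB, Cmod_div, Cmod_conj by easy.
    rewrite EE, Cmod_mult, Cmod_conj, Ht. field.
    apply Rgt_not_eq, Cmod_gt_0. intros E0. apply HE. rewrite EE, E0. ring. }
  assert (HBA : Cmod (B - A_op f zeta) <= 1 - gam).
  { replace (B - A_op f zeta)%C with ((1 / 2 * n)%R * (2 * Cconj tau / E - f2 / f1))%C.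
    - rewrite Cmod_mult, Cmod_R, Rabs_right by lra. lra.
    - unfold A_op, B. fold f1 f2 n. rewrite RtoC_mult, RtoC_div by lra. field. auto. }
  pose proof (Cmod_triangle_rev B (A_op f zeta)) as T. lra.
Qed.

End Recession.

(** * Plane convex sets *)

Section PlaneConvex.

Variable E : C -> Prop.
Hypothesis Econvex : convex E.
Hypothesis Eopen : forall w, E w -> exists d, 0 < d /\ forall y, Cmod (y - w) < d -> E y.

(** The barrier cone of [E], given by the angles of its elements. *)
Definition barrier (phi : R) : Prop :=
  exists c, forall w, E w -> Re (expi (- phi) * w)%C <= c.

Lemma open_strict (phi c : R) :
  (forall w, E w -> Re (expi (- phi) * w)%C <= c) ->
  forall w, E w -> Re (expi (- phi) * w)%C < c.
Proof.
  intros H w Hw. destruct (Eopen w Hw) as [d [Hd D]].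
  specialize (H (w + (d / 2)%R * expi phi)%C).
  replace (expi (- phi) * (w + (d / 2)%R * expi phi))%C
    with (expi (- phi) * w + (d / 2)%R * (expi (- phi) * expi phi))%C in H by ring.
  rewrite expi_opp_mult, re_plus, re_scal_l in H. change (Re 1) with 1 in H.
  assert (Re (expi (- phi) * w)%C + d / 2 * 1 <= c); [|lra].
  apply H, D. replace (w + (d / 2)%R * expi phi - w)%C with ((d / 2)%R * expi phi)%C by ring.
  rewrite Cmod_mult, Cmod_expi, Cmod_R, Rabs_right; lra.
Qed.

(** Supporting line at a point [b] outside [E]: in coordinates where a point of
    [E] is on the positive axis from [b], the slopes [x / y] of the points above
    the axis exceed those of the points below it, and their infimum is the slope
    of the line. *)
Lemma separation (w0 b : C) : E w0 -> ~ E b ->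
  exists phi, forall w, E w -> Re (expi (- phi) * w)%C <= Re (expi (- phi) * b)%C.
Proof.
  intros Hw0 Hb.
  destruct (polar_form (w0 - b)%C) as [al [_ Eal]].
  set (r := Cmod (w0 - b)) in *.
  assert (Hr : 0 < r).
  { apply Cmod_gt_0, Cminus_eq_contra. intros E1. apply Hb. now rewrite <- E1. }
  set (u := fun w => (expi (- al) * (w - b))%C).
  set (X := fun w => Re (u w)). set (Y := fun w => Im (u w)).
  assert (Euinv : forall w, w = (b + expi al * u w)%C).
  { intros w. unfold u. transitivity (b + (expi (- al) * expi al) * (w - b))%C;
      [rewrite expi_opp_mult|]; ring. }
  assert (Hub : forall w, X w = 0 -> Y w = 0 -> w = b).
  { intros w HX HY. rewrite (Euinv w), (surjective_pairing (u w)).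
    change (fst (u w)) with (X w). change (snd (u w)) with (Y w). rewrite HX, HY.
    change (((0, 0)) : C) with (RtoC 0). ring. }
  assert (Eu0 : u w0 = r).
  { unfold u. rewrite Eal. transitivity (r * (expi (- al) * expi al))%C; [ring|].
    rewrite expi_opp_mult. ring. }
  assert (Haff : forall w1 w2 (t : R), u ((1 - t)%R * w1 + t * w2)%C = ((1 - t)%R * u w1 + t * u w2)%C).
  { intros w1 w2 t. unfold u. rewrite RtoC_minus. ring. }
  assert (HX : forall w1 w2 t, X ((1 - t)%R * w1 + t * w2)%C = (1 - t) * X w1 + t * X w2).
  { intros. unfold X. now rewrite Haff, re_plus, !re_scal_l. }
  assert (HY : forall w1 w2 t, Y ((1 - t)%R * w1 + t * w2)%C = (1 - t) * Y w1 + t * Y w2).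
  { intros. unfold Y. now rewrite Haff, im_plus, !im_scal_l. }
  assert (X0 : X w0 = r) by (unfold X; rewrite Eu0; reflexivity).
  assert (Y0 : Y w0 = 0) by (unfold Y; rewrite Eu0; reflexivity).
  assert (Haxis : forall w, E w -> Y w = 0 -> 0 < X w).
  { intros w Hw HYw. apply Rnot_le_lt. intros L. apply Hb.
    set (t := r / (r - X w)).
    assert (Ht : 0 <= t <= 1).
    { split; [apply Rdiv_le_0_compat; lra|].
      apply Rmult_le_reg_r with (r - X w); [lra|]. unfold t, Rdiv. rewrite Rmult_assoc, Rinv_l; lra. }
    rewrite <- (Hub ((1 - t)%R * w0 + t * w)%C).
    - now apply Econvex.
    - rewrite HX, X0. unfold t. field. lra.
    - rewrite HY, Y0, HYw. ring. }
  assert (Hslope : forall w1 w2, E w1 -> E w2 -> 0 < Y w1 -> Y w2 < 0 -> X w2 / Y w2 <= X w1 / Y w1).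
  { intros w1 w2 H1 H2 P1 P2. set (t := Y w1 / (Y w1 - Y w2)).
    assert (Ht : 0 <= t <= 1).
    { split; [apply Rdiv_le_0_compat; lra|].
      apply Rmult_le_reg_r with (Y w1 - Y w2); [lra|]. unfold t, Rdiv. rewrite Rmult_assoc, Rinv_l; lra. }
    pose proof (Haxis ((1 - t)%R * w1 + t * w2)%C) as A.
    rewrite HX, HY in A.
    assert (A' : 0 < (1 - t) * X w1 + t * X w2).
    { apply A; [now apply Econvex|]. unfold t. field. lra. }
    replace ((1 - t) * X w1 + t * X w2)
      with ((X w1 / Y w1 - X w2 / Y w2) * (Y w1 * - Y w2 / (Y w1 - Y w2))) in A'
      by (unfold t; field; lra).
    assert (0 < Y w1 * - Y w2 / (Y w1 - Y w2)).
    { apply Rdiv_lt_0_compat; [|lra]. apply Rmult_lt_0_compat; lra. }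
    nra. }
  destruct (Eopen w0 Hw0) as [d [Hd D]].
  assert (Hside : forall s : R, Rabs s < d -> exists w, E w /\ Y w = s).
  { intros s Hs. exists (w0 + expi al * (s * Ci))%C. split.
    - apply D. replace (w0 + expi al * (s * Ci) - w0)%C with (expi al * (s * Ci))%C by ring.
      rewrite !Cmod_mult, Cmod_expi, Cmod_Ci, Cmod_R. lra.
    - unfold Y, u. replace (expi (- al) * (w0 + expi al * (s * Ci) - b))%C
        with (u w0 + (expi (- al) * expi al) * (s * Ci))%C by (unfold u; ring).
      rewrite expi_opp_mult, Eu0. unfold Im, Ci; simpl. ring. }
  destruct (Hside (d / 2)) as [wu [Hwu HYu]]; [rewrite Rabs_right; lra|].
  destruct (Hside (- (d / 2))) as [wl [Hwl HYl]]; [rewrite Rabs_left; lra|].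
  destruct (completeness (fun y => exists w, E w /\ 0 < Y w /\ y = - (X w / Y w))) as [S [HS1 HS2]].
  { exists (- (X wl / Y wl)). intros y [w [Hw [P ->]]].
    pose proof (Hslope w wl Hw Hwl P ltac:(lra)). lra. }
  { exists (- (X wu / Y wu)), wu. repeat split; auto. lra. }
  set (m := - S).
  assert (Hm : forall w, E w -> m * Y w <= X w).
  { intros w Hw. destruct (Rtotal_order (Y w) 0) as [N|[Z|P]].
    - assert (X w / Y w <= m).
      { assert (S <= - (X w / Y w)); [|unfold m; lra]. apply HS2. intros y [w' [Hw' [P ->]]].
        pose proof (Hslope w' w Hw' Hw P N). lra. }
      replace (X w) with (X w / Y w * Y w) at 1 by (field; lra). nra.
    - rewrite Z. pose proof (Haxis w Hw Z). lra.
    - assert (m <= X w / Y w).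
      { assert (- (X w / Y w) <= S); [|unfold m; lra]. apply HS1. now exists w. }
      replace (X w) with (X w / Y w * Y w) by (field; lra). nra. }
  destruct (polar_form (-1, m)) as [be [_ Ebe]].
  set (q := Cmod (-1, m)) in *.
  assert (Hq : 0 < q).
  { apply Cmod_gt_0. intros E1. apply (f_equal fst) in E1. simpl in E1. lra. }
  exists (be + al). intros w Hw.
  assert (Hneg : Re (expi (- (be + al)) * (w - b))%C <= 0).
  { replace (- (be + al)) with (- be + - al) by ring. rewrite expi_plus.
    replace (expi (- be) * expi (- al) * (w - b))%C with (expi (- be) * u w)%C by (unfold u; ring).
    assert (Ec : (q * Re (expi (- be) * u w)%C) = - X w + m * Y w).
    { apply (f_equal fst) in Ebe as E1. apply (f_equal snd) in Ebe as E2.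
      unfold expi, RtoC, Cmult in E1, E2; simpl in E1, E2.
      unfold expi. rewrite cos_neg, sin_neg, re_mult.
      change (Re (u w)) with (X w). change (Im (u w)) with (Y w).
      change (Re (cos be, - sin be)) with (cos be). change (Im (cos be, - sin be)) with (- sin be).
      replace (- X w + m * Y w) with ((-1) * X w + m * Y w) by ring. rewrite E1, E2. ring. }
    pose proof (Hm w Hw). apply Rnot_lt_le. intros L. nra. }
  replace (expi (- (be + al)) * (w - b))%C
    with (expi (- (be + al)) * w - expi (- (be + al)) * b)%C in Hneg by ring.
  rewrite Re_minus in Hneg. lra.
Qed.

Lemma barrier_between (p1 p p2 : R) :
  barrier p1 -> barrier p2 -> p1 <= p <= p2 -> p2 - p1 < PI -> barrier p.
Proof.
  intros [c1 H1] [c2 H2] Hp Hlt.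
  destruct (Req_dec p1 p2) as [E1|E1].
  { replace p with p1 by lra. now exists c1. }
  assert (Hs : 0 < sin (p2 - p1)) by (apply sin_gt_0; lra).
  assert (Hs1 : 0 <= sin (p2 - p)) by (apply sin_ge_0; lra).
  assert (Hs2 : 0 <= sin (p - p1)) by (apply sin_ge_0; lra).
  exists ((sin (p2 - p) * c1 + sin (p - p1) * c2) / sin (p2 - p1)).
  intros w Hw. specialize (H1 w Hw). specialize (H2 w Hw).
  (* e^(i p) is a nonnegative combination of e^(i p1) and e^(i p2) *)
  assert (K : sin (p2 - p1) * Re (expi (- p) * w)%C =
    sin (p2 - p) * Re (expi (- p1) * w)%C + sin (p - p1) * Re (expi (- p2) * w)%C).
  { destruct w as [x y]. unfold expi, Re, Cmult; simpl. rewrite !cos_neg, !sin_neg, !sin_minus.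
    pose proof (sin2_cos2 p1) as T1. pose proof (sin2_cos2 p2) as T2. pose proof (sin2_cos2 p) as T.
    unfold Rsqr in *. ring. }
  apply Rmult_le_reg_l with (sin (p2 - p1)); [easy|]. rewrite K.
  replace (sin (p2 - p1) * ((sin (p2 - p) * c1 + sin (p - p1) * c2) / sin (p2 - p1)))
    with (sin (p2 - p) * c1 + sin (p - p1) * c2) by (field; lra).
  apply Rplus_le_compat; now apply Rmult_le_compat_l.
Qed.

Lemma barrier_expi (p q : R) : expi p = expi q -> barrier p -> barrier q.
Proof.
  intros H [c Hc]. exists c. intros w Hw. specialize (Hc w Hw).
  replace (expi (- q)) with (expi (- p)); [exact Hc|].
  unfold expi in *. rewrite !cos_neg, !sin_neg. congruence.
Qed.

Lemma half_planes_in_sector (p del : R) (w0 w : C) : 0 <= del < PI ->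
  Re (expi (- p) * (w - w0))%C < 0 -> Re (expi (- (p + del)) * (w - w0))%C < 0 ->
  open_sector w0 (p + del / 2 + PI) (PI - del) w.
Proof.
  intros Hdel H1 H2. pose proof PI_RGT_0 as HPI.
  set (pc := p + del / 2 + PI).
  destruct (polar_form (expi (- pc) * (w - w0))%C) as [s [Hs Es]].
  rewrite Cmod_mult, Cmod_expi, Rmult_1_l in Es.
  set (r := Cmod (w - w0)) in *.
  assert (Ew : (w - w0)%C = (r * expi (pc + s))%C).
  { rewrite expi_plus. transitivity (expi pc * (r * expi s))%C; [|ring]. rewrite <- Es.
    transitivity ((expi (- pc) * expi pc) * (w - w0))%C; [rewrite expi_opp_mult|]; ring. }
  assert (Hr : 0 < r).
  { pose proof (Cmod_ge_0 (w - w0)) as [Hr|Hr]; [exact Hr|]. exfalso.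
    symmetry in Hr. apply Cmod_eq_0 in Hr. rewrite Hr in H1.
    rewrite Cmult_0_r in H1. change (Re 0) with 0 in H1. lra. }
  rewrite Ew, Re_expi_mult in H1, H2.
  replace (- p + (pc + s)) with (s + del / 2 + PI) in H1 by (unfold pc; lra).
  replace (- (p + del) + (pc + s)) with (s - del / 2 + PI) in H2 by (unfold pc; lra).
  rewrite neg_cos in H1, H2.
  assert (C1 : 0 < cos (s + del / 2)) by nra. assert (C2 : 0 < cos (s - del / 2)) by nra.
  exists r, (pc + s). split; [easy|]. split.
  - replace (pc + s - pc) with s by ring. apply Rabs_def1.
    + apply Rnot_le_lt. intros L.
      assert (cos (s + del / 2) <= 0) by (apply cos_le_0; lra). lra.
    + apply Rnot_le_lt. intros L.
      rewrite <- cos_neg in C2.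
      assert (cos (- (s - del / 2)) <= 0) by (apply cos_le_0; lra). lra.
  - rewrite <- Ew. ring.
Qed.

Lemma two_barriers_sector (p del : R) : 0 <= del < PI -> barrier p -> barrier (p + del) ->
  exists w0, forall w, E w -> open_sector w0 (p + del / 2 + PI) (PI - del) w.
Proof.
  intros Hdel [c1 H1] [c2 H2].
  pose proof (open_strict _ _ H1) as S1. pose proof (open_strict _ _ H2) as S2.
  assert (Hv : exists w0, (forall w, E w -> Re (expi (- p) * w)%C < Re (expi (- p) * w0)%C) /\
    (forall w, E w -> Re (expi (- (p + del)) * w)%C < Re (expi (- (p + del)) * w0)%C)).
  { destruct (Req_dec del 0) as [->|Hne].
    - rewrite Rplus_0_r. exists (c1 * expi p)%C.
      assert (Ec : Re (expi (- p) * (c1 * expi p)) = c1).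
      { rewrite Re_expi_mult. replace (- p + p) with 0 by ring. rewrite cos_0. ring. }
      rewrite Ec. auto.
    - assert (Hs : 0 < sin del) by (apply sin_gt_0; lra).
      set (q := p + del) in *.
      assert (Ed : sin del = sin q * cos p - cos q * sin p).
      { rewrite <- sin_minus. f_equal. unfold q. ring. }
      set (vx := (c1 * sin q - c2 * sin p) / sin del).
      set (vy := (c2 * cos p - c1 * cos q) / sin del).
      exists (vx, vy).
      split; intros w Hw.
      + replace (Re (expi (- p) * (vx, vy))%C)
          with c1; [now apply S1|].
        unfold expi, Re, Cmult; simpl. rewrite cos_neg, sin_neg. unfold vx, vy.
        replace (cos p * ((c1 * sin q - c2 * sin p) / sin del) - - sin p * ((c2 * cos p - c1 * cos q) / sin del))
          with (c1 * (sin q * cos p - cos q * sin p) / sin del) by (field; lra).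
        rewrite <- Ed. field. lra.
      + replace (Re (expi (- q) * (vx, vy))%C)
          with c2; [now apply S2|].
        unfold expi, Re, Cmult; simpl. rewrite cos_neg, sin_neg. unfold vx, vy.
        replace (cos q * ((c1 * sin q - c2 * sin p) / sin del) - - sin q * ((c2 * cos p - c1 * cos q) / sin del))
          with (c2 * (sin q * cos p - cos q * sin p) / sin del) by (field; lra).
        rewrite <- Ed. field. lra. }
  destruct Hv as [w0 [V1 V2]]. exists w0. intros w Hw.
  assert (M : forall a, (a * (w - w0))%C = (a * w - a * w0)%C) by (intros; ring).
  apply half_planes_in_sector; [easy| |]; rewrite M, Re_minus.
  - specialize (V1 w Hw). lra.
  - specialize (V2 w Hw). lra.
Qed.

Lemma opposite_barriers_strip (p : R) (y : C) : E y -> barrier p -> barrier (p + PI) ->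
  exists a c, a < c /\ forall w, E w -> open_strip p a c w.
Proof.
  intros Hy [c1 H1] [c2 H2].
  pose proof (open_strict _ _ H1) as S1. pose proof (open_strict _ _ H2) as S2.
  assert (Hop : forall w, Re (expi (- (p + PI)) * w)%C = - Re (expi (- p) * w)%C).
  { intros w. unfold expi. rewrite !cos_neg, !sin_neg, neg_cos, neg_sin. destruct w.
    unfold Re, Cmult; simpl. ring. }
  exists (- c2), c1.
  assert (H : forall w, E w -> open_strip p (- c2) c1 w).
  { intros w Hw. unfold open_strip. specialize (S1 w Hw). specialize (S2 w Hw).
    rewrite Hop in S2. lra. }
  split; [|exact H]. specialize (H y Hy). unfold open_strip in H. lra.
Qed.

(** Two barrier directions at distance [(1 - gam) PI] would enclose [E] in a
    sector of aperture [gam PI], and two opposite ones in a strip. So all of them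
    lie on an arc of length at most [(1 - gam) PI], by convexity of the barrier
    cone. The directions at an angle of at least [PI / 2] from the whole arc form
    a sector of aperture at least [gam PI]. Moving along them never leaves [E],
    because a line separating the moved point from [E] would have its normal in
    the barrier cone. *)
Lemma recession_sector (y : C) (p0 gam : R) : E y -> barrier p0 -> 0 < gam < 1 ->
  (forall phi a c, a < c -> ~ (forall w, E w -> open_strip phi a c w)) ->
  (forall w0 phi, ~ (forall w, E w -> open_sector w0 phi (gam * PI) w)) ->
  exists psi, forall s w t, Rabs s <= gam * PI / 2 -> E w -> 0 <= t ->
    E (w + t * expi (psi + s))%C.
Proof.
  intros Hy Hp0 Hgam Hstrip Hsector. pose proof PI_RGT_0 as HPI.
  set (del := (1 - gam) * PI). assert (Hdel : 0 < del < PI) by (unfold del; split; nra).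
  set (B0 := fun p => barrier p /\ Rabs (p - p0) < PI).
  assert (Hwidth : forall p1 p2, B0 p1 -> B0 p2 -> p2 - p1 <= del).
  { intros p1 p2 [B1 A1] [B2 A2]. apply Rabs_def2 in A1. apply Rabs_def2 in A2.
    apply Rnot_lt_le. intros L.
    assert (Bm : barrier (p1 + del)).
    { destruct (Rle_lt_dec (p1 + del) p0) as [L0|L0].
      - apply (barrier_between p1 _ p0); auto; lra.
      - apply (barrier_between p0 _ p2); auto; lra. }
    destruct (two_barriers_sector p1 del) as [w0 Hw0]; auto; [lra|].
    apply (Hsector w0 (p1 + del / 2 + PI)).
    replace (gam * PI) with (PI - del) by (unfold del; ring). exact Hw0. }
  assert (B00 : B0 p0).
  { split; [easy|]. replace (p0 - p0) with 0 by ring. rewrite Rabs_R0. lra. }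
  destruct (completeness B0) as [bp [Hbp1 Hbp2]].
  { exists (p0 + PI). intros p [_ A]. apply Rabs_def2 in A. lra. }
  { now exists p0. }
  destruct (completeness (fun p => B0 (- p))) as [bm [Hbm1 Hbm2]].
  { exists (- p0 + PI). intros p [_ A]. apply Rabs_def2 in A. lra. }
  { exists (- p0). now rewrite Ropp_involutive. }
  assert (Hlen : bp + bm <= del).
  { assert (bp <= del - bm); [|lra]. apply Hbp2. intros p2 H2.
    assert (bm <= del - p2); [|lra]. apply Hbm2. intros p1 H1.
    pose proof (Hwidth _ _ H1 H2). lra. }
  exists ((bp - bm) / 2 + PI). intros s w t Hs Hw Ht. apply NNPP. intros Hno.
  destruct (separation y _ Hy Hno) as [phi Hphi].
  assert (Bphi : barrier phi) by (eexists; exact Hphi).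
  (* the representative of [phi] modulo [2 PI] closest to [p0] *)
  destruct (polar_form (expi (phi - p0))) as [sg [Hsg Esg]].
  rewrite Cmod_expi, Cmult_1_l in Esg.
  set (p := p0 + sg).
  assert (Ep : expi phi = expi p).
  { unfold p. rewrite expi_plus, <- Esg, <- expi_plus. f_equal. ring. }
  assert (Bp : barrier p) by now apply (barrier_expi phi).
  assert (Ep' : expi (- phi) = expi (- p)).
  { unfold expi in *. rewrite !cos_neg, !sin_neg. congruence. }
  assert (Hp : B0 p).
  { split; [easy|]. unfold p. replace (p0 + sg - p0) with sg by ring. apply Rabs_def1; [|lra].
    destruct (proj2 Hsg) as [L|L]; [easy|]. exfalso. subst sg.
    destruct (opposite_barriers_strip p0 y Hy Hp0 Bp) as [a [c [Hac HC]]].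
    exact (Hstrip p0 a c Hac HC). }
  assert (P1 : p <= bp) by now apply Hbp1.
  assert (P2 : - p <= bm) by (apply Hbm1; now rewrite Ropp_involutive).
  pose proof (open_strict phi _ Hphi w Hw) as S. rewrite Ep' in S.
  rewrite Cmult_plus_distr_l, re_plus, Re_expi_mult in S.
  replace (- p + ((bp - bm) / 2 + PI + s)) with ((bp - bm) / 2 - p + s + PI) in S by lra.
  rewrite neg_cos in S. apply Rabs_le_between in Hs.
  assert (0 <= cos ((bp - bm) / 2 - p + s)) by (apply cos_ge_0; unfold del in *; lra).
  nra.
Qed.

End PlaneConvex.

(** * The angle at infinity *)

Section ConvexRange.

Variable f : C -> C.
Hypothesis hf : class_C f.

Lemma range_open (w : C) : image f unit_disk w ->
  exists d, 0 < d /\ forall y, Cmod (y - w) < d -> image f unit_disk y.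
Proof.
  intros [z [Hz ->]]. destruct hf as [HS _].
  destruct (class_S_regular f HS) as [_ [_ [Hh _]]]. destruct HS as [_ [Hinj _]].
  pose proof Hz as Hz'. unfold unit_disk in Hz'.
  destruct (univalent_locally_onto f Hh Hinj z ((1 - Cmod z) / 2) Hz) as [d [Hd D]]; [lra|].
  exists d. split; [easy|]. intros y Hy. destruct (D y Hy) as [x [Hx <-]].
  exists x. split; [|easy]. unfold unit_disk. pose proof (Cmod_le_center x z). lra.
Qed.

(** The conformal radius at [f 0] is at least the radius of any disk about [f 0]
    in the range, so the range is not the whole plane and has a supporting
    line. *)
Lemma range_barrier : exists p, barrier (image f unit_disk) p.
Proof.
  destruct hf as [HS Hconv].
  destruct (class_S_regular f HS) as [H1 [_ [Hh _]]]. pose proof HS as [_ [Hinj _]].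
  assert (H0 : image f unit_disk (f 0)) by (exists 0; split; [apply unit_disk_0|easy]).
  assert (Hb : exists b, ~ image f unit_disk b).
  { apply NNPP. intros Hno.
    assert (Hall : forall b, image f unit_disk b).
    { intros b. apply NNPP. intros Hb. apply Hno. now exists b. }
    pose proof (Cmod_ge_0 (C_derive f 0)).
    pose proof (univalent_distance_le_radius f Hh Hinj 0 _ (Cmod (C_derive f 0) + 1)
      unit_disk_0 (H1 0 unit_disk_0) ltac:(lra) (fun w _ => Hall w)) as K.
    rewrite Cmod_0 in K. nra. }
  destruct Hb as [b Hb].
  destruct (separation _ Hconv range_open (f 0) b H0 Hb) as [p Hp].
  exists p. now exists (Re (expi (- p) * b)%C).
Qed.

(** The set of which [angle_at_infinity] is the infimum. *)
Definition aperture (theta : R) : Prop :=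
  0 <= theta <= PI /\ exists T, sector_of_aperture theta T /\ forall w, image f unit_disk w -> T w.

Lemma aperture_ge (theta b : R) : aperture theta -> theta / PI < b ->
  exists z, unit_disk z /\ Cmod (A_op f z) <= b.
Proof.
  intros [_ [T [HT HTf]]] Hb. pose proof PI_RGT_0 as HPI. destruct hf as [HS _].
  destruct (class_S_regular f HS) as [H1 [H2 [Hh [_ H0]]]].
  destruct HT as [[Hth [w0 [phi0 Hs]]]|[-> [phi [a [c [Hac Hs]]]]]].
  - apply (lower_order_sector f H1 H2 H0 Hh w0 phi0 theta); auto.
    intros w Hw. now apply Hs, HTf.
  - apply (lower_order_strip f H1 H2 H0 Hh phi a c); auto.
    + intros w Hw. now apply Hs, HTf.
    + unfold Rdiv in Hb. lra.
Qed.

(** A half-plane contains the range, which settles the case [|A_f zeta| >= 1]. If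
    the bound failed in the other case, the range would lie in no strip and in no
    sector of aperture [gam PI] for some [gam > |A_f zeta|]; then it would be
    invariant under the translations of such a sector, against
    [A_op_ge_recession]. *)
Lemma aperture_le (zeta : C) (r : R) : unit_disk zeta ->
  (forall theta, aperture theta -> r <= theta) -> r <= Cmod (A_op f zeta) * PI.
Proof.
  intros Hz Hr. pose proof PI_RGT_0 as HPI.
  destruct hf as [HS Hconv].
  destruct (class_S_regular f HS) as [H1 [H2 [Hh [Hh1 H0]]]]. pose proof HS as [_ [Hinj _]].
  destruct range_barrier as [p0 Hp0].
  set (al := Cmod (A_op f zeta)). assert (Hal : 0 <= al) by apply Cmod_ge_0.
  assert (Hfz : image f unit_disk (f zeta)) by now exists zeta.
  (* a half-plane is a sector of aperture [PI] *)
  assert (HrPI : r <= PI).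
  { apply Hr. split; [lra|].
    destruct (two_barriers_sector _ range_open p0 0) as [w0 Hw0]; [lra|easy|now rewrite Rplus_0_r|].
    eexists. split; [|exact Hw0]. left. split; [lra|].
    exists w0, (p0 + 0 / 2 + PI). intros w. now rewrite Rminus_0_r. }
  apply Rnot_lt_le. intros L.
  assert (Hal1 : al < 1) by nra.
  set (gam := (al + r / PI) / 2).
  assert (Hrp : al < r / PI <= 1).
  { split; apply Rmult_lt_reg_r with PI || apply Rmult_le_reg_r with PI; try easy;
      unfold Rdiv; rewrite Rmult_assoc, Rinv_l; lra. }
  assert (Hg : al < gam < 1) by (unfold gam; lra).
  assert (Hgr : gam * PI < r).
  { assert (gam < r / PI) by (unfold gam; lra).
    replace r with (r / PI * PI) by (field; lra). now apply Rmult_lt_compat_r. }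
  destruct (recession_sector _ Hconv range_open (f zeta) p0 gam Hfz Hp0) as [psi Hpsi].
  - lra.
  - intros phi a c Hac H. assert (r <= 0); [|nra]. apply Hr. split; [lra|].
    exists (open_strip phi a c). split; [|exact H]. right. split; [easy|].
    exists phi, a, c. split; [easy|]. now intros w.
  - intros w0 phi H. assert (r <= gam * PI); [|lra]. apply Hr. split; [nra|].
    exists (open_sector w0 phi (gam * PI)). split; [|exact H]. left. split; [nra|].
    exists w0, phi. now intros w.
  - assert (gam <= al); [|lra].
    apply (A_op_ge_recession f H1 Hh Hinj H2 Hh1 psi gam zeta); auto; [lra|].
    intros s Hs w t Hw Ht. now apply Hpsi.
Qed.

End ConvexRange.

Theorem theorem4 (f : C -> C) (hf : class_C f) :
  angle_at_infinity (image f unit_disk) = Rbar_mult (lower_order f) PI.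
Proof.
  pose proof PI_RGT_0 as HPI. unfold lower_order.
  set (SA := fun r : R => exists zeta : C, unit_disk zeta /\ r = Cmod (A_op f zeta)).
  pose proof (Glb_Rbar_correct SA) as [Hlb Hglb].
  assert (H0 : SA (Cmod (A_op f 0))) by (exists 0; split; [apply unit_disk_0|easy]).
  assert (Hge0 : Rbar_le 0 (Glb_Rbar SA)).
  { apply Hglb. intros r [z [_ ->]]. apply Cmod_ge_0. }
  destruct (Glb_Rbar SA) as [beta| |].
  2:{ destruct (Hlb _ H0). }
  2:{ destruct Hge0. }
  simpl. apply is_glb_Rbar_unique.
  change (is_glb_Rbar (aperture f) (beta * PI)).
  assert (Hlow : forall r, (forall theta, aperture f theta -> r <= theta) -> r <= beta * PI).
  { intros r Hr.
    assert (B : Rbar_le (r / PI) beta).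
    { apply Hglb. intros a [z [Hz ->]]. pose proof (aperture_le f hf z r Hz Hr).
      simpl. apply Rmult_le_reg_r with PI; [easy|].
      unfold Rdiv. rewrite Rmult_assoc, Rinv_l; lra. }
    simpl in B. replace r with (r / PI * PI) by (field; lra).
    apply Rmult_le_compat_r; lra. }
  split.
  - intros theta Hth. simpl.
    replace theta with (theta / PI * PI) by (field; lra). apply Rmult_le_compat_r; [lra|].
    apply Rnot_lt_le. intros L.
    destruct (aperture_ge f hf theta ((theta / PI + beta) / 2) Hth) as [z [Hz Hb]]; [lra|].
    assert (HA : SA (Cmod (A_op f z))) by now exists z.
    specialize (Hlb _ HA). simpl in Hlb. lra.
  - intros [r| |] Hr; simpl; [apply Hlow, Hr| |easy].
    assert (beta * PI + 1 <= beta * PI); [|lra].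
    apply Hlow. intros theta Hth. destruct (Hr theta Hth).
Qed.
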